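(* Let $R$ be a commutative ring. The following conditions are equivalent: (1) every cotorsion $R$-module is pure-injective; (2) $R$ is P-coherent and every pure-essential extension of $R$-modules is essential; (3) $R$ is P-coherent and every RD-essential extension of $R$-modules is essential; (4) an $R$-module $M$ is pure-injective if and only if $\mathrm{Ext}_R^1(C,M)=0$ for every cyclic flat $R$-module $C$; (5) there exists a family $\mathfrak{E}$ of pairwise orthogonal irreducible (primitive) idempotents of $R$ such that (a) for each $e\in\mathfrak{E}$, $R/R(1-e)$ is a pure-semisimple ring which is not a field, and (b) $R/A$ is a von Neumann regular ring, where $A=\bigoplus_{e\in\mathfrak{E}}Re$. Moreover, when these conditions hold: (6) for every $R$-module $M$, $\mathrm{PE}(M)/M$ is flat, FP-injective and regular; and (7) every Warfield cotorsion $R$-module is RD-injective.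
   Context: All rings have identity and modules are unitary. A module $M$ is cotorsion if $\mathrm{Ext}^1_R(F,M)=0$ for every flat $F$; Warfield cotorsion if $\mathrm{Ext}^1_R(F,M)=0$ for every P-flat $F$, where $F$ is P-flat if $\mathrm{Tor}_1^R(R/rR,F)=0$ for all $r\in R$. $R$ is P-coherent if every principal ideal is finitely presented. A short exact sequence is pure (resp. RD-pure) if it stays exact after tensoring with every module (resp. every module $R/rR$, $r\in R$); a module is pure-injective (resp. RD-injective) if it is injective relative to pure (resp. RD-pure) exact sequences. $R$ is pure-semisimple if every module is pure-injective. A module $M$ is FP-injective if $\mathrm{Ext}^1_R(F,M)=0$ for all finitely presented $F$; it is regular if all its submodules are pure submodules. An extension $A\subseteq B$ is pure-essential (resp. RD-essential) if $A$ is a pure (resp. RD-pure) submodule of $B$ and for every submodule $K$ of $B$, either $K\cap A\neq 0$ or $(A+K)/K$ is not a pure (resp. RD-pure) submodule of $B/K$. $\mathrm{PE}(M)$ denotes the pure-injective hull of $M$: a pure-injective module that is a pure-essential extension of $M$.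
   Formalization: In the definitions of pure-essential and RD-essential extension, the submodule K is taken to be nonzero, since with K = 0 allowed no extension would qualify and the equivalence would fail (e.g. for the integers); the zero ring, where all is trivial, is excluded. *)

(* Defs.v *)
From HB Require Import structures.
From mathcomp Require Import all_boot all_algebra.
Set Implicit Arguments. Unset Strict Implicit. Unset Printing Implicit Defensive.
Import GRing.Theory.
Local Open Scope ring_scope.

Section ModuleTheory.
Variable R : comNzRingType.

Definition is_lin (M N : lmodType R) (f : M -> N) : Prop :=
  forall (a : R) (x y : M), f (a *: x + y) = a *: f x + f y.

Definition is_submod (M : lmodType R) (A : M -> Prop) : Prop :=
  A 0 /\ forall (a : R) (x y : M), A x -> A y -> A (a *: x + y).

Definition fin_gen_sub (M : lmodType R) (A : M -> Prop) : Prop :=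
  exists (n : nat) (s : 'I_n -> M),
    forall x, A x <-> exists c : 'I_n -> R, x = \sum_(i < n) c i *: s i.

Definition fin_pres_sub (N : lmodType R) (P : N -> Prop) : Prop :=
  exists (n : nat) (f : 'rV[R]_n -> N),
    [/\ is_lin f, (forall y, P y <-> exists v, y = f v)
      & fin_gen_sub (fun v => f v = 0)].

Definition fin_pres (N : lmodType R) : Prop := fin_pres_sub (fun _ : N => True).

Definition P_coherent : Prop :=
  forall r : R, fin_pres_sub (fun y : R^o => exists s : R, y = r * s).

Definition cyclic_mod (C : lmodType R) : Prop :=
  exists x : C, forall y : C, exists r : R, y = r *: x.

Definition ext1_vanish (F M : lmodType R) : Prop :=
  forall (E : lmodType R) (f : M -> E) (g : E -> F),
    is_lin f -> is_lin g -> injective f -> (forall z, exists y, g y = z) ->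
    (forall y, g y = 0 <-> exists x, y = f x) ->
    exists r : E -> M, is_lin r /\ forall x, r (f x) = x.

(** flat (equational criterion of flatness) *)
Definition flat (F : lmodType R) : Prop :=
  forall (n : nat) (r : 'I_n -> R) (x : 'I_n -> F),
    \sum_(i < n) r i *: x i = 0 ->
    exists (m : nat) (a : 'I_n -> 'I_m -> R) (y : 'I_m -> F),
      (forall i, x i = \sum_(j < m) a i j *: y j) /\
      (forall j, \sum_(i < n) r i * a i j = 0).

(** P-flat : Tor_1(R/rR, F) = 0 for all r, i.e. r x = 0 implies x \in ann(r) F *)
Definition P_flat (F : lmodType R) : Prop :=
  forall (r : R) (x : F), r *: x = 0 ->
    exists (m : nat) (a : 'I_m -> R) (y : 'I_m -> F),
      x = \sum_(j < m) a j *: y j /\ (forall j, r * a j = 0).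

Definition cotorsion (M : lmodType R) : Prop :=
  forall F : lmodType R, flat F -> ext1_vanish F M.

Definition warfield_cotorsion (M : lmodType R) : Prop :=
  forall F : lmodType R, P_flat F -> ext1_vanish F M.

Definition FP_injective (M : lmodType R) : Prop :=
  forall F : lmodType R, fin_pres F -> ext1_vanish F M.

(** (A + K)/K is a pure submodule of B/K  (finite systems of linear
    equations with constants in A solvable modulo K in B are solvable
    modulo K in A).  With K = 0 this is "A is a pure submodule of B". *)
Definition pure_sub_mod (B : lmodType R) (A K : B -> Prop) : Prop :=
  forall (m n : nat) (r : 'I_m -> 'I_n -> R) (a : 'I_m -> B),
    (forall i, A (a i)) ->
    (exists b : 'I_n -> B, forall i, K (\sum_(j < n) r i j *: b j - a i)) ->
    exists b : 'I_n -> B, (forall j, A (b j)) /\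
                          (forall i, K (\sum_(j < n) r i j *: b j - a i)).

Definition pure_sub (B : lmodType R) (A : B -> Prop) : Prop :=
  pure_sub_mod A (fun x => x = 0).

(** (A + K)/K is an RD-pure submodule of B/K :  (A+K)/K \cap r(B/K) = r((A+K)/K) *)
Definition rd_sub_mod (B : lmodType R) (A K : B -> Prop) : Prop :=
  forall (r : R) (a : B), A a ->
    (exists b : B, K (r *: b - a)) -> exists a' : B, A a' /\ K (r *: a' - a).

Definition rd_sub (B : lmodType R) (A : B -> Prop) : Prop :=
  rd_sub_mod A (fun x => x = 0).

Definition pure_injective (M : lmodType R) : Prop :=
  forall (A B : lmodType R) (f : A -> B) (g : A -> M),
    is_lin f -> is_lin g -> injective f -> pure_sub (fun y => exists x, y = f x) ->
    exists h : B -> M, is_lin h /\ forall x, h (f x) = g x.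

Definition rd_injective (M : lmodType R) : Prop :=
  forall (A B : lmodType R) (f : A -> B) (g : A -> M),
    is_lin f -> is_lin g -> injective f -> rd_sub (fun y => exists x, y = f x) ->
    exists h : B -> M, is_lin h /\ forall x, h (f x) = g x.

Definition regular_mod (M : lmodType R) : Prop :=
  forall A : M -> Prop, is_submod A -> pure_sub A.

Definition essential_ext (B : lmodType R) (A : B -> Prop) : Prop :=
  forall K : B -> Prop, is_submod K -> (exists x, K x /\ x <> 0) ->
    exists x, [/\ K x, A x & x <> 0].

Definition pure_essential_ext (B : lmodType R) (A : B -> Prop) : Prop :=
  pure_sub A /\
  forall K : B -> Prop, is_submod K -> (forall x, K x -> A x -> x = 0) ->
    pure_sub_mod A K -> forall x, K x -> x = 0.

Definition rd_essential_ext (B : lmodType R) (A : B -> Prop) : Prop :=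
  rd_sub A /\
  forall K : B -> Prop, is_submod K -> (forall x, K x -> A x -> x = 0) ->
    rd_sub_mod A K -> forall x, K x -> x = 0.

Definition primitive_idem (e : R) : Prop :=
  [/\ e * e = e, e <> 0 &
      forall f : R, f * f = f -> f * e = f -> f = 0 \/ f = e].

Definition principal_ideal (x : R) : R -> Prop := fun a => exists s : R, a = s * x.

(** the ideal generated by a set of elements (= \bigoplus_{e} R e for
    pairwise orthogonal idempotents) *)
Definition ideal_gen (E : R -> Prop) : R -> Prop :=
  fun x => exists (n : nat) (e c : 'I_n -> R),
    (forall i, E (e i)) /\ x = \sum_(i < n) c i * e i.

Definition quot_is_field (I : R -> Prop) : Prop :=
  ~ I 1 /\ forall x : R, ~ I x -> exists y : R, I (x * y - 1).

Definition quot_vN_regular (I : R -> Prop) : Prop :=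
  forall x : R, exists y : R, I (x - x * y * x).

(** R/I is pure-semisimple: every R/I-module (= R-module annihilated by I)
    is pure-injective *)
Definition quot_pure_semisimple (I : R -> Prop) : Prop :=
  forall M : lmodType R, (forall (a : R) (x : M), I a -> a *: x = 0) ->
    pure_injective M.

Definition cond1 : Prop := forall M : lmodType R, cotorsion M -> pure_injective M.

Definition cond2 : Prop :=
  P_coherent /\
  forall (B : lmodType R) (A : B -> Prop), is_submod A ->
    pure_essential_ext A -> essential_ext A.

Definition cond3 : Prop :=
  P_coherent /\
  forall (B : lmodType R) (A : B -> Prop), is_submod A ->
    rd_essential_ext A -> essential_ext A.

Definition cond4 : Prop :=
  forall M : lmodType R,
    pure_injective M <->
    (forall C : lmodType R, cyclic_mod C -> flat C -> ext1_vanish C M).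

Definition cond5 : Prop :=
  exists E : R -> Prop,
    [/\ forall e, E e -> primitive_idem e,
        forall e f, E e -> E f -> e <> f -> e * f = 0,
        forall e, E e -> quot_pure_semisimple (principal_ideal (1 - e)) /\
                         ~ quot_is_field (principal_ideal (1 - e))
      & quot_vN_regular (ideal_gen E)].

(** (6): for any pure-injective hull  f : M -> E  (E pure-injective, f(M)
    pure-essential in E) and any cokernel  g : E -> Q  of f,  Q = PE(M)/M
    is flat, FP-injective and regular *)
Definition cond6 : Prop :=
  forall (M E Q : lmodType R) (f : M -> E) (g : E -> Q),
    is_lin f -> injective f -> pure_injective E ->
    pure_essential_ext (fun y => exists x, y = f x) ->
    is_lin g -> (forall z, exists y, g y = z) ->
    (forall y, g y = 0 <-> exists x, y = f x) ->
    [/\ flat Q, FP_injective Q & regular_mod Q].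

Definition cond7 : Prop :=
  forall M : lmodType R, warfield_cotorsion M -> rd_injective M.

End ModuleTheory.

(* Main.v *)
From HB Require Import structures.
Require Import Defs.
From mathcomp Require Import all_boot all_algebra.
From mathcomp Require Import ring.
From mathcomp Require Import boolp classical_sets functions.
Set Implicit Arguments. Unset Strict Implicit. Unset Printing Implicit Defensive.
Import GRing.Theory Num.Theory.
Local Open Scope ring_scope.

(** (5) implies (4): let I be the ideal generated by the idempotents of (5).
    After dividing by a maximal complement, a pure extension X of M is
    pure-essential; since each eM is pure-injective, eX = eM, so X/M is a module
    over the von Neumann regular ring R/I, hence flat over R, and a Baer
    argument with cyclic flat modules splits M -> X.  The same remark gives (6)
    and the essential extensions of (2), and (4) implies (1) at once.

    (1) implies (5): pure-injective modules are then closed under extensions.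
    Let J be an injective module.  Extensions built from the pure-injective modules
    {f : L -> J | P_l f_l = 0}, tested against generalized limits of
    sequences, show that R has dimension zero, that its localizations are
    noetherian valuation rings, that x in R cannot be nonzero on infinitely many
    orthogonal idempotents unless it is regular there, and that every
    annihilator has a greatest idempotent.  Hence every nilpotent element lives
    on finitely many primitive idempotents e, with eR local and its maximal
    ideal nilpotent; eR-modules are iterated extensions of vector spaces.
    Since R is arithmetical, RD-pure submodules are pure, which gives (3) and (7).

    (2) or (3) implies (5): a pure submodule M of X has a complement K such
    that M is RD-pure and essential in X/K.  Applied to direct sums inside
    products this gives dimension zero, T-nilpotent local rings and the finiteness
    of idempotents; P-coherence makes the maximal ideal of eR, an annihilator of
    a socle element, finitely generated.  Two elements of the maximal ideal are
    dependent modulo its square, so it is principal, and a comparison of socles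
    shows that eR-modules are pure-injective. *)

(** * Submodules, quotients and push-outs *)

(** Vanishing of Ext against flat modules passes to extensions, while pure-injectivity in general
    does not. Under (1) the two classes coincide, so every extension of pure-injective modules is a
    retract of its reduced powers and has linear limits along any proper filter. The consequences of
    (1) mostly come from extensions built so that such a limit cannot exist. For (2) and (3) a
    direct sum inside a product replaces the limit: an element of the product that is a limit of
    elements of the sum is neither killed by a complement nor essential over the sum modulo it. One
    kind of complement serves both conditions, since it need only be RD-pure. The exception is the
    dependence modulo the square of the maximal ideal, proved twice: the finite example that serves
    for (3) is RD-pure but not pure, so (2) needs an infinite family of Kronecker modules. To argue
    with elements, purity and essentiality of (A + K)/K in B/K are stated inside B, and partial
    linear maps are graphs. *)

Section Basics.
Variable R : comNzRingType.

Section Lin.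
Variables (M N : lmodType R) (f : M -> N) (hf : is_lin f).

Lemma lin0 : f 0 = 0.
Proof. by have := hf (-1) 0 0; rewrite scaler0 addr0 scaleN1r addNr. Qed.
Lemma linD x y : f (x + y) = f x + f y.
Proof. by have := hf 1 x y; rewrite !scale1r. Qed.
Lemma linZ a x : f (a *: x) = a *: f x.
Proof. by have := hf a x 0; rewrite !addr0 lin0 addr0. Qed.
Lemma linN x : f (- x) = - f x.
Proof. by rewrite -scaleN1r linZ scaleN1r. Qed.
Lemma linB x y : f (x - y) = f x - f y.
Proof. by rewrite linD linN. Qed.
Lemma lin_sum I (r : seq I) (P : pred I) (F : I -> M) :
  f (\sum_(i <- r | P i) F i) = \sum_(i <- r | P i) f (F i).
Proof. by apply: (big_morph f linD lin0). Qed.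

Lemma lin_inj : (forall x, f x = 0 -> x = 0) -> injective f.
Proof.
by move=> h x y e; apply/eqP; rewrite -subr_eq0; apply/eqP/h; rewrite linB e subrr.
Qed.

Lemma inj_lin_eq0 : injective f -> forall x, f x = 0 -> x = 0.
Proof. by move=> h x e; apply: h; rewrite lin0. Qed.
End Lin.

Lemma lin_comp (M N P : lmodType R) (f : M -> N) (g : N -> P) :
  is_lin f -> is_lin g -> is_lin (g \o f).
Proof. by move=> hf hg a x y /=; rewrite hf hg. Qed.

Section Sub.
Variables (M : lmodType R) (A : M -> Prop) (hA : is_submod A).

Lemma submod0 : A 0. Proof. by case: hA. Qed.
Lemma submodZ a x : A x -> A (a *: x).
Proof. by move=> h; have := hA.2 a x 0 h submod0; rewrite addr0. Qed.
Lemma submodD x y : A x -> A y -> A (x + y).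
Proof. by move=> h k; have := hA.2 1 x y h k; rewrite scale1r. Qed.
Lemma submodN x : A x -> A (- x).
Proof. by move=> h; rewrite -scaleN1r; apply: submodZ. Qed.
Lemma submodB x y : A x -> A y -> A (x - y).
Proof. by move=> h k; apply: submodD => //; apply: submodN. Qed.
Lemma submod_sum I (r : seq I) (P : pred I) (F : I -> M) :
  (forall i, P i -> A (F i)) -> A (\sum_(i <- r | P i) F i).
Proof. by move=> h; apply: big_ind => //; [exact: submod0 | exact: submodD]. Qed.
Lemma submodBC x y : A (x - y) -> A (y - x).
Proof. by move=> h; rewrite -opprB; apply: submodN. Qed.
Lemma submod_trans y x z : A (x - y) -> A (y - z) -> A (x - z).
Proof. by move=> h k; have := submodD h k; rewrite addrA subrK. Qed.
Definition mem_of of is_submod A : pred M := fun x => `[< A x >].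

Fact mem_of_closed : GRing.submod_closed (mem_of hA).
Proof.
split; first by apply/asboolP/submod0.
by move=> a x y /asboolP hx /asboolP hy; apply/asboolP/hA.2.
Qed.
HB.instance Definition _ := GRing.isSubmodClosed.Build R M (mem_of hA) mem_of_closed.

Record subm := Subm { subm_val :> M; _ : mem_of hA subm_val }.
HB.instance Definition _ := [isSub for subm_val].
HB.instance Definition _ := [Choice of subm by <:].
HB.instance Definition _ := [SubChoice_isSubLmodule of subm by <:].

Lemma sub_exists : exists (S : lmodType R) (i : S -> M),
  [/\ is_lin i, injective i & forall x, A x <-> exists s, x = i s].
Proof.
exists subm, val; split.
- by move=> a x y; rewrite linearP.
- exact: val_inj.
- move=> x; split => [hx|[s ->]]; last by case: s => s /= /asboolP.
  by exists (Subm (asboolT hx)).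
Qed.

(** A choice from the coset of [x]: congruent elements have the same coset as a set, hence by
    extensionality the same representative, and the quotient can be the type of fixed points of
    [rep]. *)
Definition rep (x : M) : M := xget 0 [set y | A (x - y)]%classic.

Lemma repP x : A (x - rep x).
Proof. by rewrite /rep; case: xgetP => [y _ //|/(_ x)] /=; rewrite subrr => /(_ submod0). Qed.

Lemma rep_eq x y : A (x - y) -> rep x = rep y.
Proof.
move=> h; rewrite /rep; congr xget; apply/seteqP; split => z /= hz.
  by apply: (submod_trans _ hz); apply: submodBC.
exact: (submod_trans h hz).
Qed.

Lemma repA x y : rep x = rep y -> A (x - y).
Proof.
move=> e; apply: (submod_trans (repP x)); rewrite e; apply: submodBC; exact: repP.
Qed.

Definition quot_of of is_submod A : Type := {x : M | rep x == x}.
Local Notation Q := (quot_of hA).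
HB.instance Definition _ := Choice.on Q.

Lemma rep_rep x : rep (rep x) == rep x.
Proof. by apply/eqP/rep_eq/submodBC/repP. Qed.
Definition qpi (x : M) : Q := exist _ (rep x) (rep_rep x).

Lemma qpi_eq x y : A (x - y) -> qpi x = qpi y.
Proof. by move=> h; apply: val_inj => /=; apply: rep_eq. Qed.
Lemma qpi_eqA x y : qpi x = qpi y -> A (x - y).
Proof. by move=> /(congr1 val) /= /repA. Qed.
Lemma qpi_val (q : Q) : qpi (val q) = q.
Proof. by case: q => x hx; apply: val_inj => /=; apply/eqP. Qed.
Lemma val_qpi x : A (val (qpi x) - x).
Proof. by apply: submodBC; apply: repP. Qed.

Definition qadd (p q : Q) := qpi (val p + val q).
Definition qopp (p : Q) := qpi (- val p).
Definition qscale (a : R) (p : Q) := qpi (a *: val p).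

Lemma qaddE x y : qadd (qpi x) (qpi y) = qpi (x + y).
Proof. by apply: qpi_eq; rewrite opprD addrACA; apply: submodD; apply: val_qpi. Qed.
Lemma qoppE x : qopp (qpi x) = qpi (- x).
Proof. by apply: qpi_eq; rewrite -opprD; apply: submodN; apply: val_qpi. Qed.
Lemma qscaleE a x : qscale a (qpi x) = qpi (a *: x).
Proof. by apply: qpi_eq; rewrite -scalerBr; apply: submodZ; apply: val_qpi. Qed.

Lemma qind (P : Q -> Prop) : (forall x, P (qpi x)) -> forall q, P q.
Proof. by move=> h q; rewrite -(qpi_val q). Qed.

Fact qaddA : associative qadd.
Proof.
elim/qind=> x; elim/qind=> y; elim/qind => z.
by rewrite !qaddE addrA.
Qed.
Fact qaddC : commutative qadd.
Proof. by elim/qind=> x; elim/qind=> y; rewrite !qaddE addrC. Qed.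
Fact qadd0 : left_id (qpi 0) qadd.
Proof. by elim/qind=> x; rewrite !qaddE add0r. Qed.
Fact qaddN : left_inverse (qpi 0) qopp qadd.
Proof. by elim/qind=> x; rewrite qoppE !qaddE addNr. Qed.
HB.instance Definition _ := GRing.isZmodule.Build Q qaddA qaddC qadd0 qaddN.

Lemma qaddE' x y : qpi x + qpi y = qpi (x + y). Proof. exact: qaddE. Qed.

Fact qscaleA a b v : qscale a (qscale b v) = qscale (a * b) v.
Proof. by elim/qind: v => x; rewrite !qscaleE scalerA. Qed.
Fact qscale1 : left_id 1 qscale.
Proof. by elim/qind=> x; rewrite !qscaleE scale1r. Qed.
Fact qscaleDr : right_distributive qscale +%R.
Proof. by move=> a; elim/qind=> x; elim/qind => y; rewrite qaddE' !qscaleE qaddE' scalerDr. Qed.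
Fact qscaleDl v : {morph qscale^~ v : a b / a + b}.
Proof. by elim/qind: v => x a b; rewrite !qscaleE qaddE' scalerDl. Qed.
HB.instance Definition _ :=
  GRing.Zmodule_isLmodule.Build R Q qscaleA qscale1 qscaleDr qscaleDl.

Lemma quot_exists : exists (Q : lmodType R) (p : M -> Q),
  [/\ is_lin p, forall z, exists y, p y = z & forall x, p x = 0 <-> A x].
Proof.
exists Q, qpi; split.
- by move=> a x y; rewrite -qaddE' -qscaleE.
- by move=> z; exists (val z); rewrite qpi_val.
- move=> x; split=> h.
    by have := @qpi_eqA x 0 h; rewrite subr0.
  by apply: qpi_eq; rewrite subr0.
Qed.
End Sub.

Lemma lin_factor (M N Q : lmodType R) (p : M -> Q) (f : M -> N) :
  is_lin p -> (forall z, exists y, p y = z) -> is_lin f ->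
  (forall x, p x = 0 -> f x = 0) ->
  exists g : Q -> N, is_lin g /\ forall x, g (p x) = f x.
Proof.
move=> hp sp hf h; have [s hs] := choice sp.
have e x : f (s (p x)) = f x.
  apply/eqP; rewrite -subr_eq0 -(linB hf); apply/eqP/h.
  by rewrite (linB hp) hs subrr.
exists (f \o s); split => // a x y /=.
by rewrite -{1}(hs x) -{1}(hs y) -hp e hf.
Qed.

Lemma lin_lift (M N S : lmodType R) (i : S -> M) (f : N -> M) :
  is_lin i -> injective i -> is_lin f -> (forall x, exists s, f x = i s) ->
  exists g : N -> S, is_lin g /\ forall x, i (g x) = f x.
Proof.
move=> hi ii hf h; have [g hg] := choice h.
exists g; split => // a x y.
by apply: ii; rewrite hi -!hg hf.
Qed.

(** The quotient of [M * B] by the antidiagonal copy of [A]. Generation, the exact ambiguity of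
    [j m + h b] and the universal property are recorded so that the quotient need not be opened
    again. *)
Lemma pushout (A B M : lmodType R) (i : A -> B) (g : A -> M) :
  is_lin i -> is_lin g -> injective i ->
  exists (P : lmodType R) (j : M -> P) (h : B -> P),
  [/\ is_lin j, is_lin h, injective j, forall x, h (i x) = j (g x) &
  [/\ forall z, exists m b, z = j m + h b,
      forall m b, j m + h b = 0 -> exists a, b = - i a /\ m = g a &
      forall (T : lmodType R) (u : M -> T) (v : B -> T), is_lin u -> is_lin v ->
        (forall a, v (i a) = u (g a)) ->
        exists w : P -> T, [/\ is_lin w, forall m, w (j m) = u m & forall b, w (h b) = v b]]].
Proof.
move=> hi hg ii.
pose K (z : M * B) := exists a, z = (g a, - i a).
have hK : is_submod K.
  split; first by exists 0; rewrite (lin0 hi) (lin0 hg) oppr0.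
  move=> r _ _ [a ->] [b ->]; exists (r *: a + b); rewrite hi hg.
  by rewrite opprD -scalerN.
have [P [p [hp sp kp]]] := quot_exists hK.
exists P, (fun m => p (m, 0)), (fun b => p (0, b)).
have hj : is_lin (fun m => p (m, 0)).
  by move=> r x y; rewrite -hp; congr p; congr (_, _) => //=; rewrite scaler0 addr0.
have hh : is_lin (fun b => p (0, b)).
  by move=> r x y; rewrite -hp; congr p; congr (_, _) => //=; rewrite scaler0 addr0.
have sum m b : p (m, 0) + p (0, b) = p (m, b).
  by rewrite -(linD hp); congr p; congr (_, _) => /=; rewrite ?addr0 ?add0r.
split => //.
- apply: (lin_inj hj) => m /kp [a [-> /esym /eqP]].
  rewrite oppr_eq0 => /eqP /(inj_lin_eq0 hi ii) ->.
  exact: lin0.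
- move=> x; apply/esym/eqP; rewrite -subr_eq0 -(linB hp); apply/eqP/kp.
  by exists x; congr (_, _) => /=; rewrite ?subr0 ?sub0r.
split.
- by move=> z; have [[m b] <-] := sp z; exists m, b; rewrite sum.
- by move=> m b; rewrite sum => /kp [a [-> ->]]; exists a.
- move=> T u v hu hv e.
  have [w [hw we]] := @lin_factor (M * B)%type T P p (fun z => u z.1 + v z.2) hp sp
     ltac:(by move=> r x y /=; rewrite hu hv scalerDr addrACA)
     ltac:(by move=> x /kp [a ->] /=; rewrite (linN hv) e subrr).
  exists w; split => // [m|b]; rewrite we /=.
    by rewrite (lin0 hv) addr0.
  by rewrite (lin0 hu) add0r.
Qed.

End Basics.

(** * Zorn's lemma and injective modules *)

Section Zorn.
Variable R : comNzRingType.
Local Open Scope classical_set_scope.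

Lemma zorn_submod (V : lmodType R) (S0 : set V) (P : set V -> Prop) :
  is_submod S0 -> P S0 ->
  (forall F : set (set V), F !=set0 ->
     (forall X, F X -> [/\ is_submod X, S0 `<=` X & P X]) ->
     total_on F subset -> P (\bigcup_(X in F) X)) ->
  exists S : set V, [/\ is_submod S, S0 `<=` S, P S &
    forall T : set V, is_submod T -> S `<=` T -> P T -> T `<=` S].
Proof.
move=> hS0 PS0 chain.
pose Q (X : set V) := X = set0 \/ [/\ is_submod X, S0 `<=` X & P X].
have [|S [QS maxS]] := @Zorn_bigcup V Q.
  move=> F FQ tF.
  have [[X [FX X0]]|none] := pselect (exists X, F X /\ X <> set0); last first.
    left; rewrite bigcup0 // => X FX; apply: contrapT => X0; apply: none.
    by exists X.
  right; pose F' := [set X | F X /\ X <> set0].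
  have eF : \bigcup_(X in F) X = \bigcup_(X in F') X.
    apply/seteqP; split => x [Y FY Yx]; exists Y => //; last by case: FY.
    by split => // Y0; rewrite Y0 in Yx.
  have F'P Y : F' Y -> [/\ is_submod Y, S0 `<=` Y & P Y].
    by case=> FY Y0; case: (FQ _ FY).
  have tF' : total_on F' subset by move=> Y Z [FY _] [FZ _]; exact: tF.
  rewrite eF; split; last by apply: chain => //; exists X.
  - split; first by exists X => //; case: (F'P X (conj FX X0)) => [[]].
    move=> a x y [Y FY Yx] [Z FZ Zy].
    have [sYZ|sZY] := tF' _ _ FY FZ.
      by exists Z => //; case: (F'P Z FZ) => hZ _ _; apply: hZ.2 => //; exact: sYZ.
    by exists Y => //; case: (F'P Y FY) => hY _ _; apply: hY.2 => //; exact: sZY.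
  - by move=> x S0x; exists X => //; case: (F'P X (conj FX X0)) => _ + _; apply.
case: QS => [S_0|[hS sS PS]].
  case: (maxS S0); last by right; split.
  split; first by rewrite S_0; exact: sub0set.
  by move=> sub; have := submod0 hS0 => /sub; rewrite S_0.
exists S; split => // T hT sST PT; apply: contrapT => nTS.
by apply: (maxS T) => //; right; split => //; apply: subset_trans sST.
Qed.

(** The graph of a linear map defined on a submodule of [B]: unions of chains and one-element
    extensions then need no subtypes. *)
Definition graph_fun (B M : lmodType R) (G : B * M -> Prop) :=
  is_submod G /\ forall m, G (0, m) -> m = 0.

Lemma graph_fun_uniq (B M : lmodType R) (G : B * M -> Prop) b m m' :
  graph_fun G -> G (b, m) -> G (b, m') -> m = m'.
Proof.
case=> hG fG h h'; apply/eqP; rewrite -subr_eq0; apply/eqP/fG.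
by have : G (b - b, m - m') := submodB hG h h'; rewrite subrr.
Qed.

(** Zorn's lemma on partial maps. The hypothesis is Baer's condition: on the multiples of [x]
    already in the domain the map is multiplication by some [m], which is what adjoining [x]
    requires. *)
Lemma graph_extend (B M : lmodType R) (G0 : B * M -> Prop) :
  graph_fun G0 ->
  (forall G : B * M -> Prop, graph_fun G -> (forall z, G0 z -> G z) -> forall x,
     exists m, forall r m', G (r *: x, m') -> m' = r *: m) ->
  exists h : B -> M, is_lin h /\ forall b m, G0 (b, m) -> h b = m.
Proof.
move=> [hG0 fG0] step.
have [|G [hG sG fG maxG]] :=
   @zorn_submod (B * M)%type G0 (fun G => forall m, G (0, m) -> m = 0) hG0 fG0.
  by move=> F _ hF _ m [X /hF [_ _ +] Xm]; apply.
have GG : graph_fun G by [].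
have tot x : exists m, G (x, m).
  have [m hm] := step G GG sG x.
  pose T (z : B * M) := exists b n r, G (b, n) /\ z = (b + r *: x, n + r *: m).
  have hT : is_submod T.
    split; first by exists 0, 0, 0; split; [exact: (submod0 hG)|rewrite !scale0r !addr0].
    move=> a _ _ [b [n [r [g ->]]]] [b' [n' [r' [g' ->]]]].
    exists (a *: b + b'), (a *: n + n'), (a * r + r').
    split; first exact: (hG.2 a _ _ g g').
    by congr (_, _); rewrite /= scalerDr scalerDl scalerA addrACA.
  have sGT : G `<=` T.
    by move=> [b n] g; exists b, n, 0; rewrite !scale0r !addr0.
  have fT n : T (0, n) -> n = 0.
    move=> [b [n' [r [g [eb ->]]]]].
    have eb' : - b = r *: x.
      by apply/eqP; rewrite eq_sym -addr_eq0 addrC -eb.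
    have : G (- b, - n') := submodN hG g; rewrite eb' => /hm <-.
    by rewrite subrr.
  apply: ex_intro; apply: (maxG T hT sGT fT).
  by exists 0, 0, 1; split; [exact: (submod0 hG)|rewrite !scale1r !add0r].
have [h hh] := choice tot.
exists h; split.
  by move=> a x y; apply: (graph_fun_uniq GG (hh _)); apply: (hG.2 a (_, _) (_, _)).
by move=> b m /sG; apply: graph_fun_uniq.
Qed.

Definition inj_graph (J : lmodType R) := forall (B : lmodType R) (G : B * J -> Prop),
  graph_fun G -> exists h : B -> J, is_lin h /\ forall b m, G (b, m) -> h b = m.

Lemma baer (J : lmodType R) :
  (forall G : R^o * J -> Prop, graph_fun G ->
     exists u, forall r v, G (r, v) -> v = r *: u) -> inj_graph J.
Proof.
move=> hJ B G0 hG0; apply: graph_extend => // G hG _ x.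
have [|u hu] := hJ (fun z => G (z.1 *: x, z.2)); last by exists u => r m' /(hu r m').
split.
  split; first by rewrite /= scale0r; exact: (submod0 hG.1).
  move=> a [r v] [r' v'] /= h h'.
  by have := hG.1.2 a _ _ h h'; rewrite scalerDl -scalerA.
by move=> m /=; rewrite scale0r; exact: hG.2.
Qed.

Definition is_ideal (I : R -> Prop) := @is_submod R R^o I.

Definition maximal_ideal (m : R -> Prop) :=
  [/\ is_ideal m, ~ m 1 & forall s, ~ m s -> exists t, m (1 - s * t)].

Lemma maximal_ideal_exists (I : R -> Prop) : is_ideal I -> ~ I 1 ->
  exists m, maximal_ideal m /\ forall s, I s -> m s.
Proof.
move=> hI I1.
have [|m [hm sm m1 maxm]] := @zorn_submod R^o I (fun X => ~ X 1) hI I1.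
  by move=> F _ hF _ [X /hF [_ _ +] X1]; apply.
exists m; split => //; split => // s ms.
pose T (z : R^o) := exists t, m (z - s * t).
have hT : is_submod T.
  split; first by exists 0; rewrite mulr0 subrr; exact: (submod0 hm).
  move=> a x y [t ht] [t' ht']; exists (a * t + t').
  have := hm.2 a _ _ ht ht'; congr m.
  by rewrite /GRing.scale /=; ring.
apply: contrapT => no; apply: ms; apply: (maxm T) => //.
- by move=> x mx; exists 0; rewrite mulr0 subr0.
- by exists 1; rewrite mulr1 subrr; exact: (submod0 hm).
Qed.
End Zorn.

(** * The cogenerator Q/Z and coinduced injective modules *)

(** [D] is Q/Z: it is injective by Baer's criterion because values can be divided in Q. *)
Lemma int_injective_cogenerator : exists (D : lmodType int),
  inj_graph D /\ forall (M : lmodType int) (m : M), m <> 0 ->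
     exists h : M -> D, is_lin h /\ h m <> 0.
Proof.
pose Q : lmodType int := ssrint.zmodule rat.
pose K (x : Q) := exists n : int, (x : rat) = n%:~R.
have hK : is_submod K.
  split; first by exists 0.
  move=> a x y [n ->] [n' ->]; exists (a * n + n').
  by rewrite scalezrE intrD intrM mulrzl.
have [D [p [hp sp kp]]] := quot_exists hK.
have DJ : inj_graph D.
  apply: baer => G [hG fG].
  (* The domain of [G] is an ideal of Z, generated by its least positive element [d] if there is
     one; the value at [d] is then divided by [d]. *)
  have [[d [d0 [v0 Gd]]]|none] := pselect (exists d : nat, (0 < d)%N /\ exists v, G (d%:Z, v)).
    have ex : exists d : nat, (0 < d)%N && `[< exists v, G (d%:Z, v) >].
      by exists d; rewrite d0; apply/asboolP; exists v0.
    case: (ex_minnP ex) => {d d0 v0 Gd ex} d /andP[d0 /asboolP[v Gd]] min.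
    have [q hq] := sp v.
    have dz : (d%:Z != 0) by rewrite eqz_nat -lt0n.
    exists (p ((q : rat) / d%:~R)) => r u Gr.
    have Grem : G ((r %% d)%Z, u - (r %/ d)%Z *: v).
      have h : G (r - (r %/ d)%Z * d%:Z, u - (r %/ d)%Z *: v) :=
        submodB hG Gr (submodZ hG (r %/ d)%Z Gd).
      by rewrite {1}(divz_eq r d) addrAC subrr add0r in h.
    have rem0 : (r %% d)%Z = 0.
      have : (0 <= (r %% d)%Z)%R by apply: modz_ge0.
      case E : (r %% d)%Z => [k|k] // _.
      case: k E => // k E.
      have := min k.+1; rewrite /= => /(_ _)/wrap [|].
        by apply/asboolP; rewrite -E; eexists; exact: Grem.
      have : ((r %% d)%Z < d)%R by rewrite ltz_pmod.
      by rewrite E ltz_nat ltnNge => /negP h /h.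
    move: Grem; rewrite rem0 => /fG /eqP; rewrite subr_eq0 => /eqP ->.
    rewrite {2}(divz_eq r d) rem0 addr0 -hq -!(linZ hp) !scalezrE; congr p.
    rewrite -[(q : rat) in LHS]/(q : rat).
    have e : (q : rat) = ((q : rat) / d%:~R) *~ d.
      by rewrite -[RHS]mulrzr mulfVK // intr_eq0.
    by rewrite [((r %/ d)%Z * d)%R]mulrC mulrzA -e.
  exists 0 => r v Gr; rewrite scaler0; apply: fG.
  suff r0 : r = 0 by rewrite -r0.
  apply: contrapT => /eqP r0; apply: none; exists `|r|%N; split.
    by rewrite absz_gt0.
  case: r r0 Gr => k r0 Gr; first by exists v.
  by exists (- v); have := submodN hG Gr; congr G.
exists D; split => // M m m0.
(* The class of [q] will be the value at [m]: 1/d if [m] has finite order [d], and 1/2 if the order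
   is infinite, when any non-integer would do. *)
have [q [hq1 hq2]] : exists q : rat, (forall n : int, n *: m = 0 -> exists k : int, q *~ n = k%:~R)
   /\ ~ exists k : int, q = k%:~R.
  have half (d : nat) : (1 < d)%N -> ~ exists k : int, (d%:R^-1 : rat) = k%:~R.
    move=> d1 [k hk].
    have dn0 : (d%:R : rat) != 0 by rewrite pnatr_eq0 -lt0n ltnW.
    have : (1%:~R : rat) = (k * d%:Z)%:~R by rewrite intrM -[d%:~R]/(d%:R) -hk mulVf.
    move=> /eqP; rewrite eqr_int => /eqP e.
    have : (d%:Z %| k * d%:Z)%Z by rewrite dvdz_mull.
    by rewrite -e dvdzE /= dvdn1 => /eqP d1'; rewrite d1' in d1.
  have [[d [d0 dm]]|none] := pselect (exists d : nat, (0 < d)%N /\ d%:Z *: m = 0).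
    have ex : exists d : nat, (0 < d)%N && (d%:Z *: m == 0).
      by exists d; rewrite d0 dm eqxx.
    case: (ex_minnP ex) => {d d0 dm ex} d /andP[d0 /eqP dm] min.
    have d1 : (1 < d)%N.
      rewrite ltn_neqAle d0 andbT; apply/eqP => e.
      by move: dm; rewrite -e scale1r.
    have dz : (d%:Z != 0) by rewrite eqz_nat -lt0n.
    exists (d%:R^-1); split; last exact: half.
    move=> n nm; exists (n %/ d)%Z.
    have rem0 : (n %% d)%Z = 0.
      have : (n %% d)%Z *: m = 0.
        by move: nm; rewrite {1}(divz_eq n d) scalerDl -scalerA dm scaler0 add0r.
      have : (0 <= (n %% d)%Z)%R by apply: modz_ge0.
      have : ((n %% d)%Z < d)%R by rewrite ltz_pmod.
      case: (n %% d)%Z => [[|k]|k] // lt _ km.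
      have := min k.+1; rewrite km eqxx /= => /(_ isT) h.
      by move: lt; rewrite ltz_nat ltnNge h.
    rewrite {1}(divz_eq n d) rem0 addr0 -mulrzr intrM mulrC -mulrA mulfV ?mulr1 //.
    by rewrite intr_eq0.
  exists (2%:R^-1); split; last exact: half.
  move=> n nm; exists 0; suff -> : n = 0 by [].
  apply: contrapT => /eqP n0; apply: none; exists `|n|%N; split; first by rewrite absz_gt0.
  case: n n0 nm => k k0 nm; first exact: nm.
  by apply/eqP; rewrite -oppr_eq0 -scaleNr; apply/eqP.
pose G (z : M * D) := exists n : int, z = (n *: m, p (q *~ n)).
have [|h [hh he]] := DJ M G.
  split.
    split; first by exists 0; rewrite scale0r mulr0z (lin0 hp).
    move=> a _ _ [n ->] [n' ->]; exists (a * n + n').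
    transitivity (a *: (n *: m) + n' *: m, a *: p (q *~ n) + p (q *~ n')) => //.
    congr (_, _); first by rewrite scalerDl scalerA.
    by rewrite -hp; congr p; rewrite scalezrE mulrzDr [(a * n)%R]mulrC mulrzA.
  by move=> u [n [/esym /hq1 [k hk] ->]]; apply/kp; exists k.
exists h; split => //.
have -> : h m = p q by apply: he; exists 1; rewrite scale1r.
by move/kp.
Qed.

Section Coinduced.
Variables (R : comNzRingType) (D : lmodType int) (L : Type).

Definition additive_at : pred (L -> R -> D) :=
  fun f => `[< forall l a b, f l (a + b) = f l a + f l b >].
Fact additive_at_closed : zmod_closed additive_at.
Proof.
split; first by apply/asboolP => l a b; rewrite -[RHS]/((0 : D) + 0) addr0.
move=> f g /asboolP hf /asboolP hg; apply/asboolP => l a b.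
rewrite -[LHS]/(f l (a + b) - g l (a + b)) hf hg opprD addrACA.
by [].
Qed.
HB.instance Definition _ :=
  GRing.isZmodClosed.Build (L -> R -> D) additive_at additive_at_closed.

(* Hom_Z(R, D)^L, on which R acts by (r f) l s = f l (s r). *)
Record coind := Coind { coind_fun :> L -> R -> D; _ : additive_at coind_fun }.
HB.instance Definition _ := [isSub for coind_fun].
HB.instance Definition _ := [Choice of coind by <:].
HB.instance Definition _ := [SubChoice_isSubZmodule of coind by <:].

Lemma coindD (f : coind) l a b : f l (a + b) = f l a + f l b.
Proof. by case: f => f /= /asboolP. Qed.

Fact coind_scale_subproof (r : R) (f : coind) :
  additive_at (fun l s => f l (s * r)).
Proof. by apply/asboolP => l a b; rewrite mulrDl coindD. Qed.
Definition coind_scale r f : coind := Coind (coind_scale_subproof r f).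

Lemma coind_eq (f g : coind) : (forall l s, f l s = g l s) -> f = g.
Proof. by move=> h; apply: val_inj; apply/funext => l; apply/funext => s; exact: h. Qed.

Fact coind_scaleA a b f : coind_scale a (coind_scale b f) = coind_scale (a * b) f.
Proof. by apply: coind_eq => l s /=; rewrite mulrA. Qed.
Fact coind_scale1 : left_id 1 coind_scale.
Proof. by move=> f; apply: coind_eq => l s /=; rewrite mulr1. Qed.
Fact coind_scaleDr : right_distributive coind_scale +%R.
Proof. by move=> a f g; apply: coind_eq. Qed.
Fact coind_scaleDl f : {morph coind_scale^~ f : a b / a + b}.
Proof. by move=> a b; apply: coind_eq => l s /=; rewrite mulrDr coindD. Qed.
HB.instance Definition _ := GRing.Zmodule_isLmodule.Build R coind
  coind_scaleA coind_scale1 coind_scaleDr coind_scaleDl.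

(** Adjunction: a map into the [l]-th factor is determined by its evaluation at 1, an additive map
    to [D], which extends to [B]; [h l (s *: b)] recovers the R-linear map. *)
Lemma coind_injective : inj_graph D -> inj_graph coind.
Proof.
move=> injD B G [hG fG].
pose BZ : lmodType int := ssrint.zmodule B.
have ext l : exists h : BZ -> D, is_lin h /\
    forall b j, G (b, j) -> h b = j l 1.
  pose Gl (z : BZ * D) := exists j : coind, G (z.1 : B, j) /\ z.2 = j l 1.
  have [|h [hh he]] := injD BZ Gl; last first.
    by exists h; split => // b j g; apply: he; exists j.
  have mulz (j : coind) (n : int) s : (j *~ n) l s = n *: (j l s).
    have hk k : (j *+ k) l s = k%:Z *: (j l s).
      elim: k => [|k IH]; first by rewrite mulr0n scale0r.
      by rewrite mulrS -[LHS]/(j l s + (j *+ k) l s) IH intS scalerDl scale1r.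
    case: n => k; first exact: hk.
    by rewrite NegzE mulrNz scaleNr -hk.
  split.
    split; first by exists 0; split => //; exact: (submod0 hG).
    move=> n [b d] [b' d'] [j [g /= ->]] [j' [g' /= ->]].
    exists (j *~ n + j'); split => /=.
      have : G (b *~ n + b', j *~ n + j').
        have := hG.2 (n%:~R) _ _ g g'; congr G; congr (_, _) => /=; congr (_ + _).
          by rewrite scaler_int.
        by rewrite scaler_int.
      exact.
    by rewrite -[RHS]/((j *~ n) l 1 + j' l 1) mulz.
  move=> d [j [/= g ->]].
  by rewrite (fG _ g).
have [h hh] := choice ext.
have addp b : additive_at (fun l (s : R) => h l (s *: b)).
  by apply/asboolP => l s t; rewrite scalerDl (linD (hh l).1).
exists (fun b => Coind (addp b)); split.
  move=> a x y; apply: coind_eq => l s.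
  rewrite -[RHS]/(h l ((s * a) *: x) + h l (s *: y)) /= scalerDr scalerA.
  by rewrite (linD (hh l).1).
move=> b j g; apply: coind_eq => l s /=.
by rewrite ((hh l).2 (s *: b) (s *: j)) /= ?mul1r //; exact: (submodZ hG s g).
Qed.
End Coinduced.

(** The coordinates are indexed by all additive maps from [M] to [D], which separate points. *)
Lemma enough_injectives (R : comNzRingType) (M : lmodType R) :
  exists (J : lmodType R) (i : M -> J), [/\ inj_graph J, is_lin i & injective i].
Proof.
have [D [injD cog]] := int_injective_cogenerator.
pose MZ : lmodType int := ssrint.zmodule M.
pose L := {h : MZ -> D | is_lin h}.
have addp (m : M) : additive_at (fun (l : L) (s : R) => sval l (s *: m)).
  apply/asboolP => -[l hl] s t /=.
  by rewrite scalerDl (linD hl).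
pose i m : coind R D L := Coind (addp m).
have li : is_lin i.
  move=> a x y; apply: coind_eq => -[l hl] s.
  rewrite -[RHS]/(l ((s * a) *: x) + l (s *: y)) /= scalerDr scalerA.
  by rewrite (linD hl).
exists (coind R D L), i; split => //; first exact: coind_injective.
apply: (lin_inj li) => m e; apply: contrapT => m0.
have [h [hl hm]] := cog MZ m m0.
apply: hm; have := congr1 (fun f : coind R D L => f (exist _ h hl) 1) e => /=.
by rewrite scale1r.
Qed.

(** * Pure-injective modules *)

Section PI.
Variable R : comNzRingType.
Implicit Types M N X : lmodType R.

(** A push-out of a pure monomorphism is pure, so [g] extends along [f] once the push-out of [f]
    along [g] splits. *)
Lemma pure_injective_split M :
  (forall X (f : M -> X), is_lin f -> injective f ->
     pure_sub (fun y => exists x, y = f x) ->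
     exists r : X -> M, is_lin r /\ forall x, r (f x) = x) -> pure_injective M.
Proof.
move=> h A B f g lf lg injf pf.
have [P [j [k [lj lk ij e [sp kp _]]]]] := pushout lf lg injf.
have [|r [lr re]] := h P j lj ij; last first.
  by exists (r \o k); split; [exact: lin_comp|move=> x /=; rewrite e re].
move=> m n r a ha [b hb].
have [a' ea'] := choice ha.
have [bm /choice [bb ebb]] := choice (fun i => sp (b i)).
(* A system solved in the push-out splits into one in [B] with constants [- f c], which purity of
   [f] solves inside [A], and one in [M] with error [g c]. *)
have key i : exists c, \sum_(j0 < n) r i j0 *: bb j0 = - f c /\
   \sum_(j0 < n) r i j0 *: bm j0 - a' i = g c.
  apply: kp; have := hb i; rewrite ea'.
  under eq_bigr do rewrite ebb scalerDr -(linZ lj) -(linZ lk).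
  by rewrite big_split /= -(lin_sum lj) -(lin_sum lk) (linB lj) addrAC => ->.
have [c hc] := choice key.
have [||d [hd ed]] := pf m n r (fun i => f (- c i)).
- by move=> i; exists (- c i).
- by exists bb => i; rewrite (hc i).1 (linN lf) subrr.
have [d' ed'] := choice hd.
exists (fun i => j (bm i + g (d' i))); split; first by move=> i; eexists.
move=> i; rewrite ea'.
have -> : \sum_(j0 < n) r i j0 *: j (bm j0 + g (d' j0)) =
          j (\sum_(j0 < n) r i j0 *: bm j0 + g (\sum_(j0 < n) r i j0 *: d' j0)).
  rewrite (linD lj) (lin_sum lg) !(lin_sum lj) -big_split /=.
  by apply: eq_bigr => l _; rewrite (linD lj) scalerDr (linZ lg) !(linZ lj).
have -> : \sum_(j0 < n) r i j0 *: d' j0 = - c i.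
  apply: injf; rewrite (lin_sum lf).
  have := ed i => /subr0_eq <-; apply: eq_bigr => l _.
  by rewrite (linZ lf) ed'.
have /eqP := (hc i).2; rewrite subr_eq => /eqP ->.
by rewrite -(linB lj) (linN lg) addrAC addrK subrr (lin0 lj).
Qed.

Lemma pure_injective_retract M X (f : M -> X) : pure_injective M ->
  is_lin f -> injective f -> pure_sub (fun y => exists x, y = f x) ->
  exists r : X -> M, is_lin r /\ forall x, r (f x) = x.
Proof. by move=> PM lf jf pf; apply: (PM M X f id). Qed.

Lemma ext_extend (F M A B : lmodType R) (i : A -> B) (q : B -> F) (g : A -> M) :
  ext1_vanish F M -> is_lin i -> is_lin q -> is_lin g -> injective i ->
  (forall z, exists y, q y = z) -> (forall y, q y = 0 <-> exists x, y = i x) ->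
  exists h : B -> M, is_lin h /\ forall x, h (i x) = g x.
Proof.
move=> ext li lq lg ii sq kq.
have [P [j [k [lj lk ij e [sp kp up]]]]] := pushout li lg ii.
have l0 : is_lin (fun _ : M => 0 : F) by move=> a x y; rewrite scaler0 addr0.
have [|w [lw wj wk]] := up F (fun _ => 0) q l0 lq.
  by move=> a; apply/kq; exists a.
have [| |r [lr re]] := ext P j w lj lw ij.
- by move=> z; have [y <-] := sq z; exists (k y); rewrite wk.
- move=> y; split=> [|[x ->]]; last exact: wj.
  have [m [b ->]] := sp y; rewrite (linD lw) wj wk add0r => /kq [a ->].
  by exists (m + g a); rewrite e (linD lj).
by exists (r \o k); split; [exact: lin_comp|move=> x /=; rewrite e re].
Qed.

(* Stated for every module S isomorphic to A, so that no particular subtype has to be chosen. *)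
Definition pi_on (M : lmodType R) (A : M -> Prop) := forall (S : lmodType R) (i : S -> M),
  is_lin i -> injective i -> (forall x, A x <-> exists s, x = i s) -> pure_injective S.

Lemma pi_on_eq M (A A' : M -> Prop) : (forall x, A x <-> A' x) -> pi_on A -> pi_on A'.
Proof. by move=> e h S i li ii eA; apply: (h S i) => // x; rewrite e. Qed.

Lemma pure_mul_ideal (A B : lmodType R) (f : A -> B) (P : R -> Prop) (a : A) n
  (c : 'I_n -> R) (b : 'I_n -> B) : is_lin f -> injective f ->
  pure_sub (fun y => exists x, y = f x) -> f a = \sum_(i < n) c i *: b i ->
  exists d : 'I_n -> A, a = \sum_(i < n) c i *: d i.
Proof.
move=> lf jf pf e.
have [||b' [h1 h2]] := pf 1%N n (fun _ => c) (fun _ => f a).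
- by move=> _; exists a.
- by exists b => _; rewrite e subrr.
have [d hd] := choice h1; exists d; apply: jf.
have := h2 ord0 => /subr0_eq <-; rewrite (lin_sum lf).
by apply: eq_bigr => i _; rewrite (linZ lf) hd.
Qed.

Definition ideal_mul (P : R -> Prop) M (A : M -> Prop) (y : M) := exists n (c : 'I_n -> R) (b : 'I_n -> M),
  (forall i, P (c i) /\ A (b i)) /\ y = \sum_(i < n) c i *: b i.

Lemma ideal_mul_sub (P : R -> Prop) M (A : M -> Prop) : is_submod A -> is_submod (ideal_mul P A).
Proof.
move=> hA; split; first by exists 0%N, (fun=> 0), (fun=> 0); split; [case|rewrite big_ord0].
move=> a _ _ [n [c [b [h ->]]]] [n' [c' [b' [h' ->]]]].
exists (n + n')%N, (fun i : 'I_(n + n') => match fintype.split i with inl j => c j | inr j => c' j end),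
  (fun i : 'I_(n + n') => match fintype.split i with inl j => a *: b j | inr j => b' j end); split.
  move=> i; case: (fintype.split i) => j //; split; first by case: (h j).
  by apply: (submodZ hA); case: (h j).
rewrite big_split_ord /= scaler_sumr; congr (_ + _); apply: eq_bigr => i _.
  by rewrite (unsplitK (inl _ i)) !scalerA mulrC.
by rewrite (unsplitK (inr _ i)).
Qed.

Lemma ideal_mul_gen (P : R -> Prop) M (A : M -> Prop) c b : P c -> A b -> ideal_mul P A (c *: b).
Proof. by move=> *; exists 1%N, (fun=> c), (fun=> b); split => //; rewrite big_ord1. Qed.

Lemma ideal_mul_ind (P : R -> Prop) M (A Q : M -> Prop) : is_submod Q ->
  (forall c b, P c -> A b -> Q (c *: b)) -> forall y, ideal_mul P A y -> Q y.
Proof.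
by move=> hQ h _ [n [c [b [k ->]]]]; apply: (submod_sum hQ) => i _; case: (k i) => *; apply: h.
Qed.

(* Purity gives f(A) /\ P B = f(P A), so the map f x + y |-> g x, for y in P B, is well defined. *)
Lemma pure_graph (A B N : lmodType R) (f : A -> B) (g : A -> N) (P : R -> Prop) :
  is_lin f -> is_lin g -> injective f -> pure_sub (fun y => exists x, y = f x) ->
  (forall a x, P a -> a *: g x = 0) ->
  graph_fun (fun z : B * N => exists a, ideal_mul P (fun _ => True) (z.1 - f a) /\ z.2 = g a).
Proof.
move=> lf lg jf pf kg.
have hT : is_submod (fun _ : B => True) by [].
have hP := ideal_mul_sub P hT.
split.
  split; first by exists 0; rewrite (lin0 lf) (lin0 lg) subr0; split => //; exact: (submod0 hP).
  move=> r [y n] [y' n'] [a [h /= ->]] [a' [h' /= ->]].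
  exists (r *: a + a'); split; last by rewrite lg.
  rewrite /= lf opprD addrACA -scalerBr; exact: hP.2.
move=> m [a [/= h ->]].
have [n [c [b [hc e]]]] : ideal_mul P (fun _ : B => True) (f a).
  by have := submodN hP h; rewrite sub0r opprK.
have [d ->] := pure_mul_ideal P lf jf pf e.
by rewrite (lin_sum lg) big1 // => i _; rewrite (linZ lg) kg //; case: (hc i).
Qed.

(** By purity the [l]-th coordinate of [g], set to 0 on [P_l B], is well defined on [f A + P_l B].
    Injectivity of [J] extends it to [B], and its vanishing on [P_l B] keeps the values in the
    submodule. *)
Lemma pi_on_ann (J : lmodType R) (L : Type) (P : L -> R -> Prop) : inj_graph J ->
  pi_on (fun u : L -> J => forall l a, P l a -> a *: u l = 0).
Proof.
move=> injJ N i li ii eN A B f g lf lg jf pf.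
have ext l : exists h : B -> J, is_lin h /\
   forall y a, ideal_mul (P l) (fun _ => True) (y - f a) -> h y = i (g a) l.
  have lgl : is_lin (fun x => i (g x) l) by move=> r x y; rewrite lg li.
  have kl a x : P l a -> a *: i (g x) l = 0.
    by move=> h; have /eN := ex_intro (fun s => i (g x) = i s) (g x) erefl; apply.
  have [h [lh he]] := injJ B _ (pure_graph (P := P l) lf lgl jf pf kl).
  by exists h; split => // y a k; apply: he; exists a.
have hT : is_submod (fun _ : B => True) by [].
have [h hh] := choice ext.
have lH : is_lin (fun b l => h l b : J).
  by move=> r x y; apply/funext => l; rewrite (hh l).1.
have [|k [lk ek]] := lin_lift li ii lH.
  move=> b; apply/eN => l a Pa; rewrite -(linZ (hh l).1).
  rewrite ((hh l).2 (a *: b) 0); first by rewrite (lin0 lg) (lin0 li).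
  by rewrite (lin0 lf) subr0; apply: ideal_mul_gen.
exists k; split => // x; apply: ii; rewrite ek; apply/funext => l.
by apply: (hh l).2; rewrite subrr; exact: (submod0 (ideal_mul_sub _ hT)).
Qed.

(** The partial map [f x + y |-> g x], zero on [m B], is a partial map of vector spaces over R/m, so
    an element independent of the domain may be sent to 0. *)
Lemma pi_killed_maximal (m : R -> Prop) N : maximal_ideal m ->
  (forall a x, m a -> a *: x = 0 :> N) -> pure_injective N.
Proof.
move=> [hm m1 max] kN A B f g lf lg jf pf.
have hT : is_submod (fun _ : B => True) by [].
have [|h [lh he]] := graph_extend (pure_graph (P := m) lf lg jf pf (fun a x => @kN a (g x))).
  move=> G GG sG x.
  have G0 y : ideal_mul m (fun _ => True) y -> G (y, 0).
    by move=> hy; apply: sG; exists 0; rewrite (lin0 lf) (lin0 lg) subr0.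
  have [[r [n [mr Gr]]]|none] := pselect (exists r n, ~ m r /\ G (r *: x, n)).
    have [t mt] := max r mr.
    exists (t *: n) => r' n' Gr'.
    have Gx : G (x, t *: n).
      have h1 : G (t *: (r *: x), t *: n) := submodZ GG.1 t Gr.
      have h2 : G ((1 - r * t) *: x, 0) by apply: G0; apply: ideal_mul_gen.
      have := submodD GG.1 h1 h2; congr G; congr (_, _) => /=.
        by rewrite scalerA mulrC -scalerDl addrC subrK scale1r.
      by rewrite addr0.
    exact: (graph_fun_uniq GG Gr' (submodZ GG.1 r' Gx)).
  exists 0 => r n Gr; rewrite scaler0.
  have [mr|mr] := pselect (m r); last by case: none; exists r, n.
  apply: (graph_fun_uniq GG Gr); apply: G0; exact: ideal_mul_gen.
exists h; split => // x; apply: he; exists x; rewrite subrr; split => //.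
exact: (submod0 (ideal_mul_sub _ hT)).
Qed.

(* The diagonal of X in its reduced power along F is pure, hence has a retraction. *)
Lemma pi_limit X (L : Type) (F : (L -> Prop) -> Prop) : pure_injective X ->
  F (fun _ => True) -> (forall P Q, F P -> F Q -> F (fun l => P l /\ Q l)) ->
  (forall P Q : L -> Prop, F P -> (forall l, P l -> Q l) -> F Q) ->
  (forall P, F P -> exists l, P l) ->
  exists lim : (L -> X) -> X, [/\ is_lin lim, forall x, lim (fun _ => x) = x &
    forall u v : L -> X, F (fun l => u l = v l) -> lim u = lim v].
Proof.
move=> PX FT FI Fs Fn.
pose K (u : L -> X) := F (fun l => u l = 0).
have hK : is_submod K.
  split; first by apply: Fs FT _.
  move=> a u v Ku Kv; apply: Fs (FI _ _ Ku Kv) _ => l [hu hv].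
  by rewrite -[LHS]/(a *: u l + v l) hu hv scaler0 addr0.
have [Q [p [lp sp kp]]] := quot_exists hK.
have ld : is_lin (fun x => p (fun=> x)).
  by move=> a x y; rewrite -lp; congr p.
have Fall n (P : 'I_n -> L -> Prop) : (forall i, F (P i)) -> F (fun l => forall i, P i l).
  elim: n P => [|n IH] P h; first by apply: Fs FT _ => l _ [].
  apply: Fs (FI _ _ (h ord0) (IH (fun i => P (lift ord0 i)) (fun i => h _))) _.
  by move=> l [h0 h1] i; have [j ->|->] := unliftP ord0 i.
have [||r [lr er]] := pure_injective_retract PX ld.
- apply: (lin_inj ld) => x /kp /Fn [l]; exact.
- move=> m n r a ha [b hb].
  have [a' ea'] := choice ha; have [b' eb'] := choice (fun i => sp (b i)).
  have : F (fun l => forall i, \sum_(j < n) r i j *: b' j l - a' i = 0).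
    apply: Fall => i.
    have /kp : p (\sum_(j < n) r i j *: b' j - (fun=> a' i)) = 0.
      rewrite (linB lp) (lin_sum lp) -ea' -[RHS](hb i); congr (_ - _).
      by apply: eq_bigr => j _; rewrite (linZ lp) eb'.
    by move=> h; apply: Fs h _ => l; rewrite -[X in X -> _]/((\sum_(j < n) r i j *: b' j) l - a' i = 0) fct_sumE.
  move=> /Fn [l hl]; exists (fun j => p (fun=> b' j l)); split; first by move=> j; eexists.
  move=> i; rewrite ea'.
  have -> : \sum_(j < n) r i j *: p (fun=> b' j l) = p (fun=> \sum_(j < n) r i j *: b' j l).
    by rewrite (lin_sum ld); apply: eq_bigr => j _; rewrite (linZ ld).
  by rewrite -(linB ld) hl (lin0 ld).
exists (r \o p); split; [exact: lin_comp| by move=> x; exact: er|].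
move=> u v h /=; congr r; apply/eqP; rewrite -subr_eq0 -(linB lp); apply/eqP/kp.
by apply: Fs h _ => l e; rewrite -[LHS]/(u l - v l) e subrr.
Qed.

End PI.

(** * Flat modules and extensions of cotorsion modules *)

Section Flat.
Variable R : comNzRingType.
Implicit Types M N X F B : lmodType R.

(** Induction on the number of equations: solving the first one turns the others into equations in
    the new unknowns [y]. *)
Lemma flat_system F : flat F -> forall m n (r : 'I_m -> 'I_n -> R) (x : 'I_n -> F),
  (forall i, \sum_(j < n) r i j *: x j = 0) ->
  exists l (c : 'I_n -> 'I_l -> R) (y : 'I_l -> F),
    (forall j, x j = \sum_(k < l) c j k *: y k) /\
    (forall i k, \sum_(j < n) r i j * c j k = 0).
Proof.
move=> hF; elim=> [|m IH] n r x e.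
  exists n, (fun j k => (j == k)%:R), x; split; last by case.
  move=> j; rewrite (bigD1 j) //= eqxx scale1r big1 ?addr0 // => k kj.
  by rewrite eq_sym (negPf kj) scale0r.
have [l [c [y [hc rc]]]] := hF n (r ord0) x (e ord0).
have [i|l' [c' [y' [hc' rc']]]] := IH l (fun i k => \sum_(j < n) r (lift ord0 i) j * c j k) y.
  rewrite -[RHS](e (lift ord0 i)).
  under [RHS]eq_bigr => j _ do rewrite hc scaler_sumr.
  rewrite exchange_big /=; apply: eq_bigr => k _; rewrite scaler_suml.
  by apply: eq_bigr => j _; rewrite scalerA.
exists l', (fun j k' => \sum_(k < l) c j k * c' k k'), y'; split.
  move=> j; rewrite hc.
  under eq_bigr => k _ do rewrite hc' scaler_sumr.
  rewrite exchange_big /=; apply: eq_bigr => k _; rewrite scaler_suml.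
  by apply: eq_bigr => k' _; rewrite scalerA.
move=> i k'.
under eq_bigr => j _ do rewrite mulr_sumr.
rewrite exchange_big /=.
have [i' ->|->] := unliftP ord0 i.
  rewrite -[RHS](rc' i' k'); apply: eq_bigr => k _; rewrite mulr_suml.
  by apply: eq_bigr => j _; rewrite mulrA.
apply: big1 => k _; under eq_bigr => j _ do rewrite mulrA.
by rewrite -mulr_suml rc mul0r.
Qed.

(** [F] is B/(A + K). Flatness writes the image of a solution [b] as [c y] with [r c = 0];
    subtracting a lift of [c y] from [b] leaves, modulo [K], a solution in [A]. *)
Lemma flat_pure_mod B F (A K : B -> Prop) (p : B -> F) : is_submod A -> is_submod K ->
  is_lin p -> (forall z, exists y, p y = z) ->
  (forall x, p x = 0 -> exists a, A a /\ K (x - a)) -> (forall x, A x \/ K x -> p x = 0) ->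
  flat F -> pure_sub_mod A K.
Proof.
move=> hA hK lp sp kp kp' hF m n r a ha [b hb].
have e i : \sum_(j < n) r i j *: p (b j) = 0.
  have := kp' _ (or_intror (hb i)); rewrite (linB lp) (kp' (a i)); last by left.
  rewrite subr0 (lin_sum lp) => e; rewrite -[RHS]e.
  by apply: eq_bigr => j _; rewrite (linZ lp).
have [l [c [y [hc rc]]]] := flat_system hF e.
have [y' ey] := choice (fun k => sp (y k)).
have [j|b' hb'] := choice (_ : forall j, exists a', A a' /\ K (b j - \sum_(k < l) c j k *: y' k - a')).
  apply: kp; rewrite (linB lp) hc (lin_sum lp); apply/eqP; rewrite subr_eq0; apply/eqP.
  by apply: eq_bigr => k _; rewrite (linZ lp) ey.
exists b'; split; first by move=> j; case: (hb' j).
move=> i; apply: (submod_trans hK) (hb i).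
have e0 : \sum_(j < n) r i j *: (\sum_(k < l) c j k *: y' k) = 0.
  under eq_bigr => j _ do rewrite scaler_sumr.
  rewrite exchange_big /= big1 // => k _.
  under eq_bigr => j _ do rewrite scalerA.
  by rewrite -scaler_suml rc scale0r.
rewrite -sumrB -[X in K X]addr0 -{2}e0 -big_split /=.
apply: (submod_sum hK) => j _; rewrite -scalerBr -scalerDr; apply: (submodZ hK).
rewrite -[X in K X]opprK; apply: (submodN hK); have := (hb' j).2; congr K.
by rewrite opprD opprB addrAC.
Qed.

Lemma pure_injective_ext F M : pure_injective M -> flat F -> ext1_vanish F M.
Proof.
move=> PM hF E f g lf lg jf sg kg.
apply: (pure_injective_retract PM lf jf).
have h0 : is_submod (fun x : E => x = 0).
  by split => // a x y -> ->; rewrite scaler0 addr0.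
have hA : is_submod (fun y => exists x, y = f x).
  split; first by exists 0; rewrite (lin0 lf).
  by move=> a _ _ [x ->] [y ->]; exists (a *: x + y); rewrite lf.
apply: (flat_pure_mod hA h0 lg sg _ _ hF).
  by move=> x /kg hx; exists x; rewrite subrr.
by move=> x [/kg//|->]; exact: (lin0 lg).
Qed.

(** Extend [p] to [h : E -> N2]. The kernel [S] of [h] is an extension of [F] by [N1], which splits
    by some [s]. *)
Lemma cotorsion_ext (N1 X N2 : lmodType R) (i : N1 -> X) (p : X -> N2) :
  is_lin i -> is_lin p -> injective i -> (forall z, exists y, p y = z) ->
  (forall y, p y = 0 <-> exists x, y = i x) ->
  cotorsion N1 -> cotorsion N2 -> cotorsion X.
Proof.
move=> li lp ji sp kp C1 C2 F hF E f g lf lg jf sg kg.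
have [h [lh eh]] := ext_extend (C2 F hF) lf lg lp jf sg kg.
have hG : is_submod (fun e => h e = 0).
  by split; [exact: lin0|move=> a x y hx hy; rewrite lh hx hy scaler0 addr0].
have [S [j [lj jj ej]]] := sub_exists hG.
have [|i1 [li1 ei1]] := lin_lift lj jj (lin_comp li lf).
  by move=> x; apply/ej; rewrite /= eh; apply/kp; exists x.
have [| | |s [ls es]] := C1 F hF S i1 (g \o j) li1 (lin_comp lj lg).
- by move=> x y e; apply: ji; apply: jf; rewrite -[LHS]ei1 -[RHS]ei1 e.
- move=> z; have [e <-] := sg z; have [x hx] := sp (h e).
  have /ej [s es] : h (e - f x) = 0 by rewrite (linB lh) eh hx subrr.
  exists s; rewrite /= -es (linB lg); have -> : g (f x) = 0 by apply/kg; exists x.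
  by rewrite subr0.
- move=> y; split=> /=.
    move=> /kg [x ex]; have : h (j y) = 0 by apply/ej; exists y.
    rewrite ex eh => /kp [n en]; exists n; apply: jj.
    by rewrite ei1 /= -en.
  by move=> [x ->]; rewrite ei1; apply/kg; eexists.
(* [E] is the sum of [f X] and the kernel of [h], which meet in [N1]; there [s] agrees with the
   identity of [X], so the two maps glue. *)
have lt : is_lin (fun z : X * S => f z.1 + j z.2).
  by move=> a x y /=; rewrite lf lj scalerDr addrACA.
have lu : is_lin (fun z : X * S => z.1 + i (s z.2)).
  by move=> a x y /=; rewrite ls li scalerDr addrACA.
have [| |r [lr er]] := lin_factor lt _ lu.
- move=> e; have [x hx] := sp (h e).
  have /ej [s' es'] : h (e - f x) = 0 by rewrite (linB lh) eh hx subrr.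
  by exists (x, s'); rewrite /= -es' addrC subrK.
- move=> [x y] /= e.
  have ey : h (j y) = 0 by apply/ej; exists y.
  have : h (f x + j y) = 0 by rewrite e (lin0 lh).
  rewrite (linD lh) eh ey addr0 => /kp [n en].
  have -> : y = - i1 n.
    by apply: jj; rewrite (linN lj) ei1 /= -en; apply/eqP; rewrite -addr_eq0 addrC e.
  by rewrite (linN ls) es en (linN li) subrr.
exists r; split => // x; have := er (x, 0); rewrite /= (lin0 lj) addr0 => ->.
by rewrite (lin0 ls) (lin0 li) addr0.
Qed.

(** Pure-injective modules are cotorsion, cotorsion modules are closed under extensions, and (1)
    leads back. Kernel and image are predicates, to fit the explicit submodules to which this is
    applied. *)
Lemma pi_on_ext (M T : lmodType R) (A : M -> Prop) (h : M -> T) : cond1 R ->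
  is_submod A -> is_lin h -> pi_on (fun x => A x /\ h x = 0) ->
  pi_on (fun y => exists x, A x /\ y = h x) -> pi_on A.
Proof.
move=> c1 hA lh P1 P2 S i li ii eA; apply: c1.
have hK : is_submod (fun s => h (i s) = 0).
  split; first by rewrite (lin0 li) (lin0 lh).
  by move=> a x y hx hy; rewrite li lh hx hy scaler0 addr0.
have [N1 [j [lj jj ej]]] := sub_exists hK.
have hI : is_submod (fun y => exists x, A x /\ y = h x).
  split; first by exists 0; rewrite (lin0 lh); split => //; exact: submod0 hA.
  move=> a _ _ [x [Ax ->]] [y [Ay ->]]; exists (a *: x + y); rewrite lh.
  by split => //; exact: hA.2.
have [N2 [k [lk jk ek]]] := sub_exists hI.
have [|p [lp ep]] := lin_lift lk jk (lin_comp li lh).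
  by move=> s; apply/ek; exists (i s); split => //; apply/eA; exists s.
apply: (cotorsion_ext lj lp jj).
- move=> z; have [x [Ax ex]] : exists x, A x /\ k z = h x by apply/ek; exists z.
  by have /eA [s es] := Ax; exists s; apply: jk; rewrite ep /= -es.
- move=> y; rewrite -ej; split; last by move=> e; apply: jk; rewrite ep (lin0 lk).
  by move=> e; have := ep y; rewrite e (lin0 lk).
- move=> F hF; apply: pure_injective_ext => //.
  apply: (P1 N1 (i \o j)); [exact: lin_comp|by move=> x y /ii /jj|].
  move=> x; split.
    by move=> [/eA [s ->]] /ej [n ->]; exists n.
  move=> [s ->]; split; first by apply/eA; exists (j s).
  by apply/ej; exists s.
- by move=> F hF; apply: pure_injective_ext => //; exact: (P2 N2 k).
Qed.

Lemma pure_injective_extension (N1 X N2 : lmodType R) (i : N1 -> X) (p : X -> N2) :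
  cond1 R ->
  is_lin i -> is_lin p -> injective i -> (forall z, exists y, p y = z) ->
  (forall y, p y = 0 <-> exists x, y = i x) ->
  pure_injective N1 -> pure_injective N2 -> pure_injective X.
Proof.
move=> c1 li lp ji sp kp P1 P2; apply: c1; apply: (cotorsion_ext li lp ji sp kp).
  by move=> F hF; apply: pure_injective_ext.
by move=> F hF; apply: pure_injective_ext.
Qed.

End Flat.

(** * Pure-essential extensions *)

Section PureEssential.
Variable R : comNzRingType.
Local Open Scope classical_set_scope.

Lemma pure_rd (B : lmodType R) (A K : B -> Prop) : is_submod K ->
  pure_sub_mod A K -> rd_sub_mod A K.
Proof.
move=> hK h r a Aa [b hb].
have [||b' [h1 h2]] := h 1%N 1%N (fun _ _ => r) (fun _ => a) => //.
  by exists (fun _ => b) => i; rewrite big_ord1.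
by exists (b' ord0); split => //; have := h2 ord0; rewrite big_ord1.
Qed.

Lemma chain_fin (T : Type) (F : set (set T)) n (x : 'I_n -> T) : F !=set0 ->
  total_on F subset -> (forall i, (\bigcup_(X in F) X) (x i)) ->
  exists2 X, F X & forall i, X (x i).
Proof.
move=> F0 tF; elim: n x => [|n IH] x hx; first by case: F0 => X FX; exists X => // -[].
have [X FX hX] := IH (fun i => x (lift ord0 i)) (fun i => hx _).
have [Y FY hY] := hx ord0.
have [sXY|sYX] := tF _ _ FX FY.
  by exists Y => // i; have [j ->|->//] := unliftP ord0 i; apply: sXY.
by exists X => // i; have [j ->//|->] := unliftP ord0 i; apply: sYX.
Qed.

Section Maximal.
Variables (B : lmodType R) (A N : B -> Prop).
Hypotheses (hA : is_submod A) (hN : is_submod N).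

Lemma maximal_complement (P : (B -> Prop) -> Prop) : P N ->
  (forall F : set (set B), F !=set0 ->
    (forall X, F X -> is_submod X /\ P X) -> total_on F subset -> P (\bigcup_(X in F) X)) ->
  exists K : set B, [/\ is_submod K, N `<=` K, (forall x, K x -> A x -> N x), P K &
    forall T : set B, is_submod T -> K `<=` T -> (forall x, T x -> A x -> N x) -> P T -> T `<=` K].
Proof.
move=> PN ch.
have [|F F0 hF tF|K [hK sK [PK dK] maxK]] :=
  @zorn_submod R B N (fun X => P X /\ forall x, X x -> A x -> N x) hN; first by split.
- split; first by apply: ch => // X /hF [? _ []].
  by move=> x [X /hF [_ _ [_ +]] Xx]; apply.
- by exists K; split => // T hT sT dT PT; apply: maxK.
Qed.

Lemma maximal_pure : pure_sub_mod A N ->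
  exists K : set B, [/\ is_submod K, N `<=` K, (forall x, K x -> A x -> N x), pure_sub_mod A K &
    forall T : set B, is_submod T -> K `<=` T -> (forall x, T x -> A x -> N x) ->
      pure_sub_mod A T -> T `<=` K].
Proof.
move=> h; apply: maximal_complement => // F F0 hF tF m n r a ha [b hb].
have [X FX hX] := chain_fin F0 tF hb.
have [|b' [h1 h2]] := (hF X FX).2 m n r a ha; first by exists b.
by exists b'; split => // i; exists X.
Qed.

Lemma maximal_rd : rd_sub_mod A N ->
  exists K : set B, [/\ is_submod K, N `<=` K, (forall x, K x -> A x -> N x), rd_sub_mod A K &
    forall T : set B, is_submod T -> K `<=` T -> (forall x, T x -> A x -> N x) ->
      rd_sub_mod A T -> T `<=` K].
Proof.
move=> h; apply: maximal_complement => // F F0 hF tF r a ha [b [X FX hb]].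
have [|b' [h1 h2]] := (hF X FX).2 r a ha; first by exists b.
by exists b'; split => //; exists X.
Qed.
End Maximal.

Section Quotient.
Variables (B Q : lmodType R) (A K : B -> Prop) (p : B -> Q).
Hypotheses (hA : is_submod A) (hK : is_submod K) (lp : is_lin p).
Hypotheses (sp : forall z, exists y, p y = z) (kp : forall x, p x = 0 <-> K x).
Let pA := (fun y => exists a, A a /\ y = p a).

Lemma img_submod : is_submod pA.
Proof.
split; first by exists 0; rewrite (lin0 lp); split => //; exact: submod0 hA.
by move=> a _ _ [x [Ax ->]] [y [Ay ->]]; exists (a *: x + y); rewrite lp; split => //; exact: hA.2.
Qed.

Lemma pure_quot (T : Q -> Prop) : is_submod T ->
  pure_sub_mod pA T <-> pure_sub_mod A (fun x => T (p x)).
Proof.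
move=> hT; split=> h m n r a ha [b hb].
  have [||b' [h1 h2]] := h m n r (fun i => p (a i)).
  - by move=> i; exists (a i).
  - exists (fun j => p (b j)) => i; move: (hb i); rewrite (linB lp) (lin_sum lp).
    by under eq_bigr do rewrite (linZ lp).
  have [c hc] := choice h1; exists c; split; first by move=> j; case: (hc j).
  move=> i; move: (h2 i); rewrite (linB lp) (lin_sum lp).
  by under eq_bigr do rewrite (hc _).2 -(linZ lp).
have [c hc] := choice ha; have [b' hb'] := choice (fun j => sp (b j)).
have [||d [h1 h2]] := h m n r c.
- by move=> i; case: (hc i).
- exists b' => i; move: (hb i); rewrite (linB lp) (lin_sum lp) (hc i).2.
  by under eq_bigr do rewrite -hb' -(linZ lp).
exists (fun j => p (d j)); split; first by move=> j; exists (d j).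
move=> i; move: (h2 i); rewrite (linB lp) (lin_sum lp) (hc i).2.
by under eq_bigr do rewrite (linZ lp).
Qed.

Lemma rd_quot (T : Q -> Prop) : is_submod T ->
  rd_sub_mod pA T <-> rd_sub_mod A (fun x => T (p x)).
Proof.
move=> hT; split=> h r a ha [b hb].
  have [|| b' [[c [Ac ->]] h2]] := h r (p a); first by exists a.
  - by exists (p b); rewrite -(linZ lp) -(linB lp).
  by exists c; split => //; rewrite (linB lp) (linZ lp).
case: ha => c [Ac ec]; have [b' hb'] := sp b.
have [|d [Ad hd]] := h r c Ac.
  by exists b'; rewrite (linB lp) (linZ lp) hb' -ec.
exists (p d); split; first by exists d.
by rewrite ec -(linZ lp) -(linB lp).
Qed.

Lemma preim_submod (T : Q -> Prop) : is_submod T -> is_submod (fun x => T (p x)).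
Proof. by move=> hT; split; [rewrite (lin0 lp); exact: submod0 hT|move=> a x y; rewrite lp; exact: hT.2]. Qed.

Lemma ker_eq : (fun x => p x = 0) = K.
Proof. by apply/funext => x; apply/propext; exact: kp. Qed.
End Quotient.

Lemma zero_submod (M : lmodType R) : is_submod (fun x : M => x = 0).
Proof. by split => // a x y -> ->; rewrite scaler0 addr0. Qed.

Lemma range_submod (M N : lmodType R) (f : M -> N) : is_lin f ->
  is_submod (fun y => exists x, y = f x).
Proof.
move=> lf; split; first by exists 0; rewrite (lin0 lf).
by move=> a _ _ [x ->] [y ->]; exists (a *: x + y); rewrite lf.
Qed.

Lemma pure_essential_quotient (M B : lmodType R) (f : M -> B) : is_lin f -> injective f ->
  pure_sub (fun y => exists x, y = f x) ->
  exists (Q : lmodType R) (p : B -> Q), [/\ is_lin p, injective (p \o f) &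
    pure_essential_ext (fun y => exists x, y = p (f x))].
Proof.
move=> lf jf pf.
have hA := range_submod lf.
have [K [hK _ dK pK maxK]] := maximal_pure (zero_submod B) pf.
have [Q [p [lp sp kp]]] := quot_exists hK.
have eA : (fun y => exists x, y = p (f x)) = (fun y => exists a, (exists x, a = f x) /\ y = p a).
  apply/funext => y; apply/propext; split=> [[x ->]|[_ [[x ->] ->]]]; last by exists x.
  by exists (f x); split => //; exists x.
exists Q, p; split => //.
  apply: (lin_inj (lin_comp lf lp)) => x /= /kp h.
  by apply: (inj_lin_eq0 lf jf); apply: dK => //; exists x.
split.
  rewrite eA; apply/(pure_quot _ lp sp); first exact: zero_submod.
  by rewrite (ker_eq kp).
move=> T hT dT pT z Tz.
have [x ex] := sp z; rewrite -ex; apply/kp.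
apply: (maxK (fun x => T (p x))).
- exact: preim_submod.
- by move=> y /kp e; rewrite e; exact: submod0 hT.
- move=> y Ty [w ew]; rewrite ew in Ty *.
  have /kp Kw : p (f w) = 0 by apply: dT => //; exists w.
  by apply: dK => //; exists w.
- by apply/(pure_quot _ lp sp) => //; rewrite -eA.
- by rewrite ex.
Qed.

(** Essentiality of (A + K)/K in B/K, tested on cyclic submodules without forming the quotient. *)
Definition rel_essential (B : lmodType R) (A K : B -> Prop) :=
  forall x, ~ K x -> exists s m, [/\ A m, K (s *: x - m) & ~ K (s *: x)].

Lemma rel_essentialP (B Q : lmodType R) (A K : B -> Prop) (p : B -> Q) :
  is_lin p -> (forall z, exists y, p y = z) -> (forall x, p x = 0 <-> K x) ->
  essential_ext (fun y => exists a, A a /\ y = p a) -> rel_essential A K.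
Proof.
move=> lp sp kp ess x nKx.
have [||_ [[s ->] [a [Aa ea]] n0]] := ess (fun y => exists s, y = s *: p x).
- split; first by exists 0; rewrite scale0r.
  by move=> a _ _ [s ->] [t ->]; exists (a * s + t); rewrite scalerDl scalerA.
- exists (p x); split; first by exists 1; rewrite scale1r.
  by move/kp.
exists s, a; split => //.
  by apply/kp; rewrite (linB lp) (linZ lp) ea subrr.
by move/kp; rewrite (linZ lp).
Qed.

Lemma cond2_rel (B : lmodType R) (A N : B -> Prop) : cond2 R ->
  is_submod A -> is_submod N -> pure_sub_mod A N ->
  exists K : B -> Prop, [/\ is_submod K, forall x, N x -> K x, forall x, K x -> A x -> N x,
    pure_sub_mod A K & rel_essential A K].
Proof.
move=> [_ c2] hA hN pA.
have [K [hK sK dK pK maxK]] := maximal_pure hN pA.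
have [Q [p [lp sp kp]]] := quot_exists hK.
exists K; split => //; apply: (rel_essentialP lp sp kp).
apply: c2; first exact: img_submod.
split; first by apply/(pure_quot _ lp sp); [exact: zero_submod|rewrite (ker_eq kp)].
move=> T hT dT pT z Tz.
have [x ex] := sp z; rewrite -ex; apply/kp.
apply: (maxK (fun x => T (p x))).
- exact: preim_submod.
- by move=> y /kp e; rewrite e; exact: submod0 hT.
- move=> y Ty Ay; apply: dK => //; apply/kp; apply: dT => //.
  by exists y.
- by apply/(pure_quot _ lp sp).
- by rewrite ex.
Qed.

Lemma cond3_rel (B : lmodType R) (A N : B -> Prop) : cond3 R ->
  is_submod A -> is_submod N -> rd_sub_mod A N ->
  exists K : B -> Prop, [/\ is_submod K, forall x, N x -> K x, forall x, K x -> A x -> N x,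
    rd_sub_mod A K & rel_essential A K].
Proof.
move=> [_ c2] hA hN pA.
have [K [hK sK dK pK maxK]] := maximal_rd hN pA.
have [Q [p [lp sp kp]]] := quot_exists hK.
exists K; split => //; apply: (rel_essentialP lp sp kp).
apply: c2; first exact: img_submod.
split; first by apply/(rd_quot _ lp sp); [exact: zero_submod|rewrite (ker_eq kp)].
move=> T hT dT pT z Tz.
have [x ex] := sp z; rewrite -ex; apply/kp.
apply: (maxK (fun x => T (p x))).
- exact: preim_submod.
- by move=> y /kp e; rewrite e; exact: submod0 hT.
- move=> y Ty Ay; apply: dK => //; apply/kp; apply: dT => //.
  by exists y.
- by apply/(rd_quot _ lp sp).
- by rewrite ex.
Qed.

(* What the arguments from (2) and from (3) have in common. *)
Definition cond23 := forall (B : lmodType R) (A N : B -> Prop),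
  is_submod A -> is_submod N -> pure_sub_mod A N ->
  exists K : B -> Prop, [/\ is_submod K, forall x, N x -> K x, forall x, K x -> A x -> N x,
    rd_sub_mod A K & rel_essential A K].

Lemma cond2_23 : cond2 R -> cond23.
Proof.
move=> c2 B A N hA hN pA; have [K [hK sK dK pK eK]] := cond2_rel c2 hA hN pA.
by exists K; split => //; exact: pure_rd.
Qed.

Lemma cond3_23 : cond3 R -> cond23.
Proof.
by move=> c3 B A N hA hN pA; apply: cond3_rel => //; exact: pure_rd.
Qed.
End PureEssential.

(** * Rings satisfying condition (5) *)

Section IdealGen.
Variable R : comNzRingType.
Implicit Types (E : R -> Prop) (M : lmodType R).

Lemma ideal_gen_ideal E : is_ideal (ideal_gen E).
Proof.
have hT : is_submod (fun _ : R^o => True) by [].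
have h := ideal_mul_sub E hT.
have e x : ideal_gen E x <-> ideal_mul E (fun _ : R^o => True) x.
  split=> [[n [e [c [h1 ->]]]]|[n [c [b [h1 ->]]]]].
    by exists n, e, c; split => //; apply: eq_bigr => i _; rewrite mulrC.
  exists n, c, b; split; first by move=> i; case: (h1 i).
  by apply: eq_bigr => i _; rewrite mulrC.
split; first by apply/e; exact: submod0 h.
by move=> a x y /e hx /e hy; apply/e; exact: h.2.
Qed.

Lemma ideal_gen_mem E e : E e -> ideal_gen E e.
Proof. by exists 1%N, (fun=> e), (fun=> 1); split => //; rewrite big_ord1 mul1r. Qed.

Section Idempotents.
Variables (E : R -> Prop) (idE : forall e, E e -> e * e = e).

Lemma idem_join (e f : R) : e * e = e -> f * f = f ->
  let g := e + f - e * f in [/\ g * g = g, e * g = e & f * g = f].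
Proof.
move=> he hf g; have e1 : e * g = e.
  by rewrite /g mulrBr mulrDr mulrA he addrK.
have e2 : f * g = f.
  by rewrite /g mulrBr mulrDr [e * f]mulrC mulrA hf [f * e + f]addrC addrK.
split => //; rewrite {1}/g mulrBl mulrDl -mulrA e1 e2.
by [].
Qed.

Lemma ideal_gen_unit n (d : 'I_n -> R) : (forall i, ideal_gen E (d i)) ->
  exists u, [/\ ideal_gen E u, u * u = u & forall i, d i * u = d i].
Proof.
have hI := ideal_gen_ideal E.
have join u v : ideal_gen E u -> ideal_gen E v -> ideal_gen E (u + v - u * v).
  by move=> hu hv; apply: (submodB hI); [apply: (submodD hI)|apply: (submodZ hI u)].
have one x : ideal_gen E x -> exists u, [/\ ideal_gen E u, u * u = u & x * u = x].
  move=> [m [e [c [he ->]]]].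
  elim: m e c he => [|m IH] e c he.
    by exists 0; rewrite !mulr0 big_ord0; split => //; exact: submod0 hI.
  have [u [hu uu eu]] := IH (fun i => e (lift ord0 i)) (fun i => c (lift ord0 i)) (fun i => he _).
  have [gg g1 g2] := idem_join (idE (he ord0)) uu.
  exists (e ord0 + u - e ord0 * u); split => //.
    by apply: join => //; exact: ideal_gen_mem.
  rewrite big_ord_recl mulrDl -mulrA g1; congr (_ + _).
  by rewrite -[X in X * _]eu -mulrA g2 eu.
elim: n d => [|n IH] d hd; first by exists 0; rewrite mulr0; split => //; [exact: submod0 hI|case].
have [u [hu uu eu]] := IH (fun i => d (lift ord0 i)) (fun i => hd _).
have [v [hv vv ev]] := one _ (hd ord0).
have [gg g1 g2] := idem_join uu vv.
exists (u + v - u * v); split => //; first exact: join.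
move=> i; have [j ->|->] := unliftP ord0 i.
  by rewrite -[X in X * _]eu -mulrA g1 eu.
by rewrite -[X in X * _]ev -mulrA g2 ev.
Qed.

Hypothesis reg : quot_vN_regular (ideal_gen E).

(** Finitely generated ideals of a regular ring are generated by an idempotent, here represented
    modulo the ideal by the sum of the [c i * r i]. *)
Lemma regular_fg n (r : 'I_n -> R) : exists c : 'I_n -> R,
  forall j, ideal_gen E (r j - (\sum_(i < n) c i * r i) * r j).
Proof.
have hI := ideal_gen_ideal E.
elim: n r => [|n IH] r; first by exists (fun=> 0) => -[].
have [c hc] := IH (fun i => r (lift ord0 i)).
set u := \sum_(i < n) _ in hc; set r0 := r ord0.
have [y hy] := reg (r0 * (1 - u)).
set r' := r0 * (1 - u) in hy.
(* One minus the new sum is [(1 - u) * (1 - y * (1 - u) * r0)]: the factor [1 - u] kills the old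
   generators and the product kills [r0] by the choice of [y], all modulo the ideal. *)
pose c' i := if unlift ord0 i is Some j then c j else y * (1 - u) * (1 - u).
exists c' => j.
have -> : \sum_(i < n.+1) c' i * r i = u + y * (1 - u) * (1 - u) * r0.
  rewrite big_ord_recl /c' unlift_none addrC; congr (_ + _).
  by apply: eq_bigr => i _; rewrite liftK.
have [k ->|->] := unliftP ord0 j; last first.
  by have := hy; congr ideal_gen; rewrite /r' -/r0; ring.
have := submodZ hI (1 - y * (1 - u) * r0) (hc k); congr ideal_gen.
by rewrite /GRing.scale /=; ring.
Qed.
End Idempotents.
End IdealGen.

Section Cond5.
Variable R : comNzRingType.
Implicit Types (M B F : lmodType R).

Lemma flat_killed (E : R -> Prop) F : (forall e, E e -> e * e = e) ->
  quot_vN_regular (ideal_gen E) -> (forall a (x : F), ideal_gen E a -> a *: x = 0) -> flat F.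
Proof.
move=> idE reg kF n r x e.
have [c hc] := regular_fg reg r.
have [u [hu uu eu]] := ideal_gen_unit idE hc.
set w := \sum_(i < n) c i * r i in hc eu.
(* The factor [1 - c r] fixes [x] because of the relation, and [r] times it is [r j - w * r j], in
   the ideal. The local unit [u] fixes these finitely many elements, so [1 - u] kills them, while it
   fixes [x]. *)
exists n, (fun i j => ((i == j)%:R - c i * r j) * (1 - u)), x; split.
  move=> i; under eq_bigr => j _ do rewrite mulrBl scalerBl.
  rewrite sumrB (bigD1 i) //= eqxx mul1r scalerBl scale1r (kF u) // subr0.
  rewrite [X in _ + X - _]big1 ?addr0; last first.
    by move=> j ji; rewrite eq_sym (negPf ji) mul0r scale0r.
  under eq_bigr => j _ do rewrite mulrAC -scalerA.
  by rewrite -scaler_sumr e scaler0 subr0.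
move=> j.
have -> : \sum_(i < n) r i * (((i == j)%:R - c i * r j) * (1 - u)) =
   (\sum_(i < n) r i * (i == j)%:R - w * r j) * (1 - u).
  rewrite mulrBl !mulr_suml -sumrB; apply: eq_bigr => i _.
  by ring.
rewrite (bigD1 j) //= eqxx mulr1 big1 ?addr0; last by move=> i /negPf ->; rewrite mulr0.
by have := eu j; rewrite mulrBr mulr1 => ->; rewrite subrr.
Qed.

(** [e A] is pure in [B] and pure-injective, so [B] retracts onto it by [h]. The part of [e B]
    killed by [h] meets [A] in 0, and [A] stays pure modulo it, so it vanishes and [e B = e A]. *)
Lemma pure_essential_idem B (A : B -> Prop) e : is_submod A -> e * e = e ->
  quot_pure_semisimple (principal_ideal (1 - e)) -> pure_essential_ext A ->
  forall x, A (e *: x).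
Proof.
move=> hA ee pss [pA eA].
have hT : is_submod (fun x => A x /\ e *: x = x).
  split; first by rewrite scaler0; split => //; exact: (submod0 hA).
  move=> a x y [Ax ex] [Ay ey]; split; first exact: hA.2.
  by rewrite scalerDr ey scalerA mulrC -scalerA ex.
have [T [i [li ii eT]]] := sub_exists hT.
have PT : pure_injective T.
  apply: pss => a t [s ->]; apply: ii; rewrite (linZ li) (lin0 li) -scalerA.
  have [_ e1] : A (i t) /\ e *: i t = i t by apply/eT; exists t.
  by rewrite scalerBl scale1r e1 subrr scaler0.
have idem1e : (1 - e) * (1 - e) = 1 - e.
  by rewrite mulrBr mulr1 mulrBl mul1r ee subrr subr0.
have e0' x : (1 - e) *: (e *: x) = 0.
  by rewrite scalerA mulrBl mul1r ee subrr scale0r.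
have pT : pure_sub (fun y => exists t, y = i t).
  move=> m n r a ha hb.
  have ha' k : A (a k) /\ e *: a k = a k by apply/eT.
  have [|b [h1 h2]] := pA m n r a _ hb; first by move=> k; case: (ha' k).
  exists (fun j => e *: b j); split.
    move=> j; apply/eT; split; first exact: (submodZ hA _ (h1 j)).
    by rewrite scalerA ee.
  move=> k; have := congr1 (fun z => e *: z) (h2 k).
  rewrite scaler0 scalerBr (ha' k).2 scaler_sumr => h; rewrite -[RHS]h; congr (_ - _).
  by apply: eq_bigr => j _; rewrite !scalerA mulrC.
have [h [lh hh]] := pure_injective_retract PT li ii pT.
pose K x := e *: x = x /\ h x = 0.
have hK : is_submod K.
  split; first by rewrite /K scaler0 (lin0 lh).
  move=> a x y [ex hx] [ey hy]; split; last by rewrite lh hx hy scaler0 addr0.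
  by rewrite scalerDr ey scalerA mulrC -scalerA ex.
have iA t : A (i t) /\ e *: i t = i t by apply/eT; exists t.
have K0 : forall x, K x -> x = 0.
  apply: eA => //.
    move=> x [ex hx] Ax; have /eT [t et] := conj Ax ex.
    by move: hx; rewrite et hh => ->; exact: lin0 li.
  (* The [1 - e] part of the system is solved by the purity of [A], the [e] part by applying [h]. *)
  move=> m n r a ha [b hb].
  have [||c [c1 c2]] := pA m n r (fun k => (1 - e) *: a k).
  - by move=> k; exact: (submodZ hA _ (ha k)).
  - exists (fun j => (1 - e) *: b j) => k.
    rewrite (_ : _ - _ = (1 - e) *: (\sum_(j < n) r k j *: b j - a k)).
      by case: (hb k) => <- _; exact: e0'.
    rewrite scalerBr scaler_sumr; congr (_ - _).
    by apply: eq_bigr => j _; rewrite !scalerA mulrC.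
  exists (fun j => (1 - e) *: c j + i (h (e *: b j))); split.
    by move=> j; apply: (submodD hA); [exact: (submodZ hA _ (c1 j))|case: (iA (h (e *: b j)))].
  move=> k; set z := (X in K X).
  suff -> : z = 0 by exact: submod0 hK.
  have e1 : \sum_(j < n) r k j *: i (h (e *: b j)) = e *: a k.
    have /eT [t et] : A (e *: a k) /\ e *: (e *: a k) = e *: a k.
      by rewrite scalerA ee; split => //; exact: (submodZ hA _ (ha k)).
    have : h (e *: (\sum_(j < n) r k j *: b j - a k)) = 0.
      by case: (hb k) => ->.
    rewrite scalerBr (linB lh) et hh => /subr0_eq <-.
    rewrite scaler_sumr (lin_sum lh) (lin_sum li); apply: eq_bigr => j _.
    by rewrite -(linZ li) -(linZ lh) !scalerA mulrC.
  have e2 : \sum_(j < n) r k j *: ((1 - e) *: c j) = (1 - e) *: a k.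
    have /subr0_eq := c2 k => /(congr1 (fun z => (1 - e) *: z)).
    rewrite scaler_sumr scalerA idem1e => <-; apply: eq_bigr => j _.
    by rewrite !scalerA mulrC.
  rewrite /z; under eq_bigr => j _ do rewrite scalerDr.
  by rewrite big_split /= e1 e2 -scalerDl subrK scale1r subrr.
move=> x.
have : K (e *: x - i (h (e *: x))).
  split; first by rewrite scalerBr scalerA ee (iA _).2.
  by rewrite (linB lh) hh subrr.
by move=> /K0 /subr0_eq ->; case: (iA (h (e *: x))).
Qed.
End Cond5.

(** * Flatness of R/I-modules and its consequences *)

Section Cond5Consequences.
Variable R : comNzRingType.
Implicit Types (M B F : lmodType R).

(* The part of condition (5) that makes R/I-modules, I = ideal_gen E, flat over R. *)
Definition flat_ideal (E : R -> Prop) :=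
  [/\ forall e, E e -> e * e = e,
      forall e, E e -> quot_pure_semisimple (principal_ideal (1 - e))
    & quot_vN_regular (ideal_gen E)].

Lemma cond5_flat_ideal : cond5 R -> exists E, flat_ideal E.
Proof.
move=> [E [prim _ pss reg]]; exists E; split => //.
  by move=> e /prim [].
by move=> e /pss [].
Qed.

Section FlatIdeal.
Variables (E : R -> Prop) (hE : flat_ideal E).
Let I := ideal_gen E.

Lemma killed_flat F : (forall a (x : F), I a -> a *: x = 0) -> flat F.
Proof. by case: hE => ? _ ?; apply: flat_killed. Qed.

Lemma pure_essential_absorbs B (A : B -> Prop) : is_submod A -> pure_essential_ext A ->
  forall a x, I a -> A (a *: x).
Proof.
case: hE => idE pss _ hA pA a x [n [e [c [he ->]]]].
rewrite scaler_suml; apply: (submod_sum hA) => i _; rewrite -scalerA; apply: (submodZ hA).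
by apply: (pure_essential_idem hA) => //; [apply: idE|apply: pss].
Qed.

Lemma absorbs_pure B (A K : B -> Prop) : is_submod A -> is_submod K ->
  (forall a x, I a -> exists y, A y /\ K (a *: x - y)) -> pure_sub_mod A K.
Proof.
move=> hA hK abs.
have hAK : is_submod (fun x => exists a, A a /\ K (x - a)).
  split; first by exists 0; rewrite subrr; split; [exact: (submod0 hA)|exact: (submod0 hK)].
  move=> r x y [a [Aa Ka]] [b [Ab Kb]]; exists (r *: a + b); split; first exact: hA.2.
  by rewrite opprD addrACA -scalerBr; exact: hK.2.
have [F [p [lp sp kp]]] := quot_exists hAK.
apply: (flat_pure_mod hA hK lp sp).
- by move=> x /kp.
- move=> x [Ax|Kx]; apply/kp.
    by exists x; rewrite subrr; split => //; exact: (submod0 hK).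
  by exists 0; rewrite subr0; split => //; exact: (submod0 hA).
- apply: killed_flat => a z Ia; have [x <-] := sp z.
  by rewrite -(linZ lp); apply/kp; exact: abs.
Qed.

Lemma flat_ideal_essential B (A : B -> Prop) : is_submod A ->
  pure_essential_ext A -> essential_ext A.
Proof.
move=> hA pA K hK [x [Kx x0]]; apply: contrapT => none.
apply: x0; apply: (pA.2 K hK) => //.
  by move=> y Ky Ay; apply: contrapT => y0; apply: none; exists y.
apply: absorbs_pure => // a y Ia; exists (a *: y); rewrite subrr.
by split; [exact: pure_essential_absorbs|exact: (submod0 hK)].
Qed.

Lemma flat_ideal_cond4 : cond4 R.
Proof.
move=> M; split=> [PM C _ fC|ext]; first exact: pure_injective_ext.
apply: pure_injective_split => X f lf jf pf.
have [Q [p [lp jp ep]]] := pure_essential_quotient lf jf pf.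
have lpf := lin_comp lf lp.
have hA := range_submod lpf.
have abs := pure_essential_absorbs hA ep.
(* The inverse of [p \o f] on its image; an extension of it to [Q] gives the retraction. *)
pose G0 (z : Q * M) := z.1 = p (f z.2).
have [||h [lh hh]] := @graph_extend R Q M G0; last first.
- by exists (h \o p); split; [exact: lin_comp|move=> x; exact: hh].
- move=> G GG sG x.
  (* The ideal of scalars carrying [x] into the domain of [G]. It contains [I], since [I Q] lies in
     the image of [M], so R/T is cyclic and flat. *)
  pose T (r : R^o) := exists m, G (r *: x, m).
  have hT : is_submod T.
    split; first by exists 0; rewrite scale0r; exact: (submod0 GG.1).
    move=> a r s [m Gr] [m' Gs]; exists (a *: m + m').
    have := GG.1.2 a _ _ Gr Gs; congr G; congr (_, _).
    by rewrite scalerDl -[a *: r]/(a * r) -scalerA.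
  have [S [i [li ii eS]]] := sub_exists hT.
  have [C [q [lq sq kq]]] := quot_exists hT.
  have TI a : I a -> T a.
    move=> /(abs a x) [m em]; exists m; apply: sG; exact: em.
  have [g hg] := choice (fun s => (eS (i s)).2 (ex_intro _ s erefl)).
  have lg : is_lin g.
    move=> a s t; apply: (graph_fun_uniq GG (hg _)).
    have := GG.1.2 a _ _ (hg s) (hg t); congr G; congr (_, _).
    by rewrite li scalerDl -[a *: i s]/(a * i s) -scalerA.
  have [|||k [lk ek]] := ext_extend (ext C _ _) li lq lg ii sq _.
  + exists (q 1) => y; have [r <-] := sq y; exists r.
    by rewrite -(linZ lq); congr q; rewrite /GRing.scale /= mulr1.
  + apply: killed_flat => a y Ia; have [r <-] := sq y.
    rewrite -(linZ lq); apply/kq.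
    rewrite (_ : a *: r = r *: (a : R^o)); first exact: (submodZ hT r (TI a Ia)).
    by rewrite /GRing.scale /= mulrC.
  + by move=> y; rewrite kq.
  exists (k 1) => r m Gr.
  have /eS [s es] : T r by exists m.
  rewrite -(linZ lk) (_ : r *: (1 : R^o) = i s) ?ek; last by rewrite -es /GRing.scale /= mulr1.
  by apply: (graph_fun_uniq GG Gr); rewrite es.
- split.
    split; first by rewrite /G0 /= (lin0 lf) (lin0 lp).
    by move=> a [y m] [y' m']; rewrite /G0 /= => -> ->; rewrite lf lp.
  by move=> m /esym /(inj_lin_eq0 lpf jp).
Qed.

(** Finitely presented modules are projective relative to pure sequences: the relations, evaluated
    on lifts [y] of the generators, form a finite system with constants in [f M], and a solution [b]
    there corrects [y] to a section. *)
Lemma fin_pres_pure_split F M (Y : lmodType R) (f : M -> Y) (g : Y -> F) : fin_pres F ->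
  is_lin f -> is_lin g -> injective f -> (forall z, exists y, g y = z) ->
  (forall y, g y = 0 <-> exists x, y = f x) -> pure_sub (fun y => exists x, y = f x) ->
  exists r : Y -> M, is_lin r /\ forall x, r (f x) = x.
Proof.
move=> [n [phi [lphi sphi [k [s hs]]]]] lf lg jf sg kg pf.
have [y hy] := choice (fun j : 'I_n => sg (phi (delta_mx 0 j))).
pose psi (y : 'I_n -> Y) (v : 'rV[R]_n) := \sum_j v 0 j *: y j.
have lpsi y' : is_lin (psi y').
  move=> a u v; rewrite /psi scaler_sumr -big_split /=; apply: eq_bigr => j _.
  by rewrite !mxE scalerDl scalerA.
have gpsi v : g (psi y v) = phi v.
  rewrite [in RHS](row_sum_delta v) (lin_sum lg) (lin_sum lphi).
  by apply: eq_bigr => j _; rewrite (linZ lg) (linZ lphi) hy.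
have kpsi i : exists x, psi y (s i) = f x.
  apply/kg; rewrite gpsi; apply/hs; exists (fun j => (i == j)%:R).
  rewrite (bigD1 i) //= eqxx scale1r big1 ?addr0 // => j ji.
  by rewrite eq_sym (negPf ji) scale0r.
have [|b [h1 h2]] := pf k n (fun i j => s i 0 j) (fun i => psi y (s i)) kpsi.
  by exists y => i; rewrite subrr.
have k' v : phi v = 0 -> psi (fun j => y j - b j) v = 0.
  move=> /hs [c ->]; rewrite (lin_sum (lpsi _)) big1 // => i _.
  rewrite (linZ (lpsi _)) /psi.
  under eq_bigr => j _ do rewrite scalerBr.
  by rewrite sumrB (subr0_eq (h2 i)) subrr scaler0.
have sphi' z : exists v, phi v = z by have [v ->] := (sphi z).1 Logic.I; exists v.
have [t [lt et]] := lin_factor lphi sphi' (lpsi _) k'.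
have gt z : g (t z) = z.
  have [v ->] := (sphi z).1 Logic.I; rewrite et /psi -gpsi !(lin_sum lg).
  apply: eq_bigr => j _; rewrite !(linZ lg) (linB lg).
  by have [x ->] := h1 j; rewrite (_ : g (f x) = 0) ?subr0 //; apply/kg; exists x.
have lt' : is_lin (fun z => z - t (g z)).
  by move=> a u v; rewrite lg lt opprD addrACA scalerBr.
have [|r [lr er]] := lin_lift lf jf lt'.
  by move=> z; apply/kg; rewrite (linB lg) gt subrr.
exists r; split => // x; apply: jf; rewrite er.
by rewrite (_ : g (f x) = 0) ?(lin0 lt) ?subr0 //; apply/kg; exists x.
Qed.

Lemma flat_ideal_cond6 : cond6 R.
Proof.
move=> M X Q f g lf jf PX pe lg sg kg.
have hA := range_submod lf.
have abs := pure_essential_absorbs hA pe.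
have kQ a (z : Q) : I a -> a *: z = 0.
  move=> Ia; have [x <-] := sg z; rewrite -(linZ lg); apply/kg; exact: abs.
split; first exact: killed_flat.
- move=> F pF Y h k lh lk jh sk kk.
  apply: (fin_pres_pure_split pF lh lk jh sk kk).
  have hT : is_submod (fun _ : Y => True) by [].
  have hIY := ideal_mul_sub I hT.
  have hH := range_submod lh.
  (* Modulo [I Y] the submodule [h Q] is pure. The error of a solution found there lies in [I Y] and
     in [h Q]: a local unit [u] of [I] both fixes and kills it. *)
  have pu : pure_sub_mod (fun y => exists x, y = h x) (ideal_mul I (fun _ : Y => True)).
    apply: absorbs_pure => // a x Ia; exists 0; split; first exact: (submod0 hH).
    by rewrite subr0; apply: ideal_mul_gen.
  move=> m n r a ha [b hb].
  have [|c [c1 c2]] := pu m n r a ha.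
    by exists b => i; rewrite hb; exact: (submod0 hIY).
  exists c; split => // i.
  have [|w ew] := submodB hH (_ : exists x, \sum_(j < n) r i j *: c j = h x) (ha i).
    by apply: (submod_sum hH) => j _; exact: (submodZ hH _ (c1 j)).
  have [l [d [v [hd ed]]]] := c2 i.
  have [u [Iu _ du]] := ideal_gen_unit (let: And3 x _ _ := hE in x) (fun j => (hd j).1).
  have : u *: (\sum_(j < n) r i j *: c j - a i) = 0.
    by rewrite ew -(linZ lh) kQ // (lin0 lh).
  rewrite ed scaler_sumr => e0; rewrite -[RHS]e0; apply: eq_bigr => j _.
  by rewrite scalerA mulrC du.
- move=> T hT; apply: absorbs_pure => //; first exact: zero_submod.
  by move=> a z Ia; exists 0; rewrite subr0 kQ //; split => //; exact: (submod0 hT).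
Qed.
End FlatIdeal.

Lemma cond5_cond4 : cond5 R -> cond4 R.
Proof. by move=> /cond5_flat_ideal [E hE]; exact: (flat_ideal_cond4 hE). Qed.

Lemma cond4_cond1 : cond4 R -> cond1 R.
Proof. by move=> h M cM; apply/h => C _; exact: cM. Qed.

End Cond5Consequences.

(** * Zero-dimensional rings and primitive idempotents *)

Section Rings.
Variable R : comNzRingType.
Implicit Types (x r s e f g : R).

Definition nilp_elt x := exists k, x ^+ k = 0.

Lemma nilp_eltM x r : nilp_elt x -> nilp_elt (r * x).
Proof. by move=> [k hk]; exists k; rewrite exprMn hk mulr0. Qed.

Lemma nilpD x r : nilp_elt x -> nilp_elt r -> nilp_elt (x + r).
Proof.
move=> [m hm] [n hn]; exists (m + n)%N; rewrite exprDn big1 // => i _.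
have [le|lt] := leqP n i.
  by rewrite -(subnK le) (exprD r) hn !mulr0 mul0rn.
have le : (m <= m + n - i)%N by rewrite -addnBA ?leq_addr // ltnW.
by rewrite -(subnK le) exprD hm mulr0 mul0r mul0rn.
Qed.

Lemma nilp_idem e : e * e = e -> nilp_elt e -> e = 0.
Proof.
move=> ee [k hk].
have h j : e ^+ j.+1 = e by elim: j => [|j IH]; rewrite ?expr1 // exprS IH.
by rewrite -(h k) exprS hk mulr0.
Qed.

Lemma nilp_fix x r s : nilp_elt x -> r = r * (x * s) -> r = 0.
Proof.
move=> [k hk] e.
have h j : r = r * (x * s) ^+ j.
  by elim: j => [|j IH]; rewrite ?expr0 ?mulr1 // exprS mulrA -e.
by rewrite (h k) exprMn hk mul0r mulr0.
Qed.

(** Strong pi-regularity, which for commutative rings amounts to Krull dimension zero. *)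
Definition zero_dim := forall r, exists n s, r ^+ n = r ^+ n.+1 * s.

(** The ideal is [r R] plus the annihilators of the powers of [r]: if [1 = r t + c] with
    [c r^k = 0], then [r^k = r^(k+1) t]. *)
Lemma power_ideal r : ~ (exists n s, r ^+ n = r ^+ n.+1 * s) ->
  exists I : R -> Prop, [/\ is_ideal I, ~ I 1, I r & forall k c, c * r ^+ k = 0 -> I c].
Proof.
move=> nz.
exists (fun s => exists k t c, s = r * t + c /\ c * r ^+ k = 0); split.
- split; first by exists 0%N, 0, 0; rewrite mulr0 mul0r addr0.
  move=> a _ _ [k [t [c [-> hc]]]] [k' [t' [c' [-> hc']]]].
  exists (k + k')%N, (a * t + t'), (a * c + c'); split.
    by rewrite -[_ *: _]/(a * (r * t + c)); ring.
  transitivity (a * (c * r ^+ k) * r ^+ k' + c' * r ^+ k' * r ^+ k); first by rewrite exprD; ring.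
  by rewrite hc hc'; ring.
- move=> [k [t [c [e hc]]]]; apply: nz; exists k, t.
  by rewrite -[LHS]mul1r e mulrDl hc addr0 exprS; ring.
- by exists 0%N, 1, 0; rewrite mulr1 addr0 mul0r.
- by move=> k c hc; exists k, 0, c; rewrite mulr0 add0r.
Qed.

Lemma zero_dim_idem : zero_dim -> forall r, exists g t,
  [/\ g * g = g, g = r * t & nilp_elt ((1 - g) * r)].
Proof.
move=> zd r; have [n [s hn]] := zd r.
have hN : r ^+ n.+1 = r ^+ n.+2 * s by rewrite exprS hn mulrA -exprS.
have h k : r ^+ n.+1 = r ^+ (n.+1 + k) * s ^+ k.
  elim: k => [|k IH]; first by rewrite addn0 expr0 mulr1.
  rewrite {1}IH exprD hN -addSnnS exprD (exprS s); ring.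
(* With [N = n + 1], [r^N = r^(2N) s^N], so [r^N s^N] is idempotent; the exponent is [n + 1], not
   [n], to make it visibly a multiple of [r]. *)
exists (r ^+ n.+1 * s ^+ n.+1), (r ^+ n * s ^+ n.+1).
have gg : r ^+ n.+1 * s ^+ n.+1 * r ^+ n.+1 = r ^+ n.+1.
  by rewrite mulrAC -exprD -h.
split; [by rewrite mulrA gg|by rewrite mulrA -exprS|].
exists n.+1; rewrite exprMn exprS -mulrA mulrCA mulrBl mul1r gg subrr mulr0.
by [].
Qed.

(** The equation says that [x] is regular in the factor [e n R]; if [x] is nilpotent it forces
    [e n * x = 0]. *)
Definition no_orthogonal := forall x (e : nat -> R), (forall n, e n * e n = e n) ->
  (forall m n, m <> n -> e m * e n = 0) -> exists n s, e n * x = x * x * s.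

Definition greatest_idem := forall x, exists f, [/\ f * f = f, f * x = 0 &
  forall g, g * g = g -> g * x = 0 -> g * f = g].

Definition primitive_sum g := exists l : seq R,
  (forall e, e \in l -> primitive_idem e) /\ g = \sum_(e <- l) e.

Lemma primitive_sumD f g : primitive_sum f -> primitive_sum g -> primitive_sum (f + g).
Proof.
move=> [l [hl ->]] [l' [hl' ->]]; exists (l ++ l'); rewrite big_cat; split => // e.
by rewrite mem_cat => /orP[/hl|/hl'].
Qed.

Lemma not_primitive_sum_split g : g * g = g -> ~ primitive_sum g ->
  exists g', [/\ g' * g' = g', g' * g = g', g' <> g & ~ primitive_sum g'].
Proof.
move=> gg bad; apply: contrapT => none; apply: bad.
have [->|/eqP g0] := eqVneq g 0; first by exists [::]; rewrite big_nil.
have [np|ns] := pselect (forall f, f * f = f -> f * g = f -> f = 0 \/ f = g).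
  by exists [:: g]; rewrite big_seq1; split => // e; rewrite inE => /eqP ->.
have [f [ff fg f0 nfg]] : exists f, [/\ f * f = f, f * g = f, f <> 0 & f <> g].
  apply: contrapT => nex; apply: ns => f ff fg.
  have [?|f0] := pselect (f = 0); first by left.
  by right; apply: contrapT => nfg; apply: nex; exists f.
rewrite -(subrK f g) addrC.
have gf : g * f = f by rewrite mulrC.
apply: primitive_sumD; apply: contrapT => bad; apply: none.
  by exists f.
exists (g - f); split => //.
- by rewrite mulrBr !mulrBl gg fg gf ff subrr subr0.
- by rewrite mulrBl gg fg.
- by move/eqP; rewrite -subr_eq0 addrAC subrr sub0r oppr_eq0 => /eqP.
Qed.

(** Otherwise [1 - f] can be split forever into smaller bad idempotents. Their successive
    differences [e n] are orthogonal, so one of them kills [x]; it lies below [f] and below [1 - f],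
    hence is 0. *)
Lemma finite_decomposition x : no_orthogonal -> greatest_idem -> nilp_elt x ->
  exists f, [/\ f * f = f, f * x = 0 & primitive_sum (1 - f)].
Proof.
move=> NA MI nx; have [f [ff fx maxf]] := MI x.
exists f; split => //; apply: contrapT => bad.
pose T := {g | [/\ g * g = g, g * (1 - f) = g & ~ primitive_sum g]}.
have step (g : T) : exists g' : T, sval g' * sval g = sval g' /\ sval g' <> sval g.
  case: g => g [gg g1 gb] /=.
  have [g' [h1 h2 h3 h4]] := not_primitive_sum_split gg gb.
  have h5 : g' * (1 - f) = g' by rewrite -{1}h2 -mulrA g1 h2.
  by exists (exist _ g' (And3 h1 h5 h4)).
have [nx' hnx] := choice step.
have i1 : (1 - f) * (1 - f) = 1 - f.
  by rewrite mulrBl mul1r mulrBr mulr1 ff subrr subr0.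
pose s n := sval (iter n nx' (exist _ (1 - f) (And3 i1 i1 bad) : T)).
have sid n : s n * s n = s n by rewrite /s; case: (iter _ _ _) => g [].
have sf n : s n * (1 - f) = s n by rewrite /s; case: (iter _ _ _) => g [].
have s1 n : s n.+1 * s n = s n.+1 by case: (hnx (iter n nx' (exist _ (1 - f) (And3 i1 i1 bad) : T))).
have sne n : s n.+1 <> s n by case: (hnx (iter n nx' (exist _ (1 - f) (And3 i1 i1 bad) : T))).
have sD n k : s (n + k)%N * s n = s (n + k)%N.
  elim: k => [|k IH]; first by rewrite addn0.
  by rewrite addnS -{1}s1 -mulrA IH s1.
pose e n := s n - s n.+1.
have eid n : e n * e n = e n.
  by rewrite /e mulrBr !mulrBl !sid s1 [s n * _]mulrC s1 subrr subr0.
have orth0 m n : (m < n)%N -> e m * e n = 0.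
  move=> lt; have le := ltnW lt.
  have h1 : s m * s n = s n by rewrite -(subnKC le) mulrC sD.
  have h2 : s m.+1 * s n = s n by rewrite -(subnKC lt) mulrC sD.
  have h3 : s m * s n.+1 = s n.+1 by rewrite -(s1 n) mulrCA h1.
  have h4 : s m.+1 * s n.+1 = s n.+1 by rewrite -(s1 n) mulrCA h2.
  by rewrite /e mulrBl !mulrBr h1 h2 h3 h4 subrr.
have [|n [t ht]] := NA x e eid.
  move=> m n mn; have [lt|lt|//] := ltngtP m n; first exact: orth0.
  by rewrite mulrC orth0.
have ex0 : e n * x = 0.
  apply: (nilp_fix (s := t) nx).
  have : e n * (e n * x) = e n * (x * x * t) by rewrite ht.
  by rewrite mulrA eid => {1}->; ring.
have e1 : e n * (1 - f) = e n by rewrite /e mulrBl !sf.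
rewrite mulrBr mulr1 (maxf _ (eid n) ex0) subrr in e1.
by apply: (sne n); apply/esym/subr0_eq; rewrite -/(e n) -e1.
Qed.

Lemma primitive_orthogonal e f : primitive_idem e -> primitive_idem f -> e <> f -> e * f = 0.
Proof.
move=> [ee e0 pe] [ff f0 pf] ef.
have ii : (e * f) * (e * f) = e * f by rewrite mulrACA ee ff.
have [//|h] := pe (e * f) ii ltac:(by rewrite mulrAC ee).
have [//|h'] := pf (e * f) ii ltac:(by rewrite -mulrA ff).
by case: ef; rewrite -h h'.
Qed.

(** [E] consists of the primitive idempotents [e] with [e R] not a field. Each [r] is regular up to
    a nilpotent [x], whose components in the factors that are fields vanish. *)
Lemma cond5_intro : zero_dim -> no_orthogonal -> greatest_idem ->
  (forall e, primitive_idem e -> quot_pure_semisimple (principal_ideal (1 - e))) -> cond5 R.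
Proof.
move=> zd NA MI pss.
pose E e := primitive_idem e /\ ~ quot_is_field (principal_ideal (1 - e)).
exists E; split.
- by move=> e [].
- by move=> e f [pe _] [pf _]; exact: primitive_orthogonal.
- by move=> e [pe ne]; split => //; exact: pss.
move=> r; have [g [t [gg gt nx]]] := zero_dim_idem zd r.
exists t; rewrite -gt.
have -> : r - g * r = (1 - g) * r by rewrite mulrBl mul1r.
set x := (1 - g) * r in nx *.
have [f [ff fx [l [hl el]]]] := finite_decomposition NA MI nx.
have -> : x = \sum_(e <- l) e * x by rewrite -mulr_suml -el mulrBl mul1r fx subr0.
rewrite big_seq; apply: (submod_sum (ideal_gen_ideal E)) => e /hl pe.
have [fe|nfe] := pselect (quot_is_field (principal_ideal (1 - e))); last first.
  by rewrite mulrC; apply: (submodZ (ideal_gen_ideal E) x); apply: ideal_gen_mem.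
suff -> : e * x = 0 by exact: (submod0 (ideal_gen_ideal E)).
have [ee e0 _] := pe.
have e1 : e * (1 - e) = 0 by rewrite mulrBr mulr1 ee subrr.
apply: contrapT => ex; have [|y [c hy]] := fe.2 x.
  by move=> [c hc]; apply: ex; rewrite hc mulrCA e1 mulr0.
apply: e0; apply: nilp_idem => //.
have -> : e = (e * y) * x.
  have : e * (x * y - 1) = 0 by rewrite hy mulrCA e1 mulr0.
  by rewrite mulrBr mulr1 => /subr0_eq h; rewrite -{1}h; ring.
exact: nilp_eltM.
Qed.

(** The inverse image in R of the nilradical of [e R], so that facts about maximal ideals of R apply
    without passing to the ring [e R]. *)
Definition local_max e : R -> Prop := fun s => nilp_elt (e * s).

Lemma primitive_local e : zero_dim -> primitive_idem e ->
  forall s, local_max e s \/ exists t, e * s * t = e.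
Proof.
move=> zd [ee e0 pe] s; have [g [t [gg gt nx]]] := zero_dim_idem zd (e * s).
have ge : g * e = g.
  by rewrite gt -[in RHS]ee; ring.
have [g0|g0] := pe g gg ge.
  by left; move: nx; rewrite g0 subr0 mul1r.
by right; exists t; rewrite -gt.
Qed.

Lemma local_max_maximal e : zero_dim -> primitive_idem e -> maximal_ideal (local_max e).
Proof.
move=> zd pe; have [ee e0 _] := pe; split.
- split; first by exists 1%N; rewrite mulr0 expr1.
  move=> a x y hx hy; rewrite /local_max mulrDr; apply: nilpD => //.
  by rewrite -[a *: x]/(a * x) mulrCA; apply: nilp_eltM.
- by rewrite /local_max mulr1 => /(nilp_idem ee).
- move=> s ns; have [//|[t ht]] := primitive_local zd pe s.
  by exists t; exists 1%N; rewrite expr1 mulrBr mulr1 mulrA ht subrr.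
Qed.

Fixpoint ideal_span (l : seq R) (s : R) : Prop :=
  if l is a :: l' then exists c s', s = c * a + s' /\ ideal_span l' s' else s = 0.

Lemma ideal_span_ideal l : is_ideal (ideal_span l).
Proof.
elim: l => [|a l IH]; first exact: (zero_submod R^o).
split; first by exists 0, 0; rewrite mul0r addr0; split => //; exact: (submod0 IH).
move=> r _ _ [c [s [-> hs]]] [c' [s' [-> hs']]].
exists (r * c + c'), (r * s + s'); split; last exact: IH.2.
by rewrite -[_ *: _]/(r * (c * a + s)); ring.
Qed.

Lemma ideal_span_cons a l s : ideal_span l s -> ideal_span (a :: l) s.
Proof. by exists 0, s; rewrite mul0r add0r. Qed.

Lemma ideal_span_mem l a : a \in l -> ideal_span l a.
Proof.
elim: l => // b l IH; rewrite inE => /orP[/eqP ->|/IH]; last exact: ideal_span_cons.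
by exists 1, 0; rewrite mul1r addr0; split => //; exact: (submod0 (ideal_span_ideal l)).
Qed.

Lemma ideal_span_min l (I : R -> Prop) : is_ideal I -> (forall a, a \in l -> I a) ->
  forall s, ideal_span l s -> I s.
Proof.
move=> hI; elim: l => [|a l IH] h s /=; first by move=> ->; exact: (submod0 hI).
move=> [c [s' [-> /IH hs]]]; apply: (submodD hI).
  by apply: (submodZ hI c); apply: h; rewrite inE eqxx.
by apply: hs => b bl; apply: h; rewrite inE bl orbT.
Qed.

Lemma ideal_span_sub l l' : (forall a, a \in l -> a \in l') -> forall s, ideal_span l s -> ideal_span l' s.
Proof. by move=> h; apply: (ideal_span_min (ideal_span_ideal l')) => a /h; exact: ideal_span_mem. Qed.

Lemma ideal_span_sumP l s : ideal_span l s <-> exists c : 'I_(size l) -> R, s = \sum_(i < size l) c i * l`_i.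
Proof.
split; last first.
  move=> [c ->]; apply: (submod_sum (ideal_span_ideal l)) => i _; apply: (submodZ (ideal_span_ideal l) (c i)).
  by apply: ideal_span_mem; apply: mem_nth.
elim: l s => [|a l IH] s /=; first by move=> ->; exists (fun=> 0); rewrite big_ord0.
move=> [c [s' [-> /IH [d ->]]]].
exists (fun i => if unlift ord0 i is Some j then d j else c).
rewrite big_ord_recl unlift_none; congr (_ + _).
by apply: eq_bigr => i _; rewrite liftK.
Qed.

Definition fg (I : R -> Prop) := exists l, forall s, I s <-> ideal_span l s.
Definition ann r : R -> Prop := fun s => s * r = 0.

Lemma ann_ideal r : is_ideal (ann r).
Proof.
split; first by rewrite /ann mul0r.
by move=> a x y hx hy; rewrite /ann mulrDl -[a *: x]/(a * x) -mulrA hx hy mulr0 addr0.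
Qed.

Lemma P_coherentP : P_coherent R <-> forall r, fg (ann r).
Proof.
split=> h r; last first.
  have [l hl] := h r.
  exists 1%N, (fun v => r * v 0 0); split.
  - by move=> a u v; rewrite !mxE -[RHS]/(a * (r * u 0 0) + r * v 0 0); ring.
  - move=> y; split=> [[s ->]|[v ->]]; last by exists (v 0 0).
    by exists (const_mx s); rewrite mxE.
  exists (size l), (fun i => const_mx l`_i) => v.
  transitivity (ann r (v 0 0)); first by rewrite /ann mulrC.
  rewrite hl ideal_span_sumP; split=> [[c hc]|[c ->]]; exists c.
    by apply/rowP => j; rewrite ord1 hc summxE; apply: eq_bigr => i _; rewrite !mxE.
  by rewrite summxE; apply: eq_bigr => i _; rewrite !mxE.
have [n [f [lf im [k [s hs]]]]] := h r.
have [v0 hv0] : exists v, r = f v by apply/im; exists 1; rewrite mulr1.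
have /choice [t ht] : forall j : 'I_n, exists t, f (delta_mx 0 j) = r * t.
  by move=> j; apply/im; exists (delta_mx 0 j).
pose lam (v : 'rV[R]_n) := \sum_j v 0 j * t j.
have llam a u v : lam (a *: u + v) = a * lam u + lam v.
  rewrite /lam mulr_sumr -big_split /=; apply: eq_bigr => j _.
  by rewrite !mxE mulrDl mulrA.
have flam v : f v = r * lam v.
  rewrite [in LHS](row_sum_delta v) (lin_sum lf) mulr_sumr; apply: eq_bigr => j _.
  by rewrite (linZ lf) ht -[LHS]/(v 0 j * (r * t j)) mulrCA.
have lam0 v : f v = 0 -> ann r (lam v) by rewrite flam /ann mulrC.
have slam c : lam (\sum_(i < k) c i *: s i) = \sum_(i < k) c i * lam (s i).
  elim: k c s {hs} => [|k IH] c s.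
    by rewrite !big_ord0 /lam big1 // => j _; rewrite mxE mul0r.
  by rewrite !big_ord_recl llam IH.
have si i : f (s i) = 0.
  apply/hs; exists (fun j => (j == i)%:R).
  rewrite (bigD1 i) //= eqxx scale1r big1 ?addr0 // => j ji.
  by rewrite (negPf ji) scale0r.
(* If [x] kills [r], then [x *: v0] is a relation, so [x * lam v0] is a combination of the
   [lam (s i)]; the difference with [x] is a multiple of [lam v0 - 1], which also kills [r]. *)
pose al := lam v0 - 1.
have hal : ann r al.
  by rewrite /ann /al mulrBl mul1r mulrC -flam -hv0 subrr.
exists (al :: [seq lam (s i) | i <- enum 'I_k]) => x; split; last first.
  apply: (ideal_span_min (ann_ideal r)) => a; rewrite inE => /orP[/eqP -> //|/mapP [i _ ->]].
  exact: lam0.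
move=> ax; have : f (x *: v0) = 0 by rewrite (linZ lf) -hv0.
move=> /hs [c hc].
have : lam (x *: v0) = x * lam v0 by have := llam x v0 0; rewrite addr0 => ->; rewrite /lam [X in _ + X]big1 ?addr0 // => j _; rewrite mxE mul0r.
rewrite hc slam => e.
have -> : x = - x * al + \sum_(i < k) c i * lam (s i) by rewrite e /al; ring.
exists (- x), (\sum_(i < k) c i * lam (s i)); split => //.
apply: (submod_sum (ideal_span_ideal _)) => i _; apply: (submodZ (ideal_span_ideal _) (c i)).
by apply: ideal_span_mem; apply: map_f; rewrite mem_enum.
Qed.

End Rings.

(** * Rings whose cotorsion modules are pure-injective *)

Section InjectiveTools.
Variable R : comNzRingType.

Lemma inj_baer (J : lmodType R) (G : R^o * J -> Prop) : inj_graph J -> graph_fun G ->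
  exists u, forall r v, G (r, v) -> v = r *: u.
Proof.
move=> injJ hG; have [h [lh hh]] := injJ R^o G hG.
exists (h 1) => r v /hh <-; rewrite -(linZ lh); congr h.
by rewrite -[RHS]/(r * 1) mulr1.
Qed.

(** The condition says that [s * c |-> s *: v], zero on [I], is well defined on [R c + I]. *)
Lemma inj_solve (J : lmodType R) (I : R -> Prop) (c : R) (v : J) : inj_graph J -> is_ideal I ->
  (forall s, I (s * c) -> s *: v = 0) ->
  exists u, c *: u = v /\ forall a, I a -> a *: u = 0.
Proof.
move=> injJ hI h.
pose G (z : R^o * J) := exists s, I (z.1 - s * c) /\ z.2 = s *: v.
have [|u hu] := @inj_baer J G injJ.
  split.
    split; first by exists 0; rewrite /= mul0r subrr scale0r; split => //; exact: (submod0 hI).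
    move=> a [r w] [r' w'] [s [/= hs ->]] [s' [/= hs' ->]].
    exists (a * s + s') => /=; split; last by rewrite scalerDl scalerA.
    have := hI.2 a _ _ hs hs'; congr I.
    by rewrite -[LHS]/(a * (r - s * c) + (r' - s' * c)) -[a *: r]/(a * r); ring.
  move=> w [s [/= hs ->]]; apply: h.
  by have := submodN hI hs; rewrite sub0r opprK.
exists u; split.
  by apply/esym/hu; exists 1; rewrite /= mul1r subrr scale1r; split => //; exact: (submod0 hI).
by move=> a Ia; apply/esym/hu; exists 0; rewrite /= mul0r subr0 scale0r.
Qed.

Lemma inj_solve2 (J : lmodType R) (a b : R) (v w : J) : inj_graph J ->
  (forall s t, s * a + t * b = 0 -> s *: v + t *: w = 0) ->
  exists u, a *: u = v /\ b *: u = w.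
Proof.
move=> injJ h.
pose G (z : R^o * J) := exists s t, z = (s * a + t * b, s *: v + t *: w).
have [|u hu] := @inj_baer J G injJ.
  split.
    split; first by exists 0, 0; rewrite !mul0r !scale0r !addr0.
    move=> r _ _ [s [t ->]] [s' [t' ->]]; exists (r * s + s'), (r * t + t').
    congr (_, _); first by rewrite -[LHS]/(r * (s * a + t * b) + (s' * a + t' * b)); ring.
    by rewrite /= scalerDr !scalerDl !scalerA addrACA.
  by move=> m [s [t [e ->]]]; apply: h.
exists u; split; apply/esym/hu.
  by exists 1, 0; rewrite !mul0r mul1r !scale0r scale1r !addr0.
by exists 0, 1; rewrite !mul0r mul1r !scale0r scale1r !add0r.
Qed.

Lemma inj_ker (M : lmodType R) (Z : M -> Prop) : is_submod Z ->
  exists (J : lmodType R) (phi : M -> J), [/\ inj_graph J, is_lin phi & forall m, phi m = 0 <-> Z m].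
Proof.
move=> hZ; have [Q [p [lp sp kp]]] := quot_exists hZ.
have [J [i [injJ li ii]]] := enough_injectives Q.
exists J, (i \o p); split => //; first exact: lin_comp.
move=> m /=; rewrite -kp; split; first exact: inj_lin_eq0.
by move=> ->; exact: lin0.
Qed.

Definition dirac (L : Type) (M : lmodType R) (l : L) (x : M) : L -> M :=
  fun k => if `[< k = l >] then x else 0.

Lemma diracE (L : Type) (M : lmodType R) (l : L) (x : M) : dirac l x l = x.
Proof. by rewrite /dirac; case: asboolP. Qed.

Lemma dirac_neq (L : Type) (M : lmodType R) (l k : L) (x : M) : k <> l -> dirac l x k = 0.
Proof. by rewrite /dirac; case: asboolP. Qed.

Lemma diracZ (L : Type) (M : lmodType R) (l : L) (x : M) a :
  a *: dirac l x = dirac l (a *: x).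
Proof.
apply/funext => k; rewrite -[LHS]/(a *: dirac l x k) /dirac.
by case: ifP; rewrite ?scaler0.
Qed.

(** Embed the product of all R/I_l in one injective module; [eta l] is the image of the generator of
    the [l]-th factor. *)
Lemma inj_family (L : Type) (I : L -> R -> Prop) : (forall l, is_ideal (I l)) ->
  exists (J : lmodType R) (eta : L -> J), inj_graph J /\ forall l s, s *: eta l = 0 <-> I l s.
Proof.
move=> hI.
have hZ : is_submod (fun f : L -> R^o => forall l, I l (f l)).
  split; first by move=> l; exact: (submod0 (hI l)).
  by move=> a x y hx hy l; apply: (hI l).2.
have [J [phi [injJ lphi kphi]]] := inj_ker hZ.
exists J, (fun l => phi (dirac l (1 : R^o))); split => // l s.
rewrite -(linZ lphi) kphi diracZ; split=> [/(_ l)|h k].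
  by rewrite diracE -[_ *: _]/(s * 1) mulr1.
have [->|kl] := pselect (k = l); last by rewrite dirac_neq //; exact: (submod0 (hI k)).
by rewrite diracE -[_ *: _]/(s * 1) mulr1.
Qed.

Lemma nat_limit (X : lmodType R) : pure_injective X ->
  exists lim : (nat -> X) -> X, [/\ is_lin lim, forall x, lim (fun _ => x) = x &
    forall (u v : nat -> X) n, (forall k, (n <= k)%N -> u k = v k) -> lim u = lim v].
Proof.
move=> PX.
have [||||lim [h1 h2 h3]] := @pi_limit R X nat
   (fun P => exists n, forall k, (n <= k)%N -> P k) PX.
- by exists 0%N.
- move=> P Q [n hn] [m hm]; exists (maxn n m) => k; rewrite geq_max => /andP[? ?].
  by split; [apply: hn|apply: hm].
- by move=> P Q [n hn] h; exists n => k /hn; apply: h.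
- by move=> P [n hn]; exists n; apply: hn.
by exists lim; split => // u v n h; apply: h3; exists n.
Qed.
Lemma pi_on_torsion (M J : lmodType R) (x : R) : inj_graph J ->
  pi_on (fun z : M * J => z.1 = 0 /\ x *: z.2 = 0).
Proof.
move=> injJ S i li ii eS.
apply: (@pi_on_ann R J unit (fun _ a => a = x) injJ S (fun s _ => (i s).2)).
- by move=> a s t; apply/funext => l; rewrite li.
- move=> s t e; apply: ii; have [es _] := (eS (i s)).2 (ex_intro _ s erefl).
  have [et _] := (eS (i t)).2 (ex_intro _ t erefl).
  have e2 := congr1 (fun f => f tt) e.
  by case: (i s) (i t) es et e2 => [? ?] [? ?] /= -> -> ->.
- move=> v; split=> [hv|[s es] l a ->].
    have [|s es] := (eS (0, v tt)).1; last by exists s; apply/funext => -[]; rewrite -es.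
    by split => //; apply: (hv tt).
  by rewrite es; have [_] := (eS (i s)).2 (ex_intro _ s erefl).
Qed.
End InjectiveTools.

(** * Push-outs and limits: dimension zero and orthogonal idempotents *)

Section Push.
Variables (R : comNzRingType) (c1 : cond1 R) (J : lmodType R) (injJ : inj_graph J).
Variables (I : nat -> R -> Prop) (hI : forall n, is_ideal (I n)) (x : R).
Let Y (f : nat -> J) := forall n a, I n a -> a *: f n = 0.
Variable Z : (nat -> J) -> Prop.
Hypotheses (hZ : is_submod Z) (ZY : forall f, Z f -> Y f /\ x *: f = 0).

(* Push-out of the pure-injective module Y along its submodule Y[x] -> Y[x]/Z,
   followed by an embedding of Y[x]/Z in the x-torsion of an injective module. *)
Lemma pushout_limit (y : nat -> (nat -> J)) : (forall k, Y (y k)) -> exists u, [/\ Y u,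
  forall w, Y w -> (exists n, forall k, (n <= k)%N -> Z (x *: y k - w)) -> Z (x *: u - w),
  forall c w, Y w -> (exists n, forall k, (n <= k)%N -> Z (c *: y k - w)) -> x *: (c *: u - w) = 0 &
  forall c (y' : nat -> (nat -> J)), (forall k, Y (y' k)) ->
    (exists n, forall k, (n <= k)%N -> y k = c *: y' k) ->
    exists u', Y u' /\ x *: (u - c *: u') = 0].
Proof.
move=> hy.
have hY : is_submod Y.
  split; first by move=> n a _; exact: scaler0.
  move=> a f g hf hg n b Ib; rewrite -[LHS]/(b *: (a *: f n + g n)).
  by rewrite scalerDr hg // scalerA mulrC -scalerA hf // scaler0 addr0.
have [J' [phi [injJ' lphi kphi]]] := inj_ker hZ.
(* The push-out: [w |-> (x *: w, phi w)] embeds Y/Z in it. Its first projection has kernel the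
   x-torsion of [J'] and image [x Y], the sequences killed at [n] by all [b] with [b * x] in [I n];
   both are pure-injective. *)
pose A (z : (nat -> J) * J') := exists f, [/\ Y f, z.1 = x *: f & x *: (z.2 - phi f) = 0].
have hA : is_submod A.
  split.
    exists 0; split; [exact: (submod0 hY)|by rewrite scaler0|].
    by rewrite (lin0 lphi) /= subr0 scaler0.
  move=> a [u j] [u' j'] [f [Yf /= -> e]] [f' [Yf' /= -> e']].
  exists (a *: f + f'); split; first exact: hY.2.
    by rewrite /= scalerDr !scalerA mulrC.
  rewrite /= lphi opprD addrACA -scalerBr scalerDr e' scalerA mulrC -scalerA e.
  by rewrite scaler0 addr0.
have lfst : is_lin (fun z : (nat -> J) * J' => z.1) by [].
have PA : pi_on A.
  apply: (pi_on_ext c1 hA lfst).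
    apply: (pi_on_eq _ (@pi_on_torsion R (nat -> J) J' x injJ')) => -[u j] /=.
    split=> [[-> xj]|[[f [_ /= e1 e2]] e3]].
      split => //; exists 0; split; [exact: (submod0 hY)|by rewrite scaler0|].
      by rewrite (lin0 lphi) /= subr0.
    by move: e2; rewrite scalerBr -(linZ lphi) -e1 e3 (lin0 lphi) subr0.
  apply: (pi_on_eq _ (@pi_on_ann R J nat (fun n b => I n (b * x)) injJ)) => u; split.
    move=> hu; have /choice [f hf] : forall n, exists v, x *: v = u n /\ forall a, I n a -> a *: v = 0.
      by move=> n; apply: inj_solve => // s; apply: hu.
    have ef : u = x *: (f : nat -> J) by apply/funext => n; rewrite -(hf n).1.
    exists (u, phi f); split => //; exists f; split => //.
      by move=> n a; case: (hf n) => _; apply.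
    by rewrite /= subrr scaler0.
  move=> [[v j] [[f [Yf e1 _]] ->]] n b Ib; rewrite /= in e1 *; rewrite e1.
  by rewrite -[X in b *: X]/(x *: f n) scalerA; apply: Yf.
have [S [i [li ii eS]]] := sub_exists hA.
have [lim [llim limc lime]] := nat_limit (PA S i li ii eS).
have xi_mem w : Y w -> exists s, (x *: w, phi w) = i s.
  by move=> Yw; apply/eS; exists w; split => //=; rewrite subrr scaler0.
pose xi (w : nat -> J) : (nat -> J) * J' := (x *: w, phi w).
have lxi : is_lin xi.
  move=> a v w; transitivity (a *: (x *: v) + x *: w, a *: phi v + phi w) => //.
  by rewrite /xi lphi scalerDr !scalerA mulrC.
have xi_eq v w : Z (v - w) -> xi v = xi w.
  move=> hz; have [_ xz] := ZY hz.
  have e1 : phi (v - w) = 0 by apply/kphi.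
  by apply/eqP; rewrite -subr_eq0 -(linB lxi) /xi xz e1.
have [t ht] := choice (fun k => xi_mem _ (hy k)).
have [u [Yu e1 e2]] : A (i (lim t)) by apply/eS; exists (lim t).
exists u; split => //.
- move=> w Yw [n hn]; have [s es] := xi_mem _ Yw.
  have : lim (fun k => x *: t k) = s.
    rewrite -(limc s); apply: (lime _ _ n) => k nk; apply: ii.
    by rewrite (linZ li) -ht -es -/(xi _) -/(xi _) -(linZ lxi); apply: xi_eq; exact: hn.
  rewrite (_ : (fun k => _) = x *: (t : nat -> S)) // (linZ llim) => ex.
  have := congr1 i ex; rewrite (linZ li) -es => ez.
  have ez2 : x *: (i (lim t)).2 = phi w by rewrite -[RHS]/((x *: w, phi w).2) -ez.
  apply/kphi; rewrite (linB lphi) (linZ lphi) -ez2.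
  by rewrite -scalerBr -opprB scalerN e2 oppr0.
- move=> c w Yw [n hn]; have [s es] := xi_mem _ Yw.
  have : lim (fun k => c *: t k) = s.
    rewrite -(limc s); apply: (lime _ _ n) => k nk; apply: ii.
    by rewrite (linZ li) -ht -es -/(xi _) -/(xi _) -(linZ lxi); apply: xi_eq; exact: hn.
  rewrite (_ : (fun k => _) = c *: (t : nat -> S)) // (linZ llim) => ex.
  have := congr1 i ex; rewrite (linZ li) -es => ez.
  have ez1 : c *: (i (lim t)).1 = x *: w by rewrite -[RHS]/((x *: w, phi w).1) -ez.
  by rewrite scalerBr -ez1 e1 !scalerA mulrC subrr.
- move=> c y' hy' [n hn].
  have [t' ht'] := choice (fun k => xi_mem _ (hy' k)).
  have et : lim t = c *: lim t'.
    rewrite -(linZ llim); apply: (lime _ _ n) => k nk; apply: ii.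
    by rewrite -ht -[X in i X]/(c *: t' k) (linZ li) -ht' -/(xi _) -/(xi _) -(linZ lxi) (hn k nk).
  have [u' [Yu' e1' _]] : A (i (lim t')) by apply/eS; exists (lim t').
  exists u'; split => //.
  have : x *: u = c *: (x *: u') by rewrite -e1 -e1' et (linZ li).
  by rewrite scalerBr => ->; rewrite !scalerA mulrC subrr.
Qed.
End Push.

Section Cond1Ring.
Variables (R : comNzRingType) (c1 : cond1 R).

Lemma sum_dirac (J : lmodType R) k (v : J) M : (k < M)%N -> \sum_(n < M) dirac k v n = v.
Proof.
move=> kM; rewrite (bigD1 (Ordinal kM)) //= diracE big1 ?addr0 // => i /eqP ik.
by apply: dirac_neq => e; apply: ik; apply: val_inj.
Qed.

Lemma principal_is_ideal (c : R) : is_ideal (fun a => exists t, a = c * t).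
Proof.
split; first by exists 0; rewrite mulr0.
by move=> a _ _ [t ->] [t' ->]; exists (a * t + t'); rewrite -[_ *: _]/(a * (c * t)); ring.
Qed.

(** Let [y k] be concentrated in coordinate [k], with [r *: y k] equal to [a0] there. Modulo finite
    sequences of sum 0, all [r *: y k] agree, so a limit [u] would have [r *: u] finite of sum [a0];
    but divisibility of the [y k] by powers of [r] gives [r *: u = 0]. *)
Lemma cond1_zero_dim : zero_dim R.
Proof.
move=> r; apply: contrapT => nz.
have [nn [hnn nn1 nnr nnk]] := power_ideal nz.
have [J [eta0 [injJ heta0]]] := @inj_family R unit (fun _ => nn) (fun _ => hnn).
pose a0 := eta0 tt.
have ha0 s : s *: a0 = 0 <-> nn s by exact: heta0.
have ra0 : r *: a0 = 0.
  by apply/ha0.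
have /choice [eta heta] : forall n, exists u, r ^+ n.+1 *: u = a0.
  move=> n; have [|u [hu _]] := @inj_solve R J (fun s => s = 0) (r ^+ n.+1) a0 injJ (zero_submod R^o).
    by move=> s hs; apply/ha0; exact: (nnk n.+1).
  by exists u.
pose I n : R -> Prop := fun a => exists t, a = r ^+ n.+2 * t.
pose Z (f : nat -> J) := r *: f = 0 /\
  exists N, forall M, (N <= M)%N -> f M = 0 /\ \sum_(n < M) f n = 0.
have hZ : is_submod Z.
  split.
    by split; [rewrite scaler0|exists 0%N => M _; split => //; apply: big1].
  move=> a f g [rf [N hN]] [rg [N' hN']]; split.
    by rewrite scalerDr rg scalerA mulrC -scalerA rf scaler0 addr0.
  exists (maxn N N') => M; rewrite geq_max => /andP[/hN [f0 sf] /hN' [g0 sg]].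
  split; first by rewrite -[LHS]/(a *: f M + g M) f0 g0 scaler0 addr0.
  rewrite (eq_bigr (fun n : 'I_M => a *: f n + g n)) // big_split /= -scaler_sumr.
  by rewrite sf sg scaler0 addr0.
have rfn (f : nat -> J) n : r *: f = 0 -> r *: f n = 0 by move=> e; rewrite -[LHS]/((r *: f) n) e.
have Yr (f : nat -> J) : r *: f = 0 -> forall n a, I n a -> a *: f n = 0.
  move=> e n a [t ->]; rewrite mulrC exprSr mulrA -scalerA rfn //; exact: scaler0.
have Yeta k j : (fun f : nat -> J => forall n a, I n a -> a *: f n = 0) (dirac k (r ^+ j *: eta k)).
  move=> n a [t ->]; have [->|nk] := pselect (n = k); last by rewrite dirac_neq // scaler0.
  rewrite diracE scalerA (_ : _ * _ = t * r ^+ j * r * r ^+ k.+1); last by rewrite exprS; ring.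
  by rewrite -scalerA heta -scalerA ra0 scaler0.
have [|f [h1 h2]|k|u [Yu ui _ uiii]] := @pushout_limit R c1 J injJ I _ r Z hZ _ (fun k => dirac k (r ^+ k *: eta k)).
- by move=> n; exact: principal_is_ideal.
- by split => //; exact: Yr.
- exact: Yeta.
(* Elements of Y are killed by [r ^+ n.+2] at coordinate [n], and [y k] is [r ^+ n.+2] times an
   element of Y once [k] is at least [n.+2]. *)
have r0 n : r *: u n = 0.
  have [||u' [Yu' e]] := uiii (r ^+ n.+2) (fun k => if (n.+2 <= k)%N then dirac k (r ^+ (k - n.+2) *: eta k) else 0).
  - move=> k; case: ifP => _; first exact: Yeta.
    by move=> m a _; exact: scaler0.
  - by exists n.+2 => k nk; rewrite nk diracZ scalerA -exprD subnKC.
  have := congr1 (fun f => f n) e.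
  rewrite -[X in X = _]/(r *: (u n - r ^+ n.+2 *: u' n)) (Yu' n (r ^+ n.+2)) ?subr0 //.
  by exists 1; rewrite mulr1.
have [||_ [N hN]] := ui (dirac 0%N a0).
- apply: Yr; rewrite diracZ ra0; apply/funext => k.
  by rewrite /dirac; case: ifP.
- exists 0%N => k _; rewrite diracZ scalerA -exprS heta; split.
    rewrite scalerBr !diracZ ra0; apply/funext => n.
    by rewrite -[LHS]/(dirac k 0 n - dirac 0%N 0 n) /dirac; do 2 case: ifP; rewrite subrr.
  exists k.+1 => M kM; split.
    rewrite -[LHS]/(dirac k a0 M - dirac 0%N a0 M) !dirac_neq ?subrr //.
      by move=> e; rewrite e ltn0 in kM.
    by move=> e; rewrite e ltnn in kM.
  rewrite (eq_bigr (fun n : 'I_M => dirac k a0 n - dirac 0%N a0 n)) // sumrB !sum_dirac ?subrr //.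
  exact: leq_ltn_trans kM.
have [_] := hN N.+1 (leqnSn N).
rewrite (eq_bigr (fun n : 'I_N.+1 => r *: u n - dirac 0%N a0 n)) // sumrB sum_dirac // big1 ?sub0r => [|i _].
  move=> /eqP; rewrite oppr_eq0 => /eqP e; apply: nn1; apply/ha0.
  by rewrite scale1r.
exact: r0.
Qed.

(** [eta n] lives on [e n] and is killed by [x * x] but not by [x]. For the partial families [y k],
    [x *: y k] is 0 modulo finite families, so [x *: u] is finite for a limit [u]; yet [e N *: u]
    agrees with [eta N] up to x-torsion for every [N]. *)
Lemma cond1_no_orthogonal : no_orthogonal R.
Proof.
move=> x e ee orth; apply: contrapT => none.
pose I n : R -> Prop := fun a => exists s t, a = (1 - e n) * s + x * x * t.
have hI n : is_ideal (I n).
  split; first by exists 0, 0; rewrite !mulr0 addr0.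
  move=> a _ _ [s [t ->]] [s' [t' ->]]; exists (a * s + s'), (a * t + t').
  by rewrite -[_ *: _]/(a * ((1 - e n) * s + x * x * t)); ring.
have [J [eta [injJ heta]]] := inj_family hI.
have xeta n : x *: eta n <> 0.
  move=> /heta [s [t ex]]; apply: none; exists n, (e n * t).
  have : e n * x = e n * ((1 - e n) * s + x * x * t) by rewrite -ex.
  rewrite (_ : _ * (_ + _) = (e n - e n * e n) * s + x * x * (e n * t)); last by ring.
  by rewrite ee subrr mul0r add0r.
have eeta n : e n *: eta n = eta n.
  apply/eqP; rewrite eq_sym -subr_eq0 -{1}(scale1r (eta n)) -scalerBl; apply/eqP/heta.
  by exists 1, 0; rewrite mulr0 mulr1 addr0.
have xxeta n : x *: (x *: eta n) = 0.
  by rewrite scalerA; apply/heta; exists 0, 1; rewrite mulr0 mulr1 add0r.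
pose Y (f : nat -> J) := forall n a, I n a -> a *: f n = 0.
have hY : is_submod Y.
  split; first by move=> n a _; exact: scaler0.
  move=> a f g hf hg n b Ib; rewrite -[LHS]/(b *: (a *: f n + g n)).
  by rewrite scalerDr hg // scalerA mulrC -scalerA hf // scaler0 addr0.
pose Z (f : nat -> J) := [/\ Y f, x *: f = 0 & exists N, forall M, (N <= M)%N -> f M = 0].
have hZ : is_submod Z.
  split.
    split; [exact: (submod0 hY)|by rewrite scaler0|by exists 0%N].
  move=> a f g [Yf xf [N hN]] [Yg xg [N' hN']]; split; first exact: hY.2.
    by rewrite scalerDr xg scalerA mulrC -scalerA xf scaler0 addr0.
  exists (maxn N N') => M; rewrite geq_max => /andP[/hN f0 /hN' g0].
  by rewrite -[LHS]/(a *: f M + g M) f0 g0 scaler0 addr0.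
have Yeta n : Y (dirac n (eta n)).
  move=> m a Ia; have [mn|nm] := pselect (m = n); last by rewrite dirac_neq // scaler0.
  by rewrite mn in Ia *; rewrite diracE; apply/heta.
pose y k : nat -> J := fun n => if (n < k)%N then eta n else 0.
have Yy k : Y (y k).
  by move=> m a Ia; rewrite /y; case: ifP => _; [apply/heta|exact: scaler0].
have ZY f : Z f -> (forall n a, I n a -> a *: f n = 0) /\ x *: f = 0 by case.
have [u [Yu ui uii _]] := @pushout_limit R c1 J injJ I hI x Z hZ ZY y Yy.
have [||_ _ [N hN]] := ui 0.
- exact: (submod0 hY).
- exists 0%N => k _; rewrite subr0; split.
  + exact: (submodZ hY).
  + apply/funext => n; rewrite -[LHS]/(x *: (x *: y k n)) /y.
    by case: ifP => _; rewrite ?xxeta ?scaler0.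
  + exists k => M kM; rewrite -[LHS]/(x *: y k M) /y ltnNge kM.
    exact: scaler0.
have : x *: (e N *: u - dirac N (eta N)) = 0.
  apply: (uii _ _ (Yeta N)); exists N.+1 => k Nk; suff -> : e N *: y k - dirac N (eta N) = 0 by exact: (submod0 hZ).
  apply/funext => m; rewrite -[LHS]/(e N *: y k m - dirac N (eta N) m).
  have [->|mN] := pselect (m = N); first by rewrite diracE /y Nk eeta subrr.
  rewrite dirac_neq // subr0 /y; case: ifP => _; last exact: scaler0.
  by rewrite -(eeta m) scalerA orth ?scale0r // => h; apply: mN.
move=> /(congr1 (fun f => f N)); rewrite -[X in X = _ -> _]/(x *: (e N *: u N - dirac N (eta N) N)).
rewrite diracE scalerBr scalerA mulrC -scalerA; have := hN N (leqnn N).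
rewrite subr0 => e0; rewrite -[x *: u N]/((x *: u) N) e0 scaler0 sub0r => /eqP.
by rewrite oppr_eq0 => /eqP; exact: xeta.
Qed.
End Cond1Ring.

(** * Localizations at maximal ideals *)

Section MaximalIdeals.
Variable R : comNzRingType.
Variables (m : R -> Prop) (hm : maximal_ideal m).
Let hI : is_ideal m. Proof. by case: hm. Qed.

Lemma maximal_mull r s : m s -> m (r * s). Proof. exact: (submodZ hI). Qed.
Lemma maximal_mulr r s : m r -> m (r * s). Proof. by rewrite mulrC; exact: maximal_mull. Qed.

Lemma maximal_1B s : m s -> ~ m (1 - s).
Proof.
by case: hm => _ m1 _ ms m1s; apply: m1; rewrite -(subrK s 1); apply: (submodD hI).
Qed.

Lemma maximal_prime r s : m (r * s) -> ~ m r -> m s.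
Proof.
case: hm => _ _ hmax mrs /hmax [t ht].
rewrite -(mul1r s) -(subrK (r * t) 1) mulrDl; apply: (submodD hI); first exact: maximal_mulr.
by rewrite mulrAC; apply: maximal_mulr.
Qed.

Lemma maximal_nilp s : nilp_elt s -> m s.
Proof.
move=> [k hk]; apply: contrapT => ms.
have h j : ~ m (s ^+ j).
  elim: j => [|j IH]; first by case: hm.
  by rewrite exprS => /maximal_prime /(_ ms).
by apply: (h k); rewrite hk; exact: (submod0 hI).
Qed.
End MaximalIdeals.

Section Cond1Ring.
Variables (R : comNzRingType) (c1 : cond1 R).

Lemma pi_on_killed (M : lmodType R) (m : R -> Prop) (A : M -> Prop) : maximal_ideal m ->
  (forall a x, m a -> A x -> a *: x = 0) -> pi_on A.
Proof.
move=> hm kA S i li ii eS; apply: (pi_killed_maximal hm) => a x ma; apply: ii.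
by rewrite (linZ li) (lin0 li) kA //; apply/eS; exists x.
Qed.

(* By Nakayama's lemma this says that R_m is noetherian.  Otherwise, the
   sequences y with m (c n) (y n) = 0 for all n and c n (y n) = 0 for almost all n form
   an extension of pure-injective modules, in which the partial sums of a
   family eta with c n (eta n) <> 0 have no limit. *)
Lemma cond1_noetherian (m : R -> Prop) (c : nat -> R) : maximal_ideal m ->
  exists n mu, m mu /\ ideal_span (mkseq c n) (c n - mu * c n).
Proof.
move=> hm; apply: contrapT => none.
have hI : is_ideal m by case: hm.
have [J [eta0 [injJ heta0]]] := @inj_family R unit (fun _ => m) (fun _ => hI).
pose w := eta0 tt.
have hw s : s *: w = 0 <-> m s by exact: heta0.
have /choice [eta heta] : forall n, exists u, c n *: u = w /\ forall a, ideal_span (mkseq c n) a -> a *: u = 0.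
  move=> n; apply: inj_solve => //; first exact: ideal_span_ideal.
  move=> s hs; apply/hw; apply: contrapT => ms; apply: none.
  case: hm => _ _ /(_ s ms) [t ht]; exists n, (1 - s * t); split => //.
  have := submodZ (ideal_span_ideal (mkseq c n)) t hs; congr ideal_span.
  by rewrite -[LHS]/(t * (s * c n)); ring.
pose A (y : nat -> J) := (forall n mu, m mu -> (mu * c n) *: y n = 0) /\
  exists N, forall n, (N <= n)%N -> c n *: y n = 0.
have hA : is_submod A.
  split; first by split; [move=> n mu _; exact: scaler0|exists 0%N => n _; exact: scaler0].
  move=> a f g [hf [N hN]] [hg [N' hN']]; split.
    move=> n mu mmu; rewrite -[LHS]/((mu * c n) *: (a *: f n + g n)) scalerDr hg //.
    by rewrite scalerA [_ * a]mulrC -scalerA hf // scaler0 addr0.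
  exists (maxn N N') => n; rewrite geq_max => /andP[/hN f0 /hN' g0].
  rewrite -[LHS]/(c n *: (a *: f n + g n)) scalerDr g0 scalerA mulrC -scalerA f0.
  by rewrite scaler0 addr0.
pose h (y : nat -> J) : nat -> J := fun n => c n *: y n.
have lh : is_lin h.
  move=> a f g; apply/funext => n; rewrite -[RHS]/(a *: (c n *: f n) + c n *: g n).
  by rewrite -[LHS]/(c n *: (a *: f n + g n)) scalerDr !scalerA mulrC.
have PA : pi_on A.
  apply: (pi_on_ext c1 hA lh).
    apply: (pi_on_eq _ (@pi_on_ann R J nat (fun n a => a = c n) injJ)) => y; split.
      move=> hy; have hy0 n : c n *: y n = 0 by apply: hy.
      split; last by apply/funext => n; exact: hy0.
      split; last by exists 0%N => n _; exact: hy0.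
      by move=> n mu _; rewrite -scalerA hy0 scaler0.
    by move=> [_ hy] n a ->; exact: (congr1 (fun f => f n) hy).
  apply: (pi_on_killed hm) => a _ ma [y [[hy _] ->]]; apply/funext => n.
  by rewrite -[LHS]/(a *: (c n *: y n)) scalerA hy.
have [S [i [li ii eS]]] := sub_exists hA.
have [lim [llim limc lime]] := nat_limit (PA S i li ii eS).
pose y k : nat -> J := fun n => if (n < k)%N then eta n else 0.
have /choice [t ht] : forall k, exists s, y k = i s.
  move=> k; apply/eS; split.
    move=> n mu mmu; rewrite /y; case: ifP => _; last exact: scaler0.
    by rewrite -scalerA (heta n).1; apply/hw.
  by exists k => n kn; rewrite /y ltnNge kn scaler0.
have [_ [N hN]] : A (i (lim t)) by apply/eS; exists (lim t).
(* For [n > N] the element [eta n] was chosen to be killed by [c N], so [c N *: y k] is constant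
   once [k > N]. *)
have e : c N *: lim t = c N *: t N.+1.
  rewrite -(limc (c N *: t N.+1)) -(linZ llim); apply: (lime _ _ N.+1) => k Nk.
  apply: ii; rewrite -[X in i X]/(c N *: t k) !(linZ li) -!ht; apply/funext => n.
  rewrite -[LHS]/(c N *: y k n) -[RHS]/(c N *: y N.+1 n) /y.
  have [lt|le] := ltnP n N.+1; first by rewrite (leq_trans lt).
  case: ifP => _ //; rewrite scaler0 (heta n).2 //.
  by apply: ideal_span_mem; apply: map_f; rewrite mem_iota.
have := hN N (leqnn N).
rewrite -[X in X = _]/((c N *: i (lim t)) N) -(linZ li) e (linZ li) -ht.
rewrite -[X in X = _]/(c N *: y N.+1 N) /y ltnSn (heta N).1 -(scale1r w) => /hw.
by case: hm.
Qed.

(* Otherwise a and b define a Kronecker module on sequences in J, an extension of pure-injective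
   modules in which the system b x_(n+1) - a x_n = (u, 0, 0, ...) is
   finitely solvable but not solvable. *)
Lemma cond1_dependent (m : R -> Prop) (a b : R) : maximal_ideal m ->
  exists s t mu nu, [/\ ~ m s \/ ~ m t, m mu, m nu & s * a + t * b = mu * a + nu * b].
Proof.
move=> hm; apply: contrapT => none.
have hI : is_ideal m by case: hm.
have indep s t mu nu : m mu -> m nu -> s * a + t * b = mu * a + nu * b -> m s /\ m t.
  move=> h1 h2 e; apply: contrapT => h; apply: none; exists s, t, mu, nu; split => //.
  by have [ms|] := pselect (m s); [right => mt; apply: h|left].
have m0 : m 0 by exact: (submod0 hI).
have [mb ma] : m b /\ m a.
  have [|mb mNa] := @indep b (- a) 0 0 m0 m0; first by ring.
  by split => //; rewrite -(opprK a); apply: (submodN hI).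
have [J [eta0 [injJ heta0]]] := @inj_family R unit (fun _ => m) (fun _ => hI).
pose u := eta0 tt.
have hu s : s *: u = 0 <-> m s by exact: heta0.
have huN s : m s -> s *: - u = 0 by move=> ms; rewrite scalerN (hu s).2 // oppr0.
have ex (v v' : J) : (forall s, m s -> s *: v = 0) -> (forall s, m s -> s *: v' = 0) ->
    exists x, a *: x = v /\ b *: x = v'.
  move=> hv hv'; apply: inj_solve2 => // s t e.
  have [|ms mt] := @indep s t 0 0 m0 m0; first by rewrite e; ring.
  by rewrite hv // hv' // addr0.
have z0 s : m s -> s *: (0 : J) = 0 by move=> _; exact: scaler0.
have [p [ap bp]] := ex _ _ huN z0.
have [q [aq bq]] := ex _ _ huN huN.
have [o [ao bo]] := ex _ _ z0 huN.
pose A (y : nat -> J) := [/\ forall i mu, m mu -> (mu * a) *: y i = 0,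
  b *: y 0%N = 0, forall i, b *: y i.+1 = a *: y i & exists N, forall i, (N <= i)%N -> a *: y i = 0].
have comm (c r : R) (v v' : J) : c *: (r *: v + v') = r *: (c *: v) + c *: v'.
  by rewrite scalerDr !scalerA mulrC.
have hA : is_submod A.
  split.
    by split; rewrite ?scaler0 // => *; rewrite ?scaler0 //; exists 0%N => i _; exact: scaler0.
  move=> r f g [f1 f2 f3 [N hN]] [g1 g2 g3 [N' hN']]; split.
  - move=> i mu mmu; rewrite -[LHS]/((mu * a) *: (r *: f i + g i)) comm f1 // g1 //.
    by rewrite scaler0 addr0.
  - by rewrite -[LHS]/(b *: (r *: f 0%N + g 0%N)) comm f2 g2 scaler0 addr0.
  - move=> i; rewrite -[LHS]/(b *: (r *: f i.+1 + g i.+1)) -[RHS]/(a *: (r *: f i + g i)).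
    by rewrite !comm f3 g3.
  exists (maxn N N') => n; rewrite geq_max => /andP[/hN f0 /hN' g0].
  by rewrite -[LHS]/(a *: (r *: f n + g n)) comm f0 g0 scaler0 addr0.
pose h (y : nat -> J) := a *: y.
have lh : is_lin h by move=> r f g; rewrite /h scalerDr !scalerA mulrC.
have PA : pi_on A.
  apply: (pi_on_ext c1 hA lh).
    apply: (pi_on_eq _ (@pi_on_ann R J nat (fun n c => c = a \/ c = b) injJ)) => y; split.
      move=> hy; have ya n : a *: y n = 0 by apply: hy; left.
      have yb n : b *: y n = 0 by apply: hy; right.
      split; last by apply/funext => n; exact: ya.
      split => //; last by exists 0%N.
        by move=> n mu _; rewrite -scalerA ya scaler0.
      by move=> n; rewrite ya yb.
    move=> [[_ y0 yS _] hy].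
    have ya n : a *: y n = 0 by exact: (congr1 (fun f => f n) hy).
    by move=> n _ [->|->] //; case: n => [|n]; rewrite ?yS.
  apply: (pi_on_killed hm) => r _ mr [y [[hy _ _ _] ->]]; apply/funext => n.
  by rewrite -[LHS]/(r *: (a *: y n)) scalerA hy.
have [S [i [li ii eS]]] := sub_exists hA.
have [lim [llim limc lime]] := nat_limit (PA S i li ii eS).
(* For positive [k] this is (p, q, ..., q, o, 0, ...) with [o] at [k]: [a] sends it to [- u] at the
   indices below [k], [b] to [- u] at 1, ..., k. *)
pose X k : nat -> J := fun j => if j == 0%N then (if k == 0%N then 0 else p)
  else if (j < k)%N then q else if j == k then o else 0.
have aX k j : a *: X k j = if (j < k)%N then - u else 0.
  rewrite /X; case: j => [|j] /=; first by case: k => [|k] /=; rewrite ?scaler0.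
  by case: ifP => // _; case: ifP; rewrite ?scaler0.
have bX k j : b *: X k j = if (0 < j <= k)%N then - u else 0.
  rewrite /X; case: j => [|j] /=; first by case: k => [|k] /=; rewrite ?scaler0.
  rewrite [(j < k)%N]leq_eqVlt; case: eqVneq => [<-|_]; first by rewrite ltnn bo.
  by rewrite orFb; case: ifP => _; rewrite ?scaler0.
have /choice [t ht] : forall k, exists s, X k = i s.
  move=> k; apply/eS; split.
  - by move=> j mu mmu; rewrite -scalerA aX; case: ifP => _; rewrite ?scaler0 // huN.
  - by rewrite bX.
  - by move=> j; rewrite aX bX.
  - by exists k => j kj; rewrite aX ltnNge kj.
have [s0 es0] : exists s, dirac 0%N u = i s.
  have du (c : R) j : m c -> c *: dirac 0%N u j = 0.
    move=> mc; rewrite -[LHS]/((c *: dirac 0%N u) j) diracZ (hu c).2 // /dirac.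
    by case: ifP.
  apply/eS; split.
  - by move=> j mu mmu; apply: du; apply: maximal_mulr.
  - exact: du.
  - by move=> j; rewrite !du.
  - by exists 0%N => j _; apply: du.
(* The shifted limits solve the infinite system. Comparing coordinates one after the other gives
   [- u] for every coordinate of [a *: z n], although [a] must kill almost all of them. *)
pose z n := lim (fun N => t (N - n)%N).
have ez n : b *: z n.+1 - a *: z n = s0.
  rewrite /z -!(linZ llim) -(linB llim) -(limc s0); apply: (lime _ _ n.+1) => N nN.
  apply: ii; rewrite -[X in i X]/(b *: t (N - n.+1)%N - a *: t (N - n)%N).
  rewrite (linB li) !(linZ li) -!ht -es0; apply/funext => j.
  rewrite -[LHS]/(b *: X (N - n.+1)%N j - a *: X (N - n)%N j) aX bX.
  have -> : (N - n = (N - n.+1).+1)%N by rewrite subnSK.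
  case: j => [|j]; first by rewrite diracE /= sub0r opprK.
  by rewrite dirac_neq //= ltnS; case: ifP; rewrite subrr.
have zA n : A (i (z n)) by apply/eS; exists (z n).
have ez' n j : a *: i (z n) j = b *: i (z n.+1) j - dirac 0%N u j.
  have := congr1 i (ez n); rewrite (linB li) !(linZ li) -es0 => <-.
  by rewrite -[X in _ = _ - X]/(b *: i (z n.+1) j - a *: i (z n) j) opprB addrC subrK.
have val j : forall n, a *: i (z n) j = - u.
  elim: j => [|j IH] n; rewrite ez'.
    by have [_ -> _ _] := zA n.+1; rewrite diracE sub0r.
  by have [_ _ -> _] := zA n.+1; rewrite IH dirac_neq // subr0.
have [_ _ _ [N hN]] := zA 0%N.
have := hN N (leqnn N); rewrite val => /eqP; rewrite oppr_eq0 => /eqP.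
by rewrite -(scale1r u) => /hu; case: hm.
Qed.

(* In other words, R_m is a valuation ring. *)
Lemma cond1_arithmetical (m : R -> Prop) (a b : R) : maximal_ideal m ->
  exists s, ~ m s /\ ((exists t, s * a = t * b) \/ (exists t, s * b = t * a)).
Proof.
move=> hm; have [s [t [mu [nu [ns mmu mnu e]]]]] := cond1_dependent a b hm.
have hI : is_ideal m by case: hm.
have nB r v : ~ m r -> m v -> ~ m (r - v).
  by move=> nr mv h; apply: nr; rewrite -(subrK v r); apply: (submodD hI).
case: ns => n.
  exists (s - mu); split; first exact: nB.
  left; exists (nu - t); rewrite mulrBl.
  have -> : s * a = mu * a + nu * b - t * b by rewrite -e; ring.
  ring.
exists (t - nu); split; first exact: nB.
right; exists (mu - s); rewrite mulrBl.
have -> : t * b = mu * a + nu * b - s * a by rewrite -e; ring.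
ring.
Qed.
End Cond1Ring.

(** * Greatest idempotents of annihilators *)

Section Greatest.
Variables (R : comNzRingType) (zd : zero_dim R).

Lemma zero_dim_maximal_idem (m : R -> Prop) (c : R) : maximal_ideal m -> ~ m c ->
  exists g t, [/\ g * g = g, g = c * t & ~ m g].
Proof.
move=> hm mc; have [g [t [gg gt ng]]] := zero_dim_idem zd c.
exists g, t; split => // mg; apply: mc.
have hI : is_ideal m by case: hm.
rewrite -(mul1r c) -(subrK g 1) mulrDl; apply: (submodD hI).
  exact: maximal_nilp ng.
exact: maximal_mulr.
Qed.

(** Join the idempotents of the [c i] to [u]. An idempotent of the annihilator not below [u] yields
    a nonzero [h'] orthogonal to [u]; a maximal ideal containing [1 - h'] contains [u], hence all
    [c i], but not [h'], which kills [x]. *)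
Lemma greatest_idem_of_fin (x : R) n (c : 'I_n -> R) : (forall i, c i * x = 0) ->
  (forall m, maximal_ideal m -> (exists s, s * x = 0 /\ ~ m s) -> exists i, ~ m (c i)) ->
  exists f, [/\ f * f = f, f * x = 0 & forall g, g * g = g -> g * x = 0 -> g * f = g].
Proof.
move=> cx hc.
have /choice [g hg] : forall i, exists g, [/\ g * g = g, g * x = 0 & nilp_elt ((1 - g) * c i)].
  move=> i; have [g [t [gg gt ng]]] := zero_dim_idem zd (c i).
  by exists g; split => //; rewrite gt mulrAC cx mul0r.
pose E e := e * e = e /\ e * x = 0.
have [||u [hu uu gu]] := @ideal_gen_unit R E _ n g.
- by move=> e [].
- by move=> i; apply: ideal_gen_mem; case: (hg i).
have ux : u * x = 0.
  case: hu => [k [e [d [he ->]]]]; rewrite mulr_suml big1 // => i _.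
  by case: (he i) => _ h; rewrite -mulrA h mulr0.
exists u; split => // h hh hx; apply: contrapT => hne.
pose h' := h - h * u.
have h'0 : h' <> 0 by move=> /subr0_eq /esym.
have h'u : h' * u = 0 by rewrite /h' mulrBl -mulrA uu subrr.
have h'x : h' * x = 0 by rewrite /h' mulrBl mulrAC hx mul0r subrr.
have h'h' : h' * h' = h'.
  rewrite {1}/h'; transitivity (h * h - h * h * u - h * h * u + h * h * (u * u)); first by rewrite /h'; ring.
  by rewrite uu hh /h'; ring.
have [|m [hm sm]] := @maximal_ideal_exists R _ (principal_is_ideal (1 - h')).
  move=> [t e]; apply: h'0; rewrite -[LHS]mulr1 e.
  have -> : h' * ((1 - h') * t) = (h' - h' * h') * t by ring.
  by rewrite h'h' subrr mul0r.
have m1 : m (1 - h') by apply: sm; exists 1; rewrite mulr1.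
have hI : is_ideal m by case: hm.
have mh' : ~ m h' by move=> mh'; exact: (maximal_1B hm mh').
have [i] := hc m hm (ex_intro _ h' (conj h'x mh')); apply.
have mu : m u.
  have -> : u = u * (1 - h') by rewrite mulrBr mulr1 [u * h']mulrC h'u subr0.
  exact: maximal_mull.
have [_ _ ng] := hg i.
rewrite -(mul1r (c i)) -(subrK (g i) 1) mulrDl; apply: (submodD hI); first exact: maximal_nilp ng.
by rewrite -(gu i); apply: maximal_mulr => //; apply: maximal_mull.
Qed.

Lemma fg_greatest_idem : (forall r : R, fg (ann r)) -> greatest_idem R.
Proof.
move=> h x; have [l hl] := h x.
apply: (@greatest_idem_of_fin x (size l) (fun i => l`_i)).
  by move=> i; apply/hl; apply: ideal_span_mem; exact: mem_nth.
move=> m hm [s [sx ms]]; apply: contrapT => none; apply: ms.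
have /hl : ann x s by [].
apply: ideal_span_min; first by case: hm.
move=> a /(nthP 0) [i il <-]; apply: contrapT => na; apply: none.
by exists (Ordinal il).
Qed.
End Greatest.

Section Cond1Ring.
Variables (R : comNzRingType) (c1 : cond1 R).
Let zd := cond1_zero_dim c1.

(* L is the set of maximal ideals that do not contain ann x, and y has annihilator l at
   l in L.  The limit of the g y, for the idempotents g of ann x, is y itself, which forces
   y to lie in (ann x) Y. *)
Lemma cond1_greatest_idem : greatest_idem R.
Proof.
move=> x.
pose L := {m : R -> Prop | maximal_ideal m /\ exists s, s * x = 0 /\ ~ m s}.
have hL (l : L) : maximal_ideal (sval l) by case: l => m [].
have hI (l : L) : is_ideal (sval l) by case: (hL l).
have [J [y [injJ hy]]] := inj_family hI.
pose Y (f : L -> J) := forall l a, sval l a -> a *: f l = 0.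
have hY : is_submod Y.
  split; first by move=> l a _; exact: scaler0.
  move=> a f g hf hg l b Ib; rewrite -[LHS]/(b *: (a *: f l + g l)).
  by rewrite scalerDr hg // scalerA mulrC -scalerA hf // scaler0 addr0.
have Yy : Y y by move=> l a ma; apply/hy.
have hIY := ideal_mul_sub (ann x) hY.
suff [n [c [u [hc ey]]]] : ideal_mul (ann x) Y y.
  apply: (@greatest_idem_of_fin R zd x n c); first by move=> i; case: (hc i).
  move=> m hm hs; apply: contrapT => none.
  pose l : L := exist _ m (conj hm hs).
  have yl : y l = 0.
    rewrite ey fct_sumE; apply: big1 => i _.
    rewrite -[LHS]/(c i *: u i l); apply: (hc i).2.
    by apply: contrapT => h; apply: none; exists i.
  by have [_ m1 _] := hm; apply: m1; apply/(hy l); rewrite yl scaler0.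
have [J' [th [injJ' lth kth]]] := inj_ker hIY.
(* An extension of [Y] by the x-torsion of [J'], in which the class of [y] modulo (ann x) Y becomes
   [x] times a second component. *)
pose A (z : (L -> J) * J') := Y z.1 /\ th z.1 = x *: z.2.
have hA : is_submod A.
  split; first by split; [exact: (submod0 hY)|rewrite (lin0 lth) scaler0].
  move=> a [f t] [f' t'] [/= h1 h2] [/= h1' h2']; split; first exact: hY.2.
  by rewrite /= lth h2 h2' scalerDr !scalerA mulrC.
have lfst : is_lin (fun z : (L -> J) * J' => z.1) by [].
have PA : pi_on A.
  apply: (pi_on_ext c1 hA lfst).
    apply: (pi_on_eq _ (@pi_on_torsion R (L -> J) J' x injJ')) => -[f t]; rewrite /A /=.
    split=> [[-> xt]|[[_ h] f0]].
      by split => //; split; [exact: (submod0 hY)|rewrite (lin0 lth) xt].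
    by rewrite -h f0 (lin0 lth).
  apply: (pi_on_eq _ (@pi_on_ann R J L (fun l a => sval l a) injJ)) => f; split; last first.
    by move=> [z [[Yz _] ->]].
  move=> Yf; have [|t [ht _]] := @inj_solve R J' (fun s => s = 0) x (th f) injJ' (zero_submod R^o).
    by move=> s sx; rewrite -(linZ lth); apply/kth; apply: ideal_mul_gen.
  by exists (f, t).
have [S [i [li ii eS]]] := sub_exists hA.
pose T := {g : R | g * g = g /\ g * x = 0}.
(* Limits along the idempotents killing [x], directed upwards by [idem_join]. *)
have [||||lim [llim limc lime]] := @pi_limit R S T
  (fun P => exists g0 : T, forall g : T, sval g0 * sval g = sval g0 -> P g) (PA S i li ii eS).
- by have h0 : 0 * 0 = 0 :> R /\ 0 * x = 0; [rewrite !mul0r|exists (exist (fun g => g * g = g /\ g * x = 0) 0 h0)].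
- move=> P Q [[g [gg gx]] hP] [[h [hh hx]] hQ].
  have [jj j1 j2] := idem_join gg hh.
  have jx : (g + h - g * h) * x = 0.
    by rewrite mulrBl mulrDl gx hx -mulrA hx mulr0 addr0 subrr.
  exists (exist (fun g => g * g = g /\ g * x = 0) (g + h - g * h) (conj jj jx)) => k /= ek; split.
    by apply: hP => /=; rewrite -j1 -mulrA ek.
  by apply: hQ => /=; rewrite -j2 -mulrA ek.
- by move=> P Q [g hg] h; exists g => k /hg; exact: h.
- by move=> P [g hg]; exists g; apply: hg; exact: (svalP g).1.
have /choice [t ht] : forall g : T, exists s, (sval g *: y, 0) = i s.
  move=> [g [gg gx]] /=; apply/eS; split => /=; first exact: (submodZ hY).
  by rewrite scaler0; apply/kth; apply: ideal_mul_gen.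
have [Yz ez] : A (i (lim t)) by apply/eS; exists (lim t).
have zy : (i (lim t)).1 = y.
  apply/funext => l; have [s [sx ms]] := (svalP l).2.
  have [g [v [gg gt mg]]] := zero_dim_maximal_idem zd (hL l) ms.
  have gx : g * x = 0 by rewrite gt mulrAC sx mul0r.
  pose g' : T := exist (fun g => g * g = g /\ g * x = 0) g (conj gg gx).
  have e : g *: lim t = t g'.
    rewrite -(limc (t g')) -(linZ llim); apply: lime; exists g' => k /= gk.
    apply: ii; rewrite -[X in i X]/(g *: t k) (linZ li) -!ht /=.
    transitivity (g *: (sval k *: y), g *: (0 : J')) => //.
    by rewrite scalerA gk scaler0.
  have e1 : g *: (i (lim t)).1 l = g *: y l.
    by have := congr1 i e; rewrite (linZ li) -ht => /(congr1 (fun z => z.1 l)).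
  have m1g : sval l (1 - g).
    apply: (maximal_prime (hL l) _ mg).
    by rewrite mulrBr mulr1 gg subrr; exact: (submod0 (hI l)).
  rewrite -[LHS]scale1r -[RHS]scale1r -(subrK g 1) !(scalerDl _ (1 - g) g) e1; congr (_ + _).
  by rewrite (Yz l (1 - g) m1g) (Yy l (1 - g) m1g).
apply/kth; rewrite -zy ez.
have : x *: lim t = 0.
  rewrite -(limc 0) -(linZ llim); apply: lime.
  have h0 : 0 * 0 = 0 :> R /\ 0 * x = 0 by rewrite !mul0r.
  exists (exist (fun g => g * g = g /\ g * x = 0) 0 h0) => k _; apply: ii; rewrite -[X in i X]/(x *: t k) (linZ li) -ht (lin0 li).
  transitivity (x *: (sval k *: y), x *: (0 : J')) => //.
  by rewrite scalerA mulrC (svalP k).2 scale0r scaler0.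
by move=> /(congr1 i); rewrite (linZ li) (lin0 li) => /(congr1 snd).
Qed.

(** Choose each generator outside the span of the previous ones. The noetherian property puts
    [1 - mu] times some generator in that span, and [1 - mu] is invertible on [e R]. *)
Lemma cond1_local_fg (e : R) (I : R -> Prop) : primitive_idem e -> is_ideal I ->
  (forall s, I s -> e * s = s) -> fg I.
Proof.
move=> pe hI eI; apply: contrapT => nfg.
pose T := {l : seq R | forall a, a \in l -> I a}.
have /choice [c hc] : forall l : T, exists a, I a /\ ~ ideal_span (sval l) a.
  move=> [l hl] /=; apply: contrapT => none; apply: nfg; exists l => s; split.
    by move=> Is; apply: contrapT => ns; apply: none; exists s.
  exact: ideal_span_min.
have hcons (l : T) a : a \in c l :: sval l -> I a.
  by rewrite inE => /orP[/eqP ->|]; [case: (hc l)|apply: (svalP l)].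
pose nx (l : T) : T := exist _ (c l :: sval l) (hcons l).
have h0 a : a \in ([::] : seq R) -> I a by [].
pose L n := iter n nx (exist _ [::] h0).
have mem n k : (n < k)%N -> c (L n) \in sval (L k).
  elim: k => // k IH; rewrite ltnS leq_eqVlt => /orP[/eqP ->|/IH h].
    by rewrite /= inE eqxx.
  by rewrite /= inE h orbT.
have hm := local_max_maximal zd pe.
have [n [mu [mmu hs]]] := cond1_noetherian c1 (fun n => c (L n)) hm.
have [Ic nsp] := hc (L n); apply: nsp.
have [h|[t ht]] := primitive_local zd pe (1 - mu).
  by case: (maximal_1B hm mmu).
rewrite -(eI _ Ic) -ht.
have -> : e * (1 - mu) * t * c (L n) = t * (1 - mu) * (e * c (L n)) by ring.
rewrite (eI _ Ic).
have -> : t * (1 - mu) * c (L n) = t * (c (L n) - mu * c (L n)) by ring.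
apply: (submodZ (ideal_span_ideal (sval (L n))) t); apply: ideal_span_sub hs => a /mapP [k].
by rewrite mem_iota => /= kn ->; apply: mem.
Qed.

(** If [s] kills [r], it kills [g], a multiple of [r], so [s] is [s (1 - g) f] plus the sum of the
    [e s]; each [e (ann r)] is finitely generated. *)
Lemma cond1_P_coherent : P_coherent R.
Proof.
apply/P_coherentP => r.
have [g [t [gg gt nx]]] := zero_dim_idem zd r.
have [f [ff fx [l [hl el]]]] := finite_decomposition (cond1_no_orthogonal c1) cond1_greatest_idem nx.
have hK := ann_ideal r.
have [ll [llK hll]] : exists ll, (forall a, a \in ll -> ann r a) /\
    forall e s, e \in l -> ann r s -> ideal_span ll (e * s).
  elim: l hl {el} => [|e l IH] hl; first by exists [::].
  have [k kl|ll [llK hll]] := IH; first by apply: hl; rewrite inE kl orbT.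
  have pe : primitive_idem e by apply: hl; rewrite inE eqxx.
  have ee : e * e = e by case: pe.
  have [||l' hl'] := @cond1_local_fg e (fun s => ann r s /\ e * s = s) pe.
  - split; first by rewrite mulr0; split => //; exact: (submod0 hK).
    move=> a x y [hx ex] [hy ey]; split; first exact: hK.2.
    by rewrite mulrDr ey -[a *: x]/(a * x) mulrCA ex.
  - by move=> s [].
  exists (l' ++ ll); split.
    by move=> a; rewrite mem_cat => /orP[/ideal_span_mem /hl' []|/llK].
  move=> k s; rewrite inE => /orP[/eqP -> sr|kl sr].
    apply: (@ideal_span_sub _ l'); first by move=> a al; rewrite mem_cat al.
    by apply/hl'; split; [exact: (submodZ hK e sr)|rewrite mulrA ee].
  apply: (@ideal_span_sub _ ll); first by move=> a al; rewrite mem_cat al orbT.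
  exact: hll.
have c0r : ann r ((1 - g) * f) by rewrite /ann mulrAC mulrC.
exists ((1 - g) * f :: ll) => s; split; last first.
  apply: ideal_span_min => // a; rewrite inE => /orP[/eqP -> //|]; exact: llK.
move=> sr; exists s, (\sum_(e <- l) e * s); split; last first.
  by rewrite big_seq; apply: (submod_sum (ideal_span_ideal ll)) => e el'; exact: hll.
rewrite -mulr_suml -el.
have sg : s * g = 0 by rewrite gt mulrA sr mul0r.
have -> : s * ((1 - g) * f) = s * f - s * g * f by ring.
by rewrite sg; ring.
Qed.

Lemma cond1_pure_semisimple (e : R) : primitive_idem e ->
  quot_pure_semisimple (principal_ideal (1 - e)).
Proof.
move=> pe; have [ee e0 _] := pe; have hm := local_max_maximal zd pe.
have hI : is_ideal (local_max e) by case: hm.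
have [||l hl] := @cond1_local_fg e (fun s => local_max e s /\ e * s = s) pe.
- split; first by rewrite mulr0; split => //; exact: (submod0 hI).
  move=> a x y [hx ex] [hy ey]; split; first exact: hI.2.
  by rewrite mulrDr ey -[a *: x]/(a * x) mulrCA ex.
- by move=> s [].
have lnil a : a \in l -> nilp_elt a.
  by move=> /ideal_span_mem /hl [+ ea]; rewrite /local_max ea.
(* [l'] lists the generators of the maximal ideal that may act nontrivially on [M]. Its head [g]
   kills M/gM, which shortens the list, and has a smaller nilpotency exponent on [g M]. *)
suff main (l' : seq R) : (forall a, a \in l' -> nilp_elt a) ->
   forall M : lmodType R, (forall x : M, e *: x = x) ->
     (forall a (x : M), a \in l -> a \notin l' -> a *: x = 0) -> pure_injective M.
  move=> M kM; apply: (main l lnil).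
    move=> x; apply/eqP; rewrite eq_sym -subr_eq0 -{1}(scale1r x) -scalerBl.
    by apply/eqP/kM; exists 1; rewrite mul1r.
  by move=> a x -> .
elim: l' => [|g l' IH] nl M eM kM.
  apply: (pi_killed_maximal hm) => a x ma.
  rewrite -(eM x) scalerA mulrC.
  have : local_max e (e * a) /\ e * (e * a) = e * a.
    by split; [exact: maximal_mull|rewrite mulrA ee].
  move=> /hl; apply: (ideal_span_min (I := fun s => s *: x = 0)).
    split; first exact: scale0r.
    by move=> r s s' h h'; rewrite scalerDl -[r *: s]/(r * s) -scalerA h h' scaler0 addr0.
  by move=> b bl; apply: kM.
have IH' := IH (fun a al => nl a (mem_behead (s := g :: l') al)).
have [k hk] := nl g (mem_head g l').
have : forall x : M, g ^+ k *: x = 0 by move=> x; rewrite hk scale0r.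
elim: k M eM kM {hk} => [|k IHk] M eM kM gk.
  apply: IH' => // a x _ _; rewrite -(scale1r x) -(expr0 g) gk; exact: scaler0.
have lg : is_lin (fun x : M => g *: x).
  by move=> r x y; rewrite scalerDr !scalerA mulrC.
have hG := range_submod lg.
have [N1 [i [li ii eN]]] := sub_exists hG.
have [N2 [p [lp sp kp]]] := quot_exists hG.
apply: (pure_injective_extension c1 li lp ii sp).
- by move=> y; rewrite kp eN.
- apply: IHk => [x|a x al al'|x]; apply: ii; rewrite (linZ li).
  + exact: eM.
  + by rewrite (lin0 li) kM.
  + have [y ->] := (eN (i x)).2 (ex_intro _ x erefl).
    by rewrite scalerA -exprSr gk (lin0 li).
- apply: IH' => [x|a x al al']; have [y <-] := sp x; rewrite -(linZ lp) ?eM //.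
  have [->|ag] := eqVneq a g; first by apply/kp; exists y.
  by rewrite kM ?(lin0 lp) // inE negb_or ag.
Qed.

Lemma cond1_cond5 : cond5 R.
Proof.
apply: (cond5_intro zd (cond1_no_orthogonal c1) cond1_greatest_idem).
exact: cond1_pure_semisimple.
Qed.
End Cond1Ring.

(** * RD-purity over arithmetical rings *)

Section Warfield.
Variables (R : comNzRingType).
Hypothesis arith : forall (m : R -> Prop) (a b : R), maximal_ideal m ->
  exists s, ~ m s /\ ((exists t, s * a = t * b) \/ (exists t, s * b = t * a)).

(** Over a valuation ring some entry divides all the others; [s] collects the denominators outside
    [m]. *)
Lemma arith_pivot (m : R -> Prop) (l : seq R) : maximal_ideal m -> l != [::] ->
  exists p s, [/\ p \in l, ~ m s & forall a, a \in l -> exists t, s * a = t * p].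
Proof.
move=> hm; elim: l => // a l IH _.
have [->|lne] := eqVneq l [::].
  exists a, 1; split; [exact: mem_head|by case: hm|].
  by move=> b; rewrite inE => /eqP ->; exists 1.
have [p [s [pl ms hp]]] := IH lne.
have [s' [ms' [[t ht]|[t ht]]]] := arith a p hm.
  exists p, (s * s'); split; first by rewrite inE pl orbT.
    by move=> h; apply: ms'; apply: (maximal_prime hm h).
  move=> b; rewrite inE => /orP[/eqP ->|/hp [t' ht']].
    by exists (s * t); rewrite -mulrA ht mulrA.
  by exists (s' * t'); rewrite mulrAC ht' mulrC mulrA.
exists a, (s * s'); split; first exact: mem_head.
  by move=> h; apply: ms'; apply: (maximal_prime hm h).
move=> b; rewrite inE => /orP[/eqP ->|/hp [t' ht']]; first by exists (s * s').
exists (t' * t); have -> : s * s' * b = s' * (s * b) by ring.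
have -> : t' * t * a = t' * (t * a) by ring.
by rewrite ht' -ht; ring.
Qed.

Lemma subr_swap (V : zmodType) (x y z w : V) : x - y - (z - w) = x - z - (y - w).
Proof. by rewrite !opprB addrACA [RHS]addrACA [- y - z]addrC. Qed.

(* Gaussian elimination, localised at m. *)
Lemma rd_pure_local (m : R -> Prop) (B : lmodType R) (A K : B -> Prop) (k : nat) :
  maximal_ideal m -> is_submod A -> is_submod K -> rd_sub_mod A K ->
  forall p n (r : 'I_p -> 'I_n -> R) (a : 'I_p -> B),
    (#|[set i | [exists j, r i j != 0%R]]| <= k)%N -> (forall i, A (a i)) ->
    (exists b : 'I_n -> B, forall i, K (\sum_(j < n) r i j *: b j - a i)) ->
    exists s (b : 'I_n -> B), [/\ ~ m s, forall j, A (b j) &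
       forall i, K (\sum_(j < n) r i j *: b j - s *: a i)].
Proof.
move=> hm hA hK rd; elim: k => [|k IH] p n r a hc ha [b hb].
  have r0 i j : r i j = 0.
    apply: contrapT => /eqP rij; move: hc; rewrite leqn0 cards_eq0 => /eqP /setP /(_ i).
    by rewrite !inE => /negbT /existsP; apply; exists j.
  exists 1, (fun=> 0); split; [by case: hm|by move=> j; exact: (submod0 hA)|].
  move=> i; rewrite scale1r big1 => [|j _]; last exact: scaler0.
  by have := hb i; rewrite big1 // => j _; rewrite r0 scale0r.
pose l := [seq r ij.1 ij.2 | ij <- enum [pred ij : 'I_p * 'I_n | r ij.1 ij.2 != 0]].
have [l0|lne] := eqVneq l [::].
  apply: (IH p n r a) => //; last by exists b.
  apply: leq_trans (leq0n k); rewrite leqn0 cards_eq0; apply/eqP/setP => i; rewrite !inE.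
  apply/existsP => -[j rij].
  have : r i j \in l by apply/mapP; exists (i, j) => //; rewrite mem_enum.
  by rewrite l0.
have [q [s [ql ms hq]]] := arith_pivot hm lne.
have [[i0 j0]] := mapP ql.
rewrite mem_enum inE /= => rij0 eq_q.
(* The multiplier is taken to be 0 at zero entries, so that zero rows stay zero under
   elimination. *)
have hq' i j : exists t, s * r i j = t * q /\ (r i j = 0 -> t = 0).
  have [->|rij] := eqVneq (r i j) 0; first by exists 0; rewrite mulr0 mul0r.
  have [|t ht] := hq (r i j); last by exists t; split => // r0; rewrite r0 eqxx in rij.
  by apply/mapP; exists (i, j) => //; rewrite mem_enum.
have [t' ht'] := choice (fun ij : 'I_p * 'I_n => hq' ij.1 ij.2).
pose t i j := t' (i, j).
have ht i j : s * r i j = t i j * q /\ (r i j = 0 -> t i j = 0) := ht' (i, j).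
(* In the pivot row [s] is also a valid multiplier, and it makes row [i0] of [r'] exactly zero. *)
pose T i := if i == i0 then s else t i j0.
have hT i : s * r i j0 = T i * q.
  by rewrite /T; case: eqVneq => [->|_]; [rewrite -eq_q|case: (ht i j0)].
pose r' i j := s * r i j - T i * r i0 j.
pose a' i := s *: a i - T i *: a i0.
pose S i (v : 'I_n -> B) := \sum_(j < n) r i j *: v j.
have S'E i v : \sum_(j < n) r' i j *: v j = s *: S i v - T i *: S i0 v.
  rewrite /S !scaler_sumr -sumrB; apply: eq_bigr => j _.
  by rewrite !scalerA -scalerBl.
have [|i||s1 [c [ms1 Ac hc']]] := IH p n r' a'.
- have : (#|[set i | [exists j, r i j != 0%R]] :\ i0| <= k)%N.
    move: hc; rewrite (cardsD1 i0) inE; have -> // : [exists j, r i0 j != 0].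
    by apply/existsP; exists j0.
  apply: leq_trans; apply: subset_leq_card; apply/fintype.subsetP => i.
  rewrite !inE => /existsP [j r'ij]; rewrite /r' /T in r'ij.
  have [ei|ne] := eqVneq i i0; first by rewrite ei eqxx subrr eqxx in r'ij.
  rewrite (negPf ne) in r'ij.
  apply/existsP; apply: contrapT => none.
  have r0 j' : r i j' = 0 by apply/eqP/negP => h; apply: none; exists j'; apply/negP.
  by move: r'ij; rewrite r0 (ht i j0).2 // mulr0 mul0r subrr eqxx.
- by apply: (submodB hA); apply: (submodZ hA).
- exists b => i; rewrite S'E.
  have := submodB hK (submodZ hK s (hb i)) (submodZ hK (T i) (hb i0)); congr K.
  by rewrite !scalerBr -/(S i b) -/(S i0 b) /a' subr_swap.
have [||x [Ax hx]] := rd q (s *: a i0).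
- exact: (submodZ hA).
- exists (\sum_(j < n) t i0 j *: b j).
  have := submodZ hK s (hb i0); congr K; rewrite scalerBr !scaler_sumr; congr (_ - _).
  by apply: eq_bigr => j _; rewrite !scalerA (ht i0 j).1 mulrC.
(* RD-purity gives [x] in [A] with [q *: x] congruent to [s *: a i0]; adding [e] in coordinate [j0]
   makes the pivot row hold without leaving [A]. *)
pose e := s1 *: x - \sum_(j < n) t i0 j *: c j.
pose v j := s *: (s *: c j + (if j == j0 then e else 0)).
exists (s * s * s1), v; split.
- by move=> /(maximal_prime hm) h; apply: ms1; apply: h => /(maximal_prime hm) /(_ ms).
- move=> j; apply: (submodZ hA); apply: (submodD hA); first exact: (submodZ hA).
  case: ifP => _; last exact: (submod0 hA).
  by apply: (submodB hA); [exact: (submodZ hA)|apply: (submod_sum hA) => k' _; exact: (submodZ hA)].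
move=> i.
have qe : q *: e = (q * s1) *: x - s *: S i0 c.
  rewrite scalerBr scalerA; congr (_ - _); rewrite /S !scaler_sumr.
  by apply: eq_bigr => j _; rewrite !scalerA (ht i0 j).1 mulrC.
have Sv : S i v = (s * s) *: S i c + T i *: (q *: e).
  rewrite /S scaler_sumr scalerA -hT.
  have -> : (s * r i j0) *: e = \sum_(j < n) (s * r i j) *: (if j == j0 then e else 0).
    rewrite (bigD1 j0) //= eqxx [X in _ + X]big1 ?addr0 // => j /negPf ->.
    exact: scaler0.
  rewrite -big_split /=; apply: eq_bigr => j _.
  by rewrite /v scalerA scalerDr !scalerA; congr (_ *: _ + _ *: _); ring.
have := submodD hK (submodZ hK s (hc' i)) (submodZ hK (T i * s1) hx); congr K.
rewrite -/(S i v) Sv qe S'E /a' !scalerBr !scalerA !opprB.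
have -> : T i * (q * s1) = T i * s1 * q by ring.
have -> : s * s1 * s = s * s * s1 by ring.
have -> : s * s1 * T i = T i * s1 * s by ring.
rewrite [s * T i]mulrC.
move: ((s * s) *: _) ((T i * s) *: _) ((T i * s1 * s) *: _) ((s * s * s1) *: _) ((T i * s1 * q) *: _).
move=> X1 X2 X3 X4 X5.
rewrite [X5 - X3]addrC -addrA [_ + (- X3 + X5)]addrA [X3 - X4]addrC addrK.
by rewrite [- X4 + X5]addrC addrA -[X1 - X2 + X5]addrA [- X2 + X5]addrC.
Qed.

(** The [s] for which the system with constants [s *: a i] is solvable in [A] form an ideal, which
    by the local solutions is contained in no maximal ideal. *)
Lemma rd_pure (B : lmodType R) (A K : B -> Prop) : is_submod A -> is_submod K ->
  rd_sub_mod A K -> pure_sub_mod A K.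
Proof.
move=> hA hK rd p n r a ha hb.
pose I s := exists b : 'I_n -> B, (forall j, A (b j)) /\
   forall i, K (\sum_(j < n) r i j *: b j - s *: a i).
have hI : is_ideal I.
  split.
    exists (fun=> 0); split; first by move=> _; exact: (submod0 hA).
    move=> i; rewrite big1 => [|j _]; last exact: scaler0.
    by rewrite scale0r subrr; exact: (submod0 hK).
  move=> x s s' [b [Ab hb1]] [b' [Ab' hb1']]; exists (fun j => x *: b j + b' j); split.
    by move=> j; exact: hA.2.
  move=> i; have := hK.2 x _ _ (hb1 i) (hb1' i); congr K.
  rewrite scalerBr addrACA -opprD scaler_sumr -big_split /= scalerA -scalerDl.
  by congr (_ - _); apply: eq_bigr => j _; rewrite scalerDr !scalerA mulrC.
suff [b [Ab hb1]] : I 1 by exists b; split => // i; rewrite -[a i]scale1r.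
apply: contrapT => nI; have [m [hm sm]] := maximal_ideal_exists hI nI.
have [s [b [ms Ab hb1]]] := rd_pure_local hm hA hK rd (leqnn _) ha hb.
by apply: ms; apply: sm; exists b.
Qed.
End Warfield.

(** * Rings over which pure-essential or RD-essential extensions are essential *)

Section Sequences.
Variables (R : comNzRingType) (V : lmodType R) (N : nat -> V -> Prop).
Hypothesis hN : forall n, is_submod (N n).

(** Modulo [seq_all], the product of the [N n], [seq_ev] becomes the direct sum of the V/N_n inside
    their product. *)
Definition seq_all (f : nat -> V) := forall n, N n (f n).
Definition seq_ev (f : nat -> V) := exists k, forall n, (k <= n)%N -> N n (f n).

Lemma seq_all_sub : is_submod seq_all.
Proof.
split; first by move=> n; exact: (submod0 (hN n)).
by move=> a f g hf hg n; apply: (hN n).2.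
Qed.

Lemma seq_ev_sub : is_submod seq_ev.
Proof.
split; first by exists 0%N => n _; exact: (submod0 (hN n)).
move=> a f g [k hk] [k' hk']; exists (maxn k k') => n; rewrite geq_max => /andP[/hk h /hk' h'].
exact: (hN n).2.
Qed.

Lemma seq_pure : pure_sub_mod seq_ev seq_all.
Proof.
move=> p q r a ha [b hb].
have [k hk] := choice ha.
pose K := \max_i k i.
exists (fun j n => if (n < K)%N then b j n else 0); split.
  by move=> j; exists K => n Kn; rewrite ltnNge Kn; exact: (submod0 (hN n)).
move=> i n.
have e (v : 'I_q -> (nat -> V)) : (\sum_(j < q) r i j *: v j - a i) n = \sum_(j < q) r i j *: v j n - a i n.
  by rewrite -[LHS]/((\sum_(j < q) r i j *: v j) n - a i n) fct_sumE.
rewrite e; have [nK|Kn] := ltnP n K; first by have := hb i n; rewrite e.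
rewrite big1 => [|j _]; last exact: scaler0.
rewrite sub0r; apply: (submodN (hN n)); apply: hk; apply: leq_trans Kn.
exact: (leq_bigmax i).
Qed.
End Sequences.

Section Cond23.
Variables (R : comNzRingType) (c23 : cond23 R).

(* (r n)_n, a limit of elements of the direct sum of the R/(r n nn) for the topology of the
   ideals r n R, cannot be killed by K and generates a submodule that avoids the sum. *)
Lemma no_descending (nn : R -> Prop) (r : nat -> R) : is_ideal nn -> ~ nn 1 ->
  (forall n, exists mu, nn mu /\ r n.+1 = mu * r n) ->
  (forall n s, s * r n = 0 -> nn s) -> False.
Proof.
move=> hn n1 hr ar.
pose I n : R^o -> Prop := fun a => exists mu, nn mu /\ a = mu * r n.
have hI n : is_submod (I n).
  split; first by exists 0; rewrite mul0r; split => //; exact: (submod0 hn).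
  move=> a _ _ [mu [h ->]] [mu' [h' ->]]; exists (a * mu + mu'); split; first exact: hn.2.
  by rewrite -[_ *: _]/(a * (mu * r n)); ring.
have Ir n s : I n (s * r n) -> nn s.
  move=> [mu [h e]]; rewrite -(subrK mu s); apply: (submodD hn) => //.
  by apply: (ar n); rewrite mulrBl e subrr.
have rD n k : exists c, r (n + k)%N = c * r n.
  elim: k => [|k [c IH]]; first by exists 1; rewrite addn0 mul1r.
  have [mu [_ e]] := hr (n + k)%N; exists (mu * c).
  by rewrite addnS e IH mulrA.
have rdiv n k : (n <= k)%N -> exists c, r k = c * r n.
  by move=> h; rewrite -(subnKC h); exact: rD.
have [K [hK NK KA rd ess]] := c23 (seq_ev_sub hI) (seq_all_sub hI) (seq_pure hI).
pose z : nat -> R^o := r.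
have key s m : seq_ev I m -> K (s *: z - m) -> seq_all I (s *: z - m).
  move=> em Km n.
  (* From index [k] on, [z] is divisible by [r k]. RD-purity modulo [K] moves the quotient into the
     sum, and multiples of [r k] vanish at coordinate [n], as [r k] lies in [nn * r n]. *)
  pose k := n.+1.
  have /choice [c hc] : forall j, exists c, (k <= j)%N -> r j = c * r k.
    move=> j; have [h|h] := leqP k j; last by exists 0.
    by have [c hc] := rdiv _ _ h; exists c.
  pose zl : nat -> R^o := fun j => if (k <= j)%N then 0 else r j.
  pose u : nat -> R^o := fun j => if (k <= j)%N then c j else 0.
  have ez : z = zl + r k *: u.
    apply/funext => j; rewrite -[RHS]/(zl j + r k * u j) /zl /u /z.
    case: ifP => h; first by rewrite add0r hc // mulrC.
    by rewrite mulr0 addr0.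
  have ezl : seq_ev I zl.
    by exists k => j kj; rewrite /zl kj; exact: (submod0 (hI j)).
  have eA := seq_ev_sub hI.
  have eB : seq_ev I (m - s *: zl) by apply: (submodB eA) => //; apply: (submodZ eA).
  have [|a' [ea' Ka']] := rd (r k) (m - s *: zl) eB.
    exists (s *: u); have := Km; congr K; rewrite ez scalerDr !scalerA [r k * s]mulrC.
    by rewrite opprB addrA [X in X - _]addrC.
  have := KA _ Ka' (submodB eA (submodZ eA (r k) ea') eB) n.
  rewrite -[(_ - _) n]/(r k * a' n - (m n - s * zl n)) -[(s *: z - m) n]/(s * r n - m n).
  rewrite /zl ltnn => h; have [mu [nmu ek]] := hr n.
  have h' : I n (r k * a' n).
    by exists (mu * a' n); rewrite /k ek; split; [rewrite mulrC; exact: (submodZ hn)|ring].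
  have := submodB (hI n) h h'; congr I.
  rewrite -[LHS]/(r k * a' n - (m n - s * r n) - r k * a' n) -[RHS]/(s * r n - m n). ring.
have nKz : ~ K z.
  move=> Kz; have := @key 1 0 (submod0 (seq_ev_sub hI)).
  rewrite scale1r subr0 => /(_ Kz 0%N).
  by rewrite /z -(mul1r (r 0%N)) => /Ir.
have [s [m [em Km nKs]]] := ess z nKz.
apply: nKs; apply: NK; have hs := key s m em Km.
have [k hk] := em.
have ns : nn s.
  apply: (Ir k); have := submodD (hI k) (hs k) (hk k (leqnn k)).
  by rewrite -[(s *: z - m) k]/(s * r k - m k) subrK.
by move=> n; exists s.
Qed.

Lemma cond23_zero_dim : zero_dim R.
Proof.
move=> r; apply: contrapT => nz.
have [nn [hnn nn1 nnr nnk]] := power_ideal nz.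
apply: (@no_descending nn (fun n => r ^+ n) hnn nn1).
  by move=> n; exists r; rewrite exprS.
by move=> n s; apply: nnk.
Qed.
Let zd := cond23_zero_dim.

(* The direct sum of the R/I_n, enlarged by the element (x, x, ...) of their product, embeds
   purely in product * cyclic module; the generator (0, 1) of the second factor is
   neither killed by the complement K nor essential over M. *)
Lemma cond23_no_orthogonal : no_orthogonal R.
Proof.
move=> x e ee orth; apply: contrapT => none.
pose I n : R -> Prop := fun a => exists s t, a = (1 - e n) * s + x * x * t.
have hI n : is_ideal (I n).
  split; first by exists 0, 0; rewrite !mulr0 addr0.
  move=> a _ _ [s [t ->]] [s' [t' ->]]; exists (a * s + s'), (a * t + t').
  by rewrite -[_ *: _]/(a * ((1 - e n) * s + x * x * t)); ring.
have Ix n : ~ I n x.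
  move=> [s [t ex]]; apply: none; exists n, (e n * t).
  rewrite {1}ex (_ : _ * (_ + _) = (e n - e n * e n) * s + x * x * (e n * t)); last by ring.
  by rewrite ee subrr mul0r add0r.
pose ev (P : nat -> Prop) := exists k, forall n, (k <= n)%N -> P n.
pose M (z : (nat -> R^o) * R^o) := ev (fun n => I n (z.1 n - z.2 * x)).
pose N (z : (nat -> R^o) * R^o) := (forall n, I n (z.1 n)) /\ ev (fun n => I n (z.2 * x)).
have hM : is_submod M.
  split; first by exists 0%N => n _; rewrite mul0r subrr; exact: (submod0 (hI n)).
  move=> a [f t] [g u] [k hk] [k' hk']; exists (maxn k k') => n.
  rewrite geq_max => /andP[/hk h /hk' h']; have := (hI n).2 a _ _ h h'; congr I.
  by rewrite -[LHS]/(a * (f n - t * x) + (g n - u * x)) -[RHS]/(a * f n + g n - (a * t + u) * x); ring.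
have hN : is_submod N.
  split.
    by split; [move=> n; exact: (submod0 (hI n))|exists 0%N => n _; rewrite mul0r; exact: (submod0 (hI n))].
  move=> a [f t] [g u] [hf [k hk]] [hg [k' hk']]; split; first by move=> n; apply: (hI n).2.
  exists (maxn k k') => n; rewrite geq_max => /andP[/hk h /hk' h'].
  have := (hI n).2 a _ _ h h'; congr I.
  by rewrite -[LHS]/(a * (t * x) + u * x) -[RHS]/((a * t + u) * x); ring.
have pMN : pure_sub_mod M N.
  move=> p q r a ha [b hb].
  have [k1 hk1] := choice ha.
  have [k2 hk2] := choice (fun i => (hb i).2).
  pose k := maxn (\max_i k1 i) (\max_i k2 i).
  exists (fun j => (fun n => if (n < k)%N then (b j).1 n else (b j).2 * x, (b j).2)); split.
    by move=> j; exists k => n kn; rewrite /= ltnNge kn subrr; exact: (submod0 (hI n)).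
  have lin1 n : is_lin (fun z : (nat -> R^o) * R^o => z.1 n : R^o) by [].
  have lin2 : is_lin (fun z : (nat -> R^o) * R^o => z.2 : R^o) by [].
  have s1 i (v : 'I_q -> (nat -> R^o) * R^o) n :
      (\sum_(j < q) r i j *: v j - a i).1 n = \sum_(j < q) r i j * (v j).1 n - (a i).1 n.
    by rewrite (linB (lin1 n)) (lin_sum (lin1 n)).
  have s2 i (v : 'I_q -> (nat -> R^o) * R^o) :
      (\sum_(j < q) r i j *: v j - a i).2 = \sum_(j < q) r i j * (v j).2 - (a i).2.
    by rewrite (linB lin2) (lin_sum lin2).
  move=> i; split; last first.
    by have [_] := hb i; rewrite !s2.
  move=> n; rewrite s1 /=; have [nk|kn] := ltnP n k.
    by have [] := hb i => /(_ n); rewrite s1.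
  move: kn; rewrite geq_max => /andP[kn1 kn2].
  have h1 := hk1 i n (leq_trans (leq_bigmax i) kn1).
  have h2 := hk2 i n (leq_trans (leq_bigmax i) kn2).
  have := submodB (hI n) h2 h1; congr I; rewrite s2 mulrBl mulr_suml.
  rewrite -[LHS]/(\sum_(j < q) r i j * (b j).2 * x - (a i).2 * x - ((a i).1 n - (a i).2 * x)).
  under [in RHS]eq_bigr => j _ do rewrite mulrA.
  by ring.
have [K [hK NK KM rd ess]] := c23 hM hN pMN.
(* [e n] carries all pairs into [M], because it lies in [I j] for [j > n], and it acts as the
   identity on R/I_n. *)
have K1 f t : K (f, t) -> forall n, I n (f n).
  move=> Kft n.
  have Mft : M (e n *: (f, t)).
    exists n.+1 => j nj; exists (e n * f j - e n * t * x), 0; rewrite mulr0 addr0.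
    rewrite -[LHS]/(e n * f j - e n * t * x).
    have en : e j * e n = 0 by apply: orth => h; rewrite h ltnn in nj.
    by rewrite mulrBl mul1r mulrBr !mulrA en !mul0r subrr subr0.
  have [/(_ n) h _] := KM _ (submodZ hK (e n) Kft) Mft.
  have h' : I n ((1 - e n) * f n) by exists (f n), 0; rewrite mulr0 addr0.
  have := submodD (hI n) h h'; congr I.
  by rewrite -[LHS]/(e n * f n + (1 - e n) * f n); ring.
(* If (0, 1) is in [K], the element ((x, x, ...), 1) of [M] is [x] times some (f, t) of [M] modulo
   [K]. For large [k], [f k] is [t x] modulo [I k], so [x] is in [I k] along with [x * x]. *)
have [K01|nK01] := pselect (K (0, 1)).
  have [||[f t] [Mft Kft]] := rd x ((fun=> x), 1).
  - by exists 0%N => n _; rewrite /= mul1r subrr; exact: (submod0 (hI n)).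
  - exists ((fun=> 1), 0).
    have := submodN hK K01; congr K.
    transitivity ((fun=> x * 1 - x : R^o) : nat -> R^o, x * 0 - 1 : R^o) => //.
    congr (_, _); last by rewrite mulr0 sub0r.
    by apply/funext => n; rewrite mulr1 subrr -[LHS]/(- (0 : R)) oppr0.
  have [k hk] := Mft.
  have h1 : I k (x * f k - x) by exact: (K1 _ _ Kft k).
  have h2 := submodZ (hI k) x (hk k (leqnn k)).
  apply: (Ix k).
  have h3 : I k (x * x * t) by exists 0, t; rewrite mulr0 add0r.
  have := submodD (hI k) (submodB (hI k) h2 h1) h3; congr I.
  by rewrite -[LHS]/(x * (f k - t * x) - (x * f k - x) + x * x * t); ring.
have [s [[f t] [Mft Km nKs]]] := ess _ nK01.
apply: nKs; rewrite -(subrK (f, t) (s *: (0, 1))); apply: (submodD hK) => //.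
apply: NK.
have hf n : I n (f n).
  have Kf : K (s *: (0 : nat -> R^o) - f, s * 1 - t) by [].
  have h : I n ((s *: (0 : nat -> R^o) - f) n) := K1 _ _ Kf n.
  rewrite -[f n]opprK; apply: (submodN (hI n)); move: h.
  by rewrite scaler0 -[X in I n X]/(0 - f n) sub0r.
split => //=; have [k hk] := Mft; exists k => n kn.
have := submodB (hI n) (hf n) (hk n kn); congr I.
by rewrite -[LHS]/(f n - (f n - t * x)); ring.
Qed.

(** * The local factors of R *)

Section Local.
Variable e : R.
Hypothesis pe : primitive_idem e.
Let mm := local_max e.
Let hm : maximal_ideal mm := local_max_maximal zd pe.
Let hI : is_ideal mm. Proof. by case: hm. Qed.

Lemma local_unit s : ~ mm s -> exists t, e * s * t = e.
Proof. by move=> ns; case: (primitive_local zd pe s). Qed.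

Lemma local_cancel s x : e * x = x -> s * x = 0 -> x <> 0 -> mm s.
Proof.
move=> ex sx x0; apply: contrapT => /local_unit [t ht]; apply: x0.
rewrite -ex -ht; have -> : e * s * t * x = e * t * (s * x) by ring.
by rewrite sx mulr0.
Qed.

(** Otherwise one can multiply [e] forever by elements of the maximal ideal without reaching 0.
    Annihilators of nonzero elements of [e R] lie in that ideal, so [no_descending] applies. *)
Lemma local_socle : exists u, [/\ e * u = u, u <> 0 & forall s, mm s -> s * u = 0].
Proof.
have [ee e0 _] := pe.
apply: contrapT => none.
pose T := {u | e * u = u /\ u <> 0}.
have /choice [c hc] : forall u : T, exists s, mm s /\ s * sval u <> 0.
  move=> [u [eu u0]] /=; apply: contrapT => nx; apply: none; exists u; split => // s ms.
  by apply: contrapT => su; apply: nx; exists s.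
have hnx (u : T) : e * (c u * sval u) = c u * sval u /\ c u * sval u <> 0.
  by split; [rewrite mulrCA (svalP u).1|case: (hc u)].
pose nx (u : T) : T := exist _ (c u * sval u) (hnx u).
pose L n := iter n nx (exist _ e (conj ee e0)).
have m1 : ~ mm 1 by case: hm.
apply: (@no_descending mm (fun n => sval (L n)) hI m1).
  by move=> n; exists (c (L n)); split; [case: (hc (L n))|].
by move=> n s h; apply: local_cancel h _; [exact: (svalP (L n)).1|exact: (svalP (L n)).2].
Qed.

Hypothesis coh : forall r : R, fg (ann r).

Lemma local_max_fg : fg mm.
Proof.
have [u [eu u0 hu]] := local_socle; have [l hl] := coh u.
exists l => s; rewrite -hl; split; first exact: hu.
by move=> h; apply: local_cancel h u0.
Qed.

(** Nakayama's lemma in [e R] relative to [q]: induct modulo [q + g R], then solve for [e * g],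
    whose coefficient is 1 minus an element of the maximal ideal. *)
Lemma nakayama l (q : R -> Prop) : is_ideal q ->
  (forall s, ideal_span l s -> exists a b,
     [/\ q a, ideal_mul mm (ideal_span l : R^o -> Prop) b & s = a + b]) ->
  forall s, ideal_span l s -> q (e * s).
Proof.
have [ee e0 _] := pe.
elim: l q => [|g l IH] q hq h s.
  by move=> /= ->; rewrite mulr0; exact: (submod0 hq).
pose q1 s := exists a d, q a /\ s = a + d * g.
have hq1 : is_ideal q1.
  split; first by exists 0, 0; rewrite mul0r addr0; split => //; exact: (submod0 hq).
  move=> r _ _ [a [d [qa ->]]] [a' [d' [qa' ->]]]; exists (r * a + a'), (r * d + d').
  by split; [exact: hq.2|rewrite -[_ *: _]/(r * (a + d * g)); ring].
have hspl := ideal_mul_sub mm (ideal_span_ideal l).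
have split_g : forall b : R^o, ideal_mul mm (ideal_span (g :: l) : R^o -> Prop) b ->
    exists c b', [/\ mm c, ideal_mul mm (ideal_span l : R^o -> Prop) b' & b = c * g + b'].
  apply: (@ideal_mul_ind R mm R^o (ideal_span (g :: l)) (fun b =>
    exists c b', [/\ mm c, ideal_mul mm (ideal_span l : R^o -> Prop) b' & b = c * g + b'])).
    split; first by exists 0, 0; rewrite mul0r addr0; split => //; [exact: (submod0 hI)|exact: (submod0 hspl)].
    move=> r _ _ [c [b' [mc hb' ->]]] [c1 [b1 [mc1 hb1 ->]]].
    exists (r * c + c1), (r * b' + b1); split; [exact: hI.2|exact: hspl.2|].
    by rewrite -[_ *: _]/(r * (c * g + b')); ring.
  move=> c _ mc [d [s' [-> hs']]]; exists (c * d), (c * s'); split.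
  - exact: maximal_mulr.
  - exact: ideal_mul_gen.
  - by rewrite -[LHS]/(c * (d * g + s')); ring.
have hl : forall s, ideal_span l s -> q1 (e * s).
  apply: IH => // s' hs'; have [a [b [qa hb ->]]] := h s' (ideal_span_cons g hs').
  have [c [b' [mc hb' ->]]] := split_g b hb.
  by exists (a + c * g), b'; split => //; [exists a, c|ring].
have hel : forall b : R^o, ideal_mul mm (ideal_span l : R^o -> Prop) b -> exists a d, [/\ q a, mm d & e * b = a + d * g].
  apply: (@ideal_mul_ind R mm R^o (ideal_span l) (fun b =>
    exists a d, [/\ q a, mm d & e * b = a + d * g])).
    split; first by exists 0, 0; rewrite mulr0 mul0r addr0; split => //; [exact: (submod0 hq)|exact: (submod0 hI)].
    move=> r x y [a [d [qa md ex]]] [a' [d' [qa' md' ey]]].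
    exists (r * a + a'), (r * d + d'); split; [exact: hq.2|exact: hI.2|].
    by rewrite -[r *: x]/(r * x) mulrDr mulrCA ex ey; ring.
  move=> c b mc /hl [a [d [qa eb]]]; exists (c * a), (c * d); split.
  - exact: (submodZ hq).
  - exact: maximal_mulr.
  - by rewrite -[c *: b]/(c * b) mulrCA eb; ring.
have qeg : q (e * g).
  have [a [b [qa hb eg]]] := h g (ideal_span_mem (mem_head g l)).
  have [c [b' [mc hb' eb]]] := split_g b hb.
  have [a' [d [qa' md eb']]] := hel b' hb'.
  have mcd : mm (c + d) by exact: (submodD hI).
  have [t ht] := local_unit (maximal_1B hm mcd).
  have e1 : e * (1 - (c + d)) * g = e * a + e * a'.
    have : e * g = e * a + e * (c * g) + e * (e * b').
      by rewrite [in LHS]eg eb !mulrDr !mulrA ee !addrA.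
    rewrite eb' => e2.
    have -> : e * (1 - (c + d)) * g = e * g - e * (c * g) - e * (d * g) by ring.
    by rewrite e2; ring.
  have -> : e * g = t * (e * (1 - (c + d)) * g) by rewrite -[in LHS]ht; ring.
  by rewrite e1; apply: (submodZ hq t); apply: (submodD hq); apply: (submodZ hq e).
move=> [d [s' [-> /hl [a [d' [qa es']]]]]].
rewrite mulrDr -[e * s'](_ : e * (e * s') = _); last by rewrite mulrA ee.
rewrite es' (_ : _ + _ = e * a + (d + d') * (e * g)); last by ring.
by apply: (submodD hq); [exact: (submodZ hq e)|exact: (submodZ hq (d + d'))].
Qed.

Hypothesis dep : forall (m I : R -> Prop) (a b : R), maximal_ideal m -> m a -> m b -> is_ideal I ->
  (forall r s, m r -> m s -> I (r * s)) ->
  exists s t, (~ m s \/ ~ m t) /\ I (s * a + t * b).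

Lemma local_principal : exists p, mm p /\ forall s, mm s -> exists t, e * s = p * t.
Proof.
have [l hl] := local_max_fg.
pose sq : R -> Prop := ideal_mul mm (mm : R^o -> Prop).
have hsq : is_ideal sq := ideal_mul_sub mm hI.
have sqm r s : mm r -> mm s -> sq (r * s) by move=> mr ms; apply: ideal_mul_gen.
have esq : sq = ideal_mul mm (ideal_span l : R^o -> Prop).
  by rewrite /sq; congr (@ideal_mul R mm R^o _); apply/funext => s; apply/propext.
suff [p [mp hp]] : exists p, mm p /\ forall b, mm b -> exists t c, sq c /\ b = p * t + c.
  exists p; split => // s /hl hs.
  apply: (@nakayama l (fun a => exists t, a = p * t) (principal_is_ideal p) _ s hs).
  move=> s' /hl /hp [t [c [hc ->]]]; exists (p * t), c; split => //; first by exists t.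
  by rewrite -esq.
have [all|/existsNP [p /not_implyP [mp np]]] := pselect (forall b, mm b -> sq b).
  exists 0; split; first exact: (submod0 hI).
  by move=> b /all h; exists 0, b; rewrite mul0r add0r.
exists p; split => // b mb.
have [s [t [ns hst]]] := dep hm mp mb hsq sqm.
have inv x y : ~ mm x -> mm y -> exists x', sq (y - x' * (x * y)).
  move=> nx my; case: hm => _ _ /(_ x nx) [x' hx']; exists x'.
  by rewrite (_ : _ - _ = (1 - x * x') * y); [exact: sqm|ring].
(* If [t] were in the maximal ideal, [s] would be invertible and [p] in the square, against its
   choice. So [t] is invertible and [b] is a multiple of [p] modulo the square. *)
have [mt|nt] := pselect (mm t).
  have ns' : ~ mm s by case: ns.
  have [s' hs'] := inv s p ns' mp; case: np.
  have := submodD hsq (submodD hsq hs' (submodZ hsq s' hst)) (submodN hsq (submodZ hsq s' (sqm _ _ mt mb))).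
  congr sq; rewrite -[LHS]/(p - s' * (s * p) + s' * (s * p + t * b) - s' * (t * b)); ring.
have [t' ht'] := inv t b nt mb.
exists (- (t' * s)), (b - t' * (t * b) + t' * (s * p + t * b)); split.
  exact: (submodD hsq ht' (submodZ hsq t' hst)).
ring.
Qed.

(** The aim is [X = M + K]. If [p ^+ j.+1] kills [x] modulo [K], then by induction [p x] comes from
    [M], RD-purity divides it by [p] there, and the difference [y] is killed by [p]; essentiality
    puts a unit multiple of [y] in [M], modulo [K]. *)
Lemma cond23_pure_semisimple : quot_pure_semisimple (principal_ideal (1 - e)).
Proof.
have [ee e0 _] := pe.
move=> M kM.
have eM (x : M) : e *: x = x.
  apply/eqP; rewrite eq_sym -subr_eq0 -{1}(scale1r x) -scalerBl.
  by apply/eqP/kM; exists 1; rewrite mul1r.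
have [p [mp hp]] := local_principal.
apply: pure_injective_split => X f lf jf pf.
have hA := range_submod lf.
have [K [hK _ dK rd ess]] := c23 hA (zero_submod X) pf.
have K0 m : K (f m) -> m = 0.
  by move=> h; apply: (inj_lin_eq0 lf jf); apply: dK => //; exists m.
have e1 : e * (1 - e) = 0 by rewrite mulrBr mulr1 ee subrr.
have K1 x : K ((1 - e) *: x).
  apply: contrapT => /ess [s [_ [[m ->] h nK]]]; apply: nK.
  suff m0 : m = 0 by rewrite -[_ *: _]subr0; have := h; rewrite m0 (lin0 lf).
  apply: K0; rewrite -[f m]opprK; apply: (submodN hK).
  have := submodZ hK e h; congr K.
  rewrite scalerBr !scalerA (_ : e * s * (1 - e) = s * (e * (1 - e))); last by ring.
  by rewrite e1 mulr0 scale0r sub0r -(linZ lf) eM.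
suff main : forall x, exists m, K (x - f m).
  have [r hr] := choice main.
  have uniq m m' x : K (x - f m) -> K (x - f m') -> m = m'.
    move=> h h'; apply/eqP; rewrite -subr_eq0; apply/eqP/K0.
    rewrite (linB lf); have := submodB hK h' h; congr K.
    by rewrite opprB addrC addrA subrK.
  exists r; split.
    move=> a x y; apply: (uniq _ _ (a *: x + y)) => //.
    have := hK.2 a _ _ (hr x) (hr y); congr K.
    by rewrite lf scalerBr addrACA -opprD.
  by move=> x; apply: (uniq _ _ (f x)) => //; rewrite subrr; exact: (submod0 hK).
have [k hk] := mp.
suff key : forall k x, K ((p ^+ k * e) *: x) -> exists m, K (e *: x - f m).
  move=> x; have [|m hm'] := key k x.
    have -> : p ^+ k * e = (e * p) ^+ k * e.
      elim: k {hk} => [|k IH]; rewrite ?expr0 // !exprS -[RHS]mulrA -IH -{1}ee; ring.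
    by rewrite hk mul0r scale0r; exact: (submod0 hK).
  exists m; have := submodD hK (K1 x) hm'; congr K.
  by rewrite addrA -scalerDl subrK scale1r.
elim=> [|j IH] x.
  rewrite expr0 mul1r => h; exists 0; by rewrite (lin0 lf) subr0.
rewrite exprSr -mulrA [p * e]mulrC mulrA -scalerA => /IH [m hm'].
have [||_ [[m' ->] h]] := rd p (f m).
- by exists m.
- by exists (e *: x); rewrite scalerA mulrC -scalerA.
pose y := e *: x - f m'.
have ey : e *: y = y by rewrite scalerBr scalerA ee -(linZ lf) eM.
have py : K (p *: y).
  have := submodB hK hm' h; congr K.
  by rewrite /y scalerBr !scalerA [e * p]mulrC opprB addrA subrK.
have [Ky|/ess [s [_ [[n ->] hs nK]]]] := pselect (K y); first by exists m'.
have ns : ~ mm s.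
  move=> /hp [t et]; apply: nK.
  by rewrite -ey scalerA mulrC et mulrC -scalerA; exact: (submodZ hK).
have [t ht] := local_unit ns.
exists (m' + t *: n).
have := submodZ hK t hs; congr K.
rewrite scalerBr scalerA -{1}ey scalerA (_ : t * s * e = e * s * t); last by ring.
by rewrite ht ey /y (linD lf) (linZ lf) opprD addrA.
Qed.
End Local.
End Cond23.

(** * Dependence modulo the square of the maximal ideal *)

Section Dependence.
Variable R : comNzRingType.
Variables (m I : R -> Prop) (a b : R).
Hypotheses (hm : maximal_ideal m) (ma : m a) (mb : m b) (hI : is_ideal I).
Hypothesis sqI : forall r s, m r -> m s -> I (r * s).

Lemma independent : ~ (exists s t, (~ m s \/ ~ m t) /\ I (s * a + t * b)) ->
  forall s t, I (s * a + t * b) -> m s /\ m t.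
Proof.
move=> none s t h; apply: contrapT => nst; apply: none; exists s, t; split => //.
by have [ms|] := pselect (m s); [right => mt; apply: nst|left].
Qed.

(* Otherwise the simple module generated by (a, b) in (R/I)^2 is RD-pure, yet an essential
   RD-quotient would have to kill both (a, 0) and (0, b). *)
Lemma cond3_dependent : cond3 R -> exists s t, (~ m s \/ ~ m t) /\ I (s * a + t * b).
Proof.
move=> c3; apply: contrapT => /independent indep.
have hmI : is_ideal m by case: hm.
have m1 : ~ m 1 by case: hm.
have I0 : I 0 := submod0 hI.
have indep1 s : I (s * a) -> m s.
  by move=> h; have [|//] := @indep s 0; rewrite mul0r addr0.
have indep2 t : I (t * b) -> m t.
  by move=> h; have [|//] := @indep 0 t; rewrite mul0r add0r.
pose N (z : R^o * R^o) := I z.1 /\ I z.2.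
have hN : is_submod N.
  split; first by [].
  by move=> r [f g] [f' g'] [/= h1 h2] [/= h1' h2']; split; apply: hI.2.
pose M (z : R^o * R^o) := exists t, I (z.1 - t * a) /\ I (z.2 - t * b).
have hM : is_submod M.
  split; first by exists 0; rewrite !mul0r subrr.
  move=> r [f g] [f' g'] [t [/= h1 h2]] [t' [/= h1' h2']]; exists (r * t + t'); split.
    have := hI.2 r _ _ h1 h1'; congr I.
    by rewrite -[LHS]/(r * (f - t * a) + (f' - t' * a)) -[RHS]/(r * f + f' - (r * t + t') * a); ring.
  have := hI.2 r _ _ h2 h2'; congr I.
  by rewrite -[LHS]/(r * (g - t * b) + (g' - t' * b)) -[RHS]/(r * g + g' - (r * t + t') * b); ring.
have mM r z : m r -> M z -> N (r *: z).
  case: z => f g mr [t [h1 h2]]; split.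
    have := submodD hI (submodZ hI r h1) (submodZ hI t (sqI mr ma)); congr I.
    by rewrite -[LHS]/(r * (f - t * a) + t * (r * a)) -[RHS]/(r * f); ring.
  have := submodD hI (submodZ hI r h2) (submodZ hI t (sqI mr mb)); congr I.
  by rewrite -[LHS]/(r * (g - t * b) + t * (r * b)) -[RHS]/(r * g); ring.
have rdM : rd_sub_mod M N.
  move=> r a0 Ma0 [[b1 b2] [hb1 hb2]].
  have [mr|nr] := pselect (m r); last first.
    have [_ _ /(_ r nr) [r' hr']] := hm.
    exists (r' *: a0); split; first exact: (submodZ hM).
    have := submodN hN (mM _ _ hr' Ma0); congr N.
    by rewrite scalerBl scale1r scalerA opprB.
  exists 0; split; first exact: (submod0 hM).
  rewrite scaler0 sub0r; apply: (submodN hN).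
  case: a0 Ma0 hb1 hb2 => f g [t [h1 h2]] hb1 hb2.
  have k1 : I (r * b1 - t * a).
    have := submodD hI hb1 h1; congr I.
    by rewrite -[LHS]/(r * b1 - f + (f - t * a)); ring.
  have k2 : I (r * b2 - t * b).
    have := submodD hI hb2 h2; congr I.
    by rewrite -[LHS]/(r * b2 - g + (g - t * b)); ring.
  have mt : m t.
    apply: contrapT => nt.
    have nb1 : ~ m b1.
      move=> mb1; apply: nt; apply: indep1.
      have := submodB hI (sqI mr mb1) k1; congr I.
      by rewrite -[LHS]/(r * b1 - (r * b1 - t * a)); ring.
    have [_ h] : m (- (b2 * t)) /\ m (b1 * t).
      apply: indep; have := submodB hI (submodZ hI b2 k1) (submodZ hI b1 k2); congr I.
      by rewrite -[LHS]/(b2 * (r * b1 - t * a) - b1 * (r * b2 - t * b)); ring.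
    by apply: nt; apply: (maximal_prime hm h).
  split.
    have := submodD hI h1 (sqI mt ma); congr I.
    by rewrite -[LHS]/(f - t * a + t * a) subrK.
  have := submodD hI h2 (sqI mt mb); congr I.
  by rewrite -[LHS]/(g - t * b + t * b) subrK.
have [K [hK NK KM rd ess]] := cond3_rel c3 hM hN rdM.
(* If [c *: v] were not in [K], a multiple of it outside [K] would come from [M]; by RD-purity it
   would be [c] times an element of [M] modulo [K], hence 0. With (a, 0) and (0, b), [K] contains
   (a, b), which is in [M] but not in [N]. *)
have aux c (v : R^o * R^o) : m c -> (forall s, m s -> N (s *: (c *: v))) -> K (c *: v).
  move=> mc hv; apply: contrapT => /ess [s [w [Mw h nK]]].
  have [ms|ns] := pselect (m s); first by apply: nK; apply: NK; exact: hv.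
  have [|a' [Ma' h']] := rd c w Mw.
    by exists (s *: v); rewrite scalerA mulrC -scalerA.
  have Kw : K w.
    have := submodB hK (NK _ (mM _ _ mc Ma')) h'; congr K.
    by rewrite opprB addrC subrK.
  by apply: nK; rewrite -(subrK w (s *: _)); exact: (submodD hK).
have Ka : K (a *: (1, 0)).
  apply: aux => // s ms; split; last by rewrite /= !scaler0.
  by rewrite -[X in I X]/(s * (a * 1)) mulr1; exact: sqI.
have Kb : K (b *: (0, 1)).
  apply: aux => // s ms; split; first by rewrite /= !scaler0.
  by rewrite -[X in I X]/(s * (b * 1)) mulr1; exact: sqI.
have [|Na _] := KM _ (submodD hK Ka Kb).
  exists 1; split.
    by rewrite -[X in I X]/(a * 1 + b * 0 - 1 * a) mulr0 mulr1 addr0 mul1r subrr.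
  by rewrite -[X in I X]/(a * 0 + b * 1 - 1 * b) mulr0 mulr1 add0r mul1r subrr.
apply: m1; apply: indep1; move: Na.
by rewrite -[X in I X]/(a * 1 + b * 0) mulr0 mulr1 addr0 mul1r.
Qed.

(* Otherwise the preprojective Kronecker modules Y_n = R^n / (I^n, a d_j - b d_(j+1)),
   on which the relation "a y = b y'" is nilpotent, give a nonessential pure-essential
   extension of their direct sum: in their product, the family of the b d_0 is a limit of
   finite families for the topology defined by the iterates of that relation. *)
Lemma cond2_dependent : cond2 R -> exists s t, (~ m s \/ ~ m t) /\ I (s * a + t * b).
Proof.
move=> c2; apply: contrapT => /independent indep.
have hmI : is_ideal m by case: hm.
have m1 : ~ m 1 by case: hm.
have I0 : I 0 := submod0 hI.
(* [al j] is the coefficient of the relation [a d_(j-1) - b d_j], for [0 < j < n]; its zero values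
   at 0 and [n] give one formula for all coordinates. Coordinates from [n] on are ignored. *)
pose N n (u : nat -> R^o) := exists al : nat -> R, [/\ al 0%N = 0, al n = 0 &
  forall i, (i < n)%N -> I (u i - (a * al i.+1 - b * al i))].
have hN n : is_submod (N n).
  split; first by exists (fun=> 0); split => // i _; rewrite !mulr0 subrr subrr.
  move=> r f g [al [h1 h2 h3]] [al' [h1' h2' h3']].
  exists (fun i => r * al i + al' i); split.
  - by rewrite h1 h1' mulr0 addr0.
  - by rewrite h2 h2' mulr0 addr0.
  - move=> i ni; have := hI.2 r _ _ (h3 i ni) (h3' i ni); congr I.
    rewrite -[LHS]/(r * (f i - (a * al i.+1 - b * al i)) + (g i - (a * al' i.+1 - b * al' i))).
    by rewrite -[(r *: f + g) i]/(r * f i + g i); ring.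
have [K [hK NK KM pu ess]] := cond2_rel c2 (seq_ev_sub hN) (seq_all_sub hN) (seq_pure hN).
pose d j : nat -> R^o := dirac j (1 : R^o).
pose z : nat -> (nat -> R^o) := fun=> b *: d 0%N.
have Nb n s : N n (s *: (b *: d 0%N)) -> (0 < n)%N -> m s.
  move=> [al [al0 aln h]] n0; have := h 0%N n0.
  rewrite -[X in X - _]/(s * (b * d 0%N 0%N)) /d diracE al0 => h'.
  suff [_ //] : m (- al 1%N) /\ m s.
  by apply: indep; move: h'; congr I; ring.
have Nm n s : m s -> N n (s *: (b *: d 0%N)).
  move=> ms; exists (fun=> 0); split => // i _.
  rewrite -[X in X - _]/(s * (b * d 0%N i)) !mulr0 subrr subr0 mulrA mulrC.
  by apply: (submodZ hI); apply: sqI.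
(* By independence, [a u_i = b u_(i+1)] in [Y_n] makes [u_i(j)] and [u_(i+1)(j+1)] agree modulo [m],
   and [u_i(n-1)] vanish there. Following the diagonals, all coordinates of [u_0] are in [m], so
   [b u_0 = 0]. *)
have nilpotent_rel n (u : nat -> (nat -> R^o)) :
    (forall i, (i < n)%N -> N n (a *: u i - b *: u i.+1)) -> N n (b *: u 0%N).
  move=> hu.
  have step i : (i < n)%N -> exists al : nat -> R, [/\ al 0%N = 0, al n = 0 &
      forall j, (j < n)%N -> m (u i j - al j.+1) /\ m (u i.+1 j - al j)].
    move=> ni; have [al [al0 aln h]] := hu i ni; exists al; split => // j nj.
    have [h1 h2] : m (u i j - al j.+1) /\ m (al j - u i.+1 j).
      apply: indep; have := h j nj; congr I.
      by rewrite -[X in X - _]/(a * u i j - b * u i.+1 j); ring.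
    by split => //; exact: submodBC h2.
  have mu k : forall i j, (i + k < n)%N -> (j + k)%N = n.-1 -> m (u i j).
    elim: k => [|k IH] i j.
      rewrite !addn0 => ni jn; have [al [al0 aln h]] := step i ni.
      have nj : (j < n)%N by rewrite jn; case: (n) ni.
      have [] := h j nj; rewrite jn prednK ?aln ?subr0 //; exact: leq_ltn_trans ni.
    rewrite !addnS => ni jn.
    have ni' : (i < n)%N by apply: leq_ltn_trans ni; rewrite -addnS leq_addr.
    have [al [al0 aln h]] := step i ni'.
    have nj : (j.+1 < n)%N.
      have n0 : (0 < n)%N by exact: leq_ltn_trans ni.
      by rewrite -(prednK n0) -jn ltnS ltnS leq_addr.
    have [h1 _] := h j (ltnW nj); have [_ h2] := h j.+1 nj.
    have h3 : m (u i.+1 j.+1) by apply: IH; rewrite addSn.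
    have := submodD hmI h1 (submodB hmI h3 h2); congr m.
    by rewrite -[LHS]/(u i j - al j.+1 + (u i.+1 j.+1 - (u i.+1 j.+1 - al j.+1))); ring.
  exists (fun=> 0); split => // j nj.
  rewrite !mulr0 subrr subr0 -[X in I X]/(b * u 0%N j).
  apply: sqI => //; apply: (mu (n.-1 - j)%N).
    by rewrite add0n; apply: leq_ltn_trans (leq_subr _ _) _; rewrite ltn_predL; exact: leq_ltn_trans nj.
  by rewrite subnKC //; rewrite -ltnS prednK //; exact: leq_ltn_trans nj.
have key s w : seq_ev N w -> K (s *: z - w) -> seq_all N (s *: z - w).
  move=> ew Kw n.
  pose k := n.+1.
  pose zl : nat -> (nat -> R^o) := fun j => if (k <= j)%N then 0 else z j.
  pose x j : nat -> (nat -> R^o) := fun n' => if (k <= n')%N then d j else 0.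
  have ez : z = zl + b *: x 0%N.
    apply/funext => j; rewrite -[RHS]/(zl j + b *: x 0%N j) /zl /x /z.
    by case: ifP => _; rewrite ?add0r // scaler0 addr0.
  have ezl : seq_ev N zl.
    by exists k => j kj; rewrite /zl kj; exact: (submod0 (hN j)).
  have hev := seq_ev_sub hN; have hall := seq_all_sub hN.
  have ec : seq_ev N (s *: zl - w) by apply: (submodB hev) => //; apply: (submodZ hev).
  have Nx j : (j.+1 < k)%N -> seq_all N (a *: x j - b *: x j.+1).
    move=> jk n'; rewrite -[X in N n' X]/(a *: x j n' - b *: x j.+1 n') /x.
    case: ifP => kn; last by rewrite !scaler0 subrr; exact: (submod0 (hN n')).
    exists (d j.+1); rewrite /d; split.
    - by rewrite dirac_neq.
    - by rewrite dirac_neq // => e; rewrite -e ltnNge kn in jk.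
    - move=> i _; rewrite -[(_ - _) i]/(a * dirac j (1 : R^o) i - b * dirac j.+1 (1 : R^o) i).
      suff -> : dirac j (1 : R^o) i = dirac j.+1 (1 : R^o) i.+1 by rewrite subrr.
      have [->|ij] := pselect (i = j); first by rewrite !diracE.
      by rewrite !dirac_neq // => -[].
  pose r (i j : 'I_k) : R := (if j.+1 == i :> nat then a else 0) - (if j == i then b else 0).
  pose c (i : 'I_k) := if i == ord0 then s *: zl - w else 0.
  have rE (y : nat -> (nat -> (nat -> R^o))) (i : 'I_k) : \sum_(j < k) r i j *: y j =
      (if val i is i'.+1 then a *: y i' else 0) - b *: y i.
    rewrite /r; under eq_bigr => j _ do rewrite scalerBl.
    rewrite sumrB; congr (_ - _); last first.
      rewrite (bigD1 i) //= eqxx big1 ?addr0 // => j /negPf ->; exact: scale0r.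
    case: i => -[|i'] ik /=; first by rewrite big1 // => j _; rewrite scale0r.
    have ik' : (i' < k)%N by exact: ltnW.
    rewrite (bigD1 (Ordinal ik')) //= eqxx big1 ?addr0 // => j jne.
    case: eqP => [[e]|_]; last exact: scale0r.
    by case/eqP: jne; apply: val_inj.
  have [|| y [ey Ky]] := pu k k r c.
  - by move=> i; rewrite /c; case: ifP => _ //; exact: (submod0 hev).
  - exists (fun j => s *: x j) => i; rewrite (rE (fun j => s *: x j)) /c.
    case: i => -[|i'] ik /=.
      have := submodN hK Kw; congr K; rewrite ez scalerDr sub0r.
      by rewrite !scalerA [b * s]mulrC !opprD !opprK -addrA addrC -addrA; congr (_ + _); rewrite addrC.
    rewrite subr0; apply: NK; have := submodZ hall s (Nx i' ik); congr seq_all.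
    by rewrite scalerBr !scalerA mulrC [b * s]mulrC.
  pose y' j : nat -> (nat -> R^o) := if @insub _ (fun j => (j < k)%N) _ j is Some i then y i else 0.
  have ey' (i : 'I_k) : y' i = y i by rewrite /y' valK.
  have Ny (i : 'I_k) : seq_all N ((if val i is i'.+1 then a *: y' i' else 0) - b *: y' i - c i).
    rewrite -rE; have e : \sum_(j < k) r i j *: y' j = \sum_(j < k) r i j *: y j.
      by apply: eq_bigr => j _; rewrite ey'.
    rewrite e; apply: (KM _ (Ky i)); apply: (submodB hev).
      by apply: (submod_sum hev) => j _; exact: (submodZ hev).
    by rewrite /c; case: ifP => _ //; exact: (submod0 hev).
  have h0 := Ny ord0 n.
  have hb : N n (b *: y' 0%N n).
    apply: (@nilpotent_rel n (fun j => y' j n)) => i ni.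
    have := Ny (Ordinal (ni : (i.+1 < k)%N)) n; rewrite /= /c /= subr0.
    by [].
  have := submodN (hN n) (submodD (hN n) h0 hb); congr (N n).
  rewrite /c /= -[LHS]/(- (0 - b *: y' 0%N n - (s *: zl n - w n) + b *: y' 0%N n)).
  rewrite -[RHS]/(s *: z n - w n) /zl ltnn.
  by rewrite sub0r addrAC addNr add0r opprK.
have nKz : ~ K z.
  move=> Kz; have := @key 1 0 (submod0 (seq_ev_sub hN)).
  rewrite scale1r subr0 => /(_ Kz 1%N); rewrite -[z 1%N]scale1r => /Nb /(_ isT).
  exact: m1.
have [s [w [ew Kw nK]]] := ess z nKz.
have hs := key s w ew Kw; have [k hk] := ew.
have ms : m s.
  apply: (Nb k.+1) => //.
  have := submodD (hN k.+1) (hs k.+1) (hk k.+1 (leqnSn k)).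
  by rewrite -[(s *: z - w) k.+1]/(s *: z k.+1 - w k.+1) subrK.
by apply: nK; apply: NK => n; exact: Nm.
Qed.
End Dependence.

(** * The equivalences and the two consequences *)

Section Implications.
Variable R : comNzRingType.

Lemma cond23_cond5 : cond23 R -> P_coherent R ->
  (forall (m I : R -> Prop) (a b : R), maximal_ideal m -> m a -> m b -> is_ideal I ->
     (forall r s, m r -> m s -> I (r * s)) ->
     exists s t, (~ m s \/ ~ m t) /\ I (s * a + t * b)) -> cond5 R.
Proof.
move=> c23 /P_coherentP coh dep; have zd := cond23_zero_dim c23.
apply: (cond5_intro zd (cond23_no_orthogonal c23) (fg_greatest_idem zd coh)).
by move=> e pe; apply: cond23_pure_semisimple.
Qed.

Lemma cond2_cond5 : cond2 R -> cond5 R.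
Proof.
move=> c2; apply: (cond23_cond5 (cond2_23 c2) c2.1) => m I a b hm ma mb hI sqI.
exact: cond2_dependent.
Qed.

Lemma cond3_cond5 : cond3 R -> cond5 R.
Proof.
move=> c3; apply: (cond23_cond5 (cond3_23 c3) c3.1) => m I a b hm ma mb hI sqI.
exact: cond3_dependent.
Qed.

Lemma cond5_cond1 : cond5 R -> cond1 R.
Proof. by move=> /cond5_cond4; exact: cond4_cond1. Qed.

Lemma cond1_rd_pure (B : lmodType R) (A : B -> Prop) : cond1 R -> is_submod A ->
  rd_sub A -> pure_sub A.
Proof.
move=> c1 hA; apply: rd_pure => //; last exact: zero_submod.
by move=> m a b; exact: cond1_arithmetical.
Qed.

Lemma cond5_cond2 : cond5 R -> cond2 R.
Proof.
move=> c5; split; first exact/cond1_P_coherent/cond5_cond1.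
by move=> B A hA; have [E hE] := cond5_flat_ideal c5; exact: flat_ideal_essential hE _ _ hA.
Qed.

(** RD-pure submodules are pure here, and purity modulo [K] implies RD-purity, so RD-essential
    extensions are pure-essential. *)
Lemma cond5_cond3 : cond5 R -> cond3 R.
Proof.
move=> c5; have [coh ess] := cond5_cond2 c5; split => // B A hA [rdA eA].
apply: ess => //; split; first exact: (cond1_rd_pure (cond5_cond1 c5)).
by move=> K hK dK pK; apply: eA => //; apply: pure_rd.
Qed.

Lemma flat_P_flat (F : lmodType R) : flat F -> P_flat F.
Proof.
move=> hF r x rx.
have [|n [a [y [h1 h2]]]] := hF 1%N (fun=> r) (fun=> x); first by rewrite big_ord1.
exists n, (a ord0), y; split; first exact: h1.
by move=> j; have := h2 j; rewrite big_ord1.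
Qed.

Lemma cond1_cond7 : cond1 R -> cond7 R.
Proof.
move=> c1 M wM.
have PM : pure_injective M by apply: c1 => F /flat_P_flat; exact: wM.
move=> A B f g lf lg jf rdf; apply: PM => //.
by apply: cond1_rd_pure => //; exact: range_submod.
Qed.
End Implications.

Theorem theorem3p9 (R : comNzRingType) :
  [/\ cond1 R <-> cond2 R,
      cond1 R <-> cond3 R,
      cond1 R <-> cond4 R,
      cond1 R <-> cond5 R
    & (cond1 R -> cond6 R /\ cond7 R)].
Proof.
have h15 : cond1 R -> cond5 R by move=> c1; exact: cond1_cond5.
have h51 : cond5 R -> cond1 R by exact: cond5_cond1.
split; first by split=> [/h15 /cond5_cond2|/cond2_cond5 /h51].
- by split=> [/h15 /cond5_cond3|/cond3_cond5 /h51].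
- by split=> [/h15 /cond5_cond4|/cond4_cond1].
- by split.
- move=> c1; split; last exact: cond1_cond7.
  have [E hE] := cond5_flat_ideal (h15 c1).
  exact: (flat_ideal_cond6 hE).
Qed.
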